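(* Consider the 2-user MISO broadcast channel with a random time-varying jammer described in the context, with $\lambda_1,\lambda_2>0$ the probabilities that receivers 1 and 2, respectively, are not jammed, in the CSIT-JSIT configuration $\mathsf{DN}$ (delayed CSIT, no JSIT). (i) If $\frac{|\lambda_1-\lambda_2|}{\lambda_1\lambda_2}\le 1$, then every pair $(d_1,d_2)$ of non-negative real numbers satisfying $$d_1+\frac{2\max(1,\lambda_1/\lambda_2)-1}{1+\lambda_2}\,d_2\le\lambda_1,\qquad \frac{2\max(1,\lambda_2/\lambda_1)-1}{1+\lambda_1}\,d_1+d_2\le\lambda_2$$ belongs to the degrees-of-freedom region. (ii) If $\frac{|\lambda_1-\lambda_2|}{\lambda_1\lambda_2}>1$, then every pair $(d_1,d_2)$ of non-negative real numbers satisfying $$\frac{d_1}{\lambda_1}+\frac{d_2}{\lambda_2}\le1$$ belongs to the degrees-of-freedom region.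
   Context: **Channel.** A transmitter with 2 antennas sends independent, uniformly distributed messages $W_1,W_2$ to two single-antenna receivers. At time $t=1,2,\dots$ receiver $k\in\{1,2\}$ observes $$Y_k(t)=\mathbf H_k(t)\mathbf X(t)+S_k(t)\,\mathbf G_k(t)\mathbf J(t)+N_k(t),$$ where $\mathbf X(t)\in\mathbb C^{2}$ is the channel input, subject to $E|\mathbf X(t)|^2\le P_T$; $\mathbf H_k(t)\in\mathbb C^{1\times 2}$ is the channel from transmitter to receiver $k$; $\mathbf G_k(t)\in\mathbb C^{1\times 2}$ is the channel from the jammer to receiver $k$; $\mathbf J(t)\in\mathbb C^2$ is the jammer's signal, of power $P_T$ (its distribution is otherwise arbitrary); $N_k(t)\sim\mathcal{CN}(0,1)$ is noise, i.i.d. over time and independent across receivers. The vectors $\mathbf H_k(t)$, $\mathbf G_k(t)$ have continuous distributions (i.e. with a density) with identity covariance, not depending on $P_T$, are i.i.d. over time and independent across $k$. The noise, the messages, $\mathbf H$, and the triple $(S,\mathbf J,\mathbf G)$ are mutually independent; arbitrary correlations among $S,\mathbf J,\mathbf G$ are allowed. **Jammer state.** $S(t)=(S_1(t),S_2(t))\in\{0,1\}^2$ is i.i.d. over time; $S_k(t)=1$ means receiver $k$ is jammed at time $t$ and $S_k(t)=0$ means it is not. $\lambda_{ij}=\Pr(S(t)=(i,j))$, fixed, not depending on $P_T$. $\lambda_1=\lambda_{00}+\lambda_{01}$ and $\lambda_2=\lambda_{00}+\lambda_{10}$ are the probabilities that receivers 1 and 2, respectively, are not jammed. **Information at the terminals.**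 Write $\mathbf H(t)=(\mathbf H_1(t),\mathbf H_2(t))$, $\mathbf H^{t}=(\mathbf H(1),\dots,\mathbf H(t))$, $S^{t}=(S(1),\dots,S(t))$. Both receivers know $\mathbf H^n$ and $S^n$ (for the whole block of length $n$). Nobody knows $\mathbf G$. The transmitter always knows the statistics of $S(t)$. In configuration $\mathsf{DN}$ the transmitter at time $t$ knows the past channels $\mathbf H^{t-1}$ and no realizations of the jammer states, i.e. $\mathbf X(t)$ is a function of $(W_1,W_2,\mathbf H^{t-1})$. **DoF region.** For fixed $P_T$, a rate pair $(R_1,R_2)$, $R_k=\frac1n\log|W_k|$ ($|W_k|$ the number of values of message $W_k$), is achievable if there are encoders (respecting the configuration and the power constraint) and decoders $g_k^{(n)}(Y_k^n,\mathbf H^n,S^n)$ whose error probabilities $\Pr(W_k\ne g_k^{(n)})$ tend to $0$ as $n\to\infty$ for $k=1,2$. The degrees-of-freedom region is the set of all $(d_1,d_2)$ with $d_k=\lim_{P_T\to\infty}\frac{R_k}{\log P_T}$ for achievable rate pairs $(R_1,R_2)=(R_1(P_T),R_2(P_T))$. *)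

(* Defs.v *)
From HB Require Import structures.
From mathcomp Require Import all_boot all_order all_algebra.
From mathcomp Require Import all_classical all_reals all_analysis.
From mathcomp Require Import complex.
Import Order.TTheory GRing.Theory Num.Theory.
Import numFieldNormedType.Exports.

Set Implicit Arguments.
Unset Strict Implicit.
Unset Printing Implicit Defensive.

Local Open Scope classical_set_scope.
Local Open Scope ring_scope.
Local Open Scope complex_scope.

Definition complex_display : measure_display -> measure_display.
Proof. exact. Qed.

Section measurable_complex.
Variable R : realType.

HB.instance Definition _ := isPointed.Build R[i] 0.

Definition complex_coords (z : R[i]) : R * R := (complex.Re z, complex.Im z).

Let measC : set (set R[i]) :=
  preimage_set_system setT complex_coords measurable.

Let sigma_measC : sigma_algebra setT measC.
Proof. exact/sigma_algebra_preimage/sigma_algebra_measurable. Qed.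

Let measC0 : measC set0. Proof. by case: sigma_measC. Qed.

Let measCC A : measC A -> measC (~` A).
Proof. by move=> mA; rewrite -setTD; case: sigma_measC => _ + _; exact. Qed.

Let measCU (F : (set R[i])^nat) :
  (forall n, measC (F n)) -> measC (\bigcup_n F n).
Proof. by case: sigma_measC => _ _; exact. Qed.

HB.instance Definition _ :=
  @isMeasurable.Build (complex_display default_measure_display) R[i] measC
    measC0 measCC measCU.

End measurable_complex.

Definition matrix_display : measure_display -> measure_display.
Proof. exact. Qed.

Section measurable_matrix.
Context {d} {T : measurableType d}.
Variables m n : nat.

(* The product sigma-algebra, generated by the entries. *)
Let measM : set (set 'M[T]_(m, n)) :=
  <<s \bigcup_(ij in [set: 'I_m * 'I_n])
        preimage_set_system setT (fun A : 'M[T]_(m, n) => A ij.1 ij.2)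
          measurable >>.

Let measM0 : measM set0. Proof. exact: sigma_algebra0. Qed.

Let measMC A : measM A -> measM (~` A). Proof. exact: sigma_algebraC. Qed.

Let measMU (F : (set 'M[T]_(m, n))^nat) :
  (forall k, measM (F k)) -> measM (\bigcup_k F k).
Proof. exact: sigma_algebra_bigcup. Qed.

HB.instance Definition _ :=
  @isMeasurable.Build (matrix_display d) 'M[T]_(m, n) measM
    measM0 measMC measMU.

End measurable_matrix.

Section independence.
Context {d} {T : measurableType d} {R : realType} (P : probability T R).

Definition mutually_independent (I : eqType) (F : I -> set (set T)) : Prop :=
  forall (s : seq I) (A : I -> set T), uniq s ->
    (forall i, i \in s -> F i (A i)) ->
    P (\bigcap_(i in [set` s]) A i) = (\prod_(i <- s) P (A i))%E.

Definition sigma_of {d'} {U : measurableType d'} (X : T -> U) :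
  set (set T) := preimage_set_system setT X measurable.

Definition sigma_family {d'} {U : measurableType d'} (I : Type)
  (X : I -> T -> U) : set (set T) := <<s \bigcup_i sigma_of (X i) >>.

Definition has_law {d'} {U : measurableType d'} (X : T -> U)
  (mu : probability U R) : Prop :=
  forall A, measurable A -> P (X @^-1` A) = mu A.

End independence.

Section laws.
Variable R : realType.

Definition csqnorm (z : R[i]) : R := complex.Re z ^+ 2 + complex.Im z ^+ 2.

Definition sqnorm m n (v : 'M[R[i]]_(m, n)) : R :=
  \sum_i \sum_j csqnorm (v i j).

Definition complex_of_pair (x : R * R) : R[i] := x.1 +i* x.2.

Definition row_of_coords (x : (R * R) * (R * R)) : 'rV[R[i]]_2 :=
  \row_j (if j == ord0 then complex_of_pair x.1 else complex_of_pair x.2).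

Let leb := @lebesgue_measure R.

Definition has_density (mu : probability 'rV[R[i]]_2 R) : Prop :=
  exists f : (R * R) * (R * R) -> R,
    [/\ measurable_fun setT f, forall x, 0 <= f x &
        forall A, measurable A ->
          mu A = (\int[((leb \x leb) \x (leb \x leb))%E]_
                    (x in row_of_coords @^-1` A) (f x)%:E)%E].

Definition cmean {d} {T : measurableType d} (mu : probability T R)
  (f : T -> R[i]) : R[i] :=
  (\int[mu]_x complex.Re (f x)) +i* (\int[mu]_x complex.Im (f x)).

Definition covariance_entry (mu : probability 'rV[R[i]]_2 R) (i j : 'I_2) :
  R[i] :=
  cmean mu (fun h => (h ord0 i - cmean mu (fun h' => h' ord0 i)) *
                     ((h ord0 j - cmean mu (fun h' => h' ord0 j))^*)%C).

(* The integral of a non-integrable function is a junk value, whence the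
   explicit second-moment condition. *)
Definition identity_covariance (mu : probability 'rV[R[i]]_2 R) : Prop :=
  (\int[mu]_h (sqnorm h)%:E < +oo)%E /\
  forall i j, covariance_entry mu i j = (i == j)%:R.

(* CN(0,1): independent real and imaginary parts of variance 1/2
   (the second parameter of normal_prob is a standard deviation). *)
Definition cnormal01 (A : set R[i]) : \bar R :=
  (normal_prob (0 : R) (Num.sqrt 2^-1) \x
   normal_prob (0 : R) (Num.sqrt 2^-1))%E (complex_of_pair @^-1` A).

End laws.

(* Receivers are indexed by 'I_2 and time starts at 0, so that a block of
   length n is {0, ..., n-1}. *)
Record channel (R : realType) := Channel {
  ch_display : measure_display;
  ch_space : measurableType ch_display;
  ch_prob : probability ch_space R;
  chH : 'I_2 -> nat -> {mfun ch_space >-> 'rV[R[i]]_2};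
  chG : 'I_2 -> nat -> {mfun ch_space >-> 'rV[R[i]]_2};
  chS : nat -> {mfun ch_space >-> (bool * bool)%type};
  chJ : nat -> {mfun ch_space >-> 'cV[R[i]]_2};
  chN : 'I_2 -> nat -> {mfun ch_space >-> R[i]} }.

Section channel_model.
Variable R : realType.
Implicit Types c : channel R.

Definition noise_events c : set (set (ch_space c)) :=
  sigma_family (fun kt : 'I_2 * nat => chN c kt.1 kt.2).

Definition csi_events c : set (set (ch_space c)) :=
  sigma_family (fun kt : 'I_2 * nat => chH c kt.1 kt.2).

Definition jammer_events c : set (set (ch_space c)) :=
  <<s sigma_family (chS c) `|` sigma_family (chJ c) `|`
      sigma_family (fun kt : 'I_2 * nat => chG c kt.1 kt.2) >>.

Arguments noise_events : clear implicits.
Arguments csi_events : clear implicits.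
Arguments jammer_events : clear implicits.

(* lam i j = Pr(S(t) = (i,j)). Beyond the power of J, the law of J and the
   dependence between S, J and G are left unconstrained. *)
Record jammed_miso_bc (muH muG : 'I_2 -> probability 'rV[R[i]]_2 R)
  (lam : bool -> bool -> R) (PT : R) c : Prop := JammedMisoBC {
  H_law : forall k t, has_law (ch_prob c) (chH c k t) (muH k);
  H_indep : mutually_independent (ch_prob c)
    (fun kt : 'I_2 * nat => sigma_of (chH c kt.1 kt.2));
  G_law : forall k t, has_law (ch_prob c) (chG c k t) (muG k);
  G_indep : mutually_independent (ch_prob c)
    (fun kt : 'I_2 * nat => sigma_of (chG c kt.1 kt.2));
  S_law : forall t (i j : bool),
    ch_prob c (chS c t @^-1` [set (i, j)]) = (lam i j)%:E;
  S_indep : mutually_independent (ch_prob c)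
    (fun t : nat => sigma_of (chS c t));
  J_power : forall t, ('E_(ch_prob c)[fun w => sqnorm (chJ c t w)] = PT%:E)%E;
  N_law : forall k t A, measurable A ->
    ch_prob c (chN c k t @^-1` A) = cnormal01 A;
  N_indep : mutually_independent (ch_prob c)
    (fun kt : 'I_2 * nat => sigma_of (chN c kt.1 kt.2));
  groups_indep : mutually_independent (ch_prob c)
    (tnth [tuple noise_events c; csi_events c; jammer_events c]) }.

Definition csi c (t : nat) (w : ch_space c) : 'M[R[i]]_2 :=
  \matrix_(k < 2) chH c k t w.

Definition csi_block c (t : nat) (w : ch_space c) : t.-tuple 'M[R[i]]_2 :=
  [tuple csi s w | s < t].

Definition jam_block c (t : nat) (w : ch_space c) : t.-tuple (bool * bool) :=
  [tuple chS c s w | s < t].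

Definition jammed (s : bool * bool) (k : 'I_2) : bool :=
  if k == ord0 then s.1 else s.2.

Definition output c (k : 'I_2) (t : nat) (x : 'cV[R[i]]_2) (w : ch_space c) :
  R[i] :=
  (chH c k t w *m x) ord0 ord0
  + (jammed (chS c t w) k)%:R * (chG c k t w *m chJ c t w) ord0 ord0
  + chN c k t w.

End channel_model.

(* What a receiver sees in a block: (Y_k^n, H^n, S^n). *)
Notation observation R n :=
  (n.-tuple R[i] * n.-tuple 'M[R[i]]_2 * n.-tuple (bool * bool))%type.

(* Configuration DN: the encoder at time t sees the messages and
   H(0), ..., H(t-1), and no jammer state. *)
Record dn_code (R : realType) (n M1 M2 : nat) := DNCode {
  enc : forall t : nat,
    'I_M1 -> 'I_M2 -> t.-tuple 'M[R[i]]_2 -> 'cV[R[i]]_2;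
  enc_measurable : forall t w1 w2, measurable_fun setT (@enc t w1 w2);
  dec1 : observation R n -> 'I_M1;
  dec1_measurable : forall m, measurable (dec1 @^-1` [set m]);
  dec2 : observation R n -> 'I_M2;
  dec2_measurable : forall m, measurable (dec2 @^-1` [set m]) }.

Arguments enc {R n M1 M2} d t _ _ _.

Section degrees_of_freedom.
Variable R : realType.
Implicit Types c : channel R.

(* Integration against the law of (W1, W2), uniform on 'I_M1 * 'I_M2. The
   messages are independent of the channel, so probabilities and expectations
   on the joint space are averages of those on ch_space over the messages. *)
Definition message_average (M1 M2 : nat) (f : 'I_M1 -> 'I_M2 -> \bar R) :
  \bar R :=
  (((M1 * M2)%:R^-1)%:E * \sum_(w1 < M1) \sum_(w2 < M2) f w1 w2)%E.

Section code_performance.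
Variables (c : channel R) (n M1 M2 : nat) (cd : dn_code R n M1 M2).

Definition input (w1 : 'I_M1) (w2 : 'I_M2) (t : nat) (w : ch_space c) :
  'cV[R[i]]_2 := enc cd t w1 w2 (csi_block t w).

Definition received (k : 'I_2) (w1 : 'I_M1) (w2 : 'I_M2) (w : ch_space c) :
  observation R n :=
  ([tuple output k t (input w1 w2 t w) w | t < n],
   csi_block n w, jam_block n w).

Definition power_constraint (PT : R) : Prop :=
  forall t, (t < n)%N ->
    (message_average (fun w1 w2 =>
       'E_(ch_prob c)[fun w => sqnorm (input w1 w2 t w)])%E <= PT%:E)%E.

Definition error1 : \bar R := message_average (fun w1 w2 =>
  ch_prob c [set w | dec1 cd (received ord0 w1 w2 w) <> w1]).

Definition error2 : \bar R := message_average (fun w1 w2 =>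
  ch_prob c [set w | dec2 cd (received ord_max w1 w2 w) <> w2]).

End code_performance.

Definition achievable c (PT R1 R2 : R) : Prop :=
  exists (M1 M2 : nat -> nat) (cd : forall n, dn_code R n (M1 n) (M2 n)),
    [/\ forall n, (0 < M1 n)%N /\ (0 < M2 n)%N,
        forall n, power_constraint c (cd n) PT,
        ln (M1 n)%:R / n%:R @[n --> \oo] --> R1 /\
        ln (M2 n)%:R / n%:R @[n --> \oo] --> R2,
        error1 c (cd n) @[n --> \oo] --> 0%E &
        error2 c (cd n) @[n --> \oo] --> 0%E].

Definition dof_region (c : R -> channel R) (d1 d2 : R) : Prop :=
  exists R1 R2 : R -> R,
    [/\ forall PT : R, 0 < PT -> achievable (c PT) PT (R1 PT) (R2 PT),
        R1 PT / ln PT @[PT --> +oo] --> d1 &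
        R2 PT / ln PT @[PT --> +oo] --> d2].

End degrees_of_freedom.

Definition unjammed1 (R : realType) (lam : bool -> bool -> R) : R :=
  lam false false + lam false true.

Definition unjammed2 (R : realType) (lam : bool -> bool -> R) : R :=
  lam false false + lam true false.

(* Main.v *)
Require Import Defs.
From HB Require Import structures.
From mathcomp Require Import all_boot all_order all_algebra.
From mathcomp Require Import zify ring lra.
From mathcomp Require Import all_classical all_reals all_analysis.
From mathcomp Require Import complex measurable_realfun.
Import Order.TTheory GRing.Theory Num.Theory.
Import numFieldNormedType.Exports.

Set Implicit Arguments.
Unset Strict Implicit.
Unset Printing Implicit Defensive.

(** The scheme follows the Maddah-Ali--Tse idea, with joint decoding instead of
successive decoding. The block is cut into slots of user 1, slots of user 2 and
later common slots. In the slots of user k the transmitter sends a random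
codeword of that user over a grid of about (P_T)^2 points of Z[i]^2. For the
common slots it computes, from the past channels, what each of these inputs
induced (up to noise) at the *other* receiver, rounds these linear forms to unit
cells, and sends a random function (hash) of the whole list of cells. A receiver
drops its jammed slots and looks for a message of its own together with a list of
cells of the other user that explain all unjammed observations.

A grid point is one of q^4, an unjammed observation leaves O(q^2) of them, and an
observation together with the cell at the other receiver leaves O(1), because
almost surely the two channel vectors are independent. A wrong message with the
right list of cells therefore costs q^(-2) per unjammed own slot and another
q^(-2) per own slot, and a wrong list of cells costs q^(-2) per unjammed own or
common slot, against q^2 candidates per jammed slot of the other user. With user
k's slots forming a fraction a_k of the block, this gives the conditions
d_k <= (lambda_k + th) a_k and
d_k + th (1 - lambda_k) a_l <= lambda_k (1 - a_l), where l is the other user and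
th = 1. With th = 0 cells are trivial, nothing is hashed, and the scheme is time
sharing. All O(1) factors do not depend on the power, and the fraction of bad slots
(large noise, nearly dependent channels) is arbitrarily small. *)

(** Without jammer states the transmitter cannot tell which slots were lost, so it cannot choose
    what to repeat. A hash of all cells avoids the choice: a candidate message determines the cells
    of its own slots, an unjammed slot of the other user leaves O(1) cells, and only the jammed
    slots of the other user cost the receiver something.

    The order of the quantifiers shapes the estimates. The level [m], which fixes what counts as a
    bad slot, is chosen first and is independent of the power. Then the power is taken so large that
    every constant depending on [m] is small against its logarithm. Finally the block length grows,
    with error O(1/n) by Chebyshev's inequality. The random coding bounds hold for each fixed
    typical channel realization, and the average over codes is exchanged with the expectation over
    the channel, which gives one code serving both receivers.

    The scheme yields, for each loss [eps], rates valid above a threshold that depends on [eps],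
    whereas the region asks for one pair of rate functions with an exact limit. A nearly minimal
    achievable loss is therefore selected separately at each power. *)

Local Open Scope ring_scope.

(** * Uniform probability on finite types *)

Section uniform_probability.
Variable R : realFieldType.
Implicit Types T U I Y : finType.

Definition upr T (A : {pred T}) : R := #|A|%:R / #|T|%:R.

Lemma upr_ge0 T (A : {pred T}) : 0 <= upr A.
Proof. by rewrite divr_ge0. Qed.

Lemma upr_le1 T (A : {pred T}) : upr A <= 1.
Proof.
rewrite /upr; case: (posnP #|T|) => [->|T0]; first by rewrite invr0 mulr0.
by rewrite ler_pdivrMr ?ltr0n// mul1r ler_nat max_card.
Qed.

Lemma upr_sub T (A B : {pred T}) : {subset A <= B} -> upr A <= upr B.
Proof.
move=> AB; rewrite ler_wpM2r ?invr_ge0// ler_nat subset_leq_card//.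
exact/fintype.subsetP.
Qed.

Lemma card_exists T I (D : {pred I}) (A : I -> {pred T}) :
  (#|[pred x | [exists i in D, A i x]]| <= \sum_(i in D) #|A i|)%N.
Proof.
under eq_bigr do rewrite -sum1_card.
rewrite -sum1_card (exchange_big_dep predT)//= [leqLHS]big_mkcond/=.
apply: leq_sum => x _; case: ifPn => // /existsP[i /andP[Di Ai]].
by rewrite (bigD1 i) ?Di//= leq_addr.
Qed.

Lemma upr_exists T I (D : {pred I}) (A : I -> {pred T}) :
  upr [pred x | [exists i in D, A i x]] <= \sum_(i in D) upr (A i).
Proof.
by rewrite -mulr_suml ler_wpM2r ?invr_ge0// -natr_sum ler_nat card_exists.
Qed.

(** Exposes the randomness in stages: the first component is drawn, then the conditional bound [a]
    is applied to the second. *)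
Lemma upr_pair T U (A : T -> U -> bool) (B : {pred T}) (a : R) :
  (forall x, B x -> upr (A x) <= a) ->
  upr [pred p : T * U | B p.1 && A p.1 p.2] <= upr B * a.
Proof.
move=> ha.
have -> : upr [pred p : T * U | B p.1 && A p.1 p.2] =
    (\sum_(x in B) upr (A x)) * #|T|%:R^-1.
  rewrite /upr card_prod natrM invfM mulrC -mulr_suml -natr_sum.
  have -> : #|[pred p : T * U | B p.1 && A p.1 p.2]| = (\sum_(x in B) #|A x|)%N.
    under eq_bigr do rewrite -sum1_card.
    rewrite pair_big_dep/= -sum1_card; apply: eq_bigl => p; rewrite !inE.
    by [].
  ring.
have -> : upr B * a = (\sum_(x in B) a) * #|T|%:R^-1.
  by rewrite /upr sumr_const -[a *+ _]mulr_natl mulrAC.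
rewrite ler_wpM2r ?invr_ge0//.
by apply: ler_sum => x Bx; exact: ha.
Qed.

Lemma upr_snd T U (A : T -> U -> bool) (a : R) :
  0 <= a -> (forall x, upr (A x) <= a) -> upr [pred p : T * U | A p.1 p.2] <= a.
Proof.
move=> a0 ha; apply: (@le_trans _ _ (upr predT * a)).
  exact: (@upr_pair _ _ A predT a (fun x _ => ha x)).
by rewrite ler_piMl// upr_le1.
Qed.

(* Resampling the coordinate [j] is a measure-preserving involution of the
   pairs (function, fresh value). *)
Lemma upr_resample I Y (j : I) (P : {ffun I -> Y} -> Y -> bool) (a : R) :
  0 <= a ->
  (forall (g : {ffun I -> Y}) y y', P [ffun i => if i == j then y' else g i] y = P g y) ->
  (forall g, upr (P g) <= a) ->
  upr [pred g : {ffun I -> Y} | P g (g j)] <= a.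
Proof.
move=> a0 inv ha.
pose upd (g : {ffun I -> Y}) y := [ffun i => if i == j then y else g i].
pose sw (p : {ffun I -> Y} * Y) := (upd p.1 p.2, p.1 j).
have swK : involutive sw.
  case=> g y; rewrite /sw/=; congr (_, _); last by rewrite ffunE eqxx.
  apply/ffunP => i; rewrite !ffunE; by case: eqVneq => [->|].
have := @upr_snd _ _ P a a0 ha; apply: le_trans; rewrite le_eqVlt; apply/orP; left.
apply/eqP; rewrite /upr card_prod.
have -> : #|[pred p : {ffun I -> Y} * Y | P p.1 p.2]| =
    #|[pred p : {ffun I -> Y} * Y | P p.1 (p.1 j) && true]|.
  rewrite -(card_imset _ (inv_inj swK)); apply: eq_card => p.
  rewrite !inE andbT; apply/imsetP/idP => [[[g y]]|Pp].
    rewrite inE/= => Pg ->/=; rewrite inv ffunE eqxx//.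
  exists (sw p); rewrite ?swK// inE/= inv//.
have -> : #|[pred p : {ffun I -> Y} * Y | P p.1 (p.1 j) && true]| =
    (#|[pred g : {ffun I -> Y} | P g (g j)]| * #|Y|)%N.
  rewrite -cardX; apply: eq_card => p; by rewrite !inE.
rewrite !natrM invfM.
have [Y0|Y0] := posnP #|Y|; last first.
  by rewrite mulrACA divff ?mulr1// pnatr_eq0 -lt0n.
rewrite Y0 mulr0 mul0r.
suff -> : #|[pred g : {ffun I -> Y} | P g (g j)]| = 0%N by rewrite mul0r.
apply: eq_card0 => g; have := fintype0 (g j); by rewrite Y0.
Qed.

(** The values of a uniform random function are independent; in counting terms, the favourable
    functions form a [family], whose cardinal is a product. *)
Lemma upr_ffun_forall I Y (S : I -> {pred Y}) (a : I -> R) :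
  (forall i, upr (S i) <= a i) ->
  upr [pred g : {ffun I -> Y} | [forall i, S i (g i)]] <= \prod_i a i.
Proof.
move=> ha; apply: (@le_trans _ _ (\prod_i upr (S i))); last first.
  by apply: ler_prod => i _; rewrite upr_ge0 ha.
rewrite /upr big_split/= prodfV !prodr_const card_ffun.
rewrite natrX -natr_prod le_eqVlt; apply/orP; left; apply/eqP; congr (_%:R / _).
transitivity #|family S|.
  by apply: eq_card => g; apply/forallP/familyP.
rewrite card_family foldrE big_map -big_enum/=.
by [].
Qed.

End uniform_probability.

(** * Random coding *)

(* [own] and [oth] are the slots of the user under consideration and of the other
   one, the remaining slots are common. [bo t x] is the cell in which the input
   [x] of an own slot falls at the other receiver, and [bt t x] the cell of an
   input of the other user at this receiver. The list [u] of all cells is the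
   argument of the hash. [S t] is the set of inputs explaining the observation
   at [t], [J] the set of jammed slots, and up to [e] slots may be violated. *)
Section scheme.
Variables (T X B W : finType) (own oth : {set T}).
Implicit Types (c x h : {ffun T -> X}) (u : {ffun T -> B}).
Implicit Types (bo bt : T -> X -> B) (b : B) (S : T -> {set X}).

Definition side_info bo bt (b0 : B) c x : {ffun T -> B} :=
  [ffun t => if t \in own then bo t (c t)
             else if t \in oth then bt t (x t) else b0].

Definition sent c x h t :=
  if t \in own then c t else if t \in oth then x t else h t.

(** In a slot of the other user only the cell is tested: some input explaining the observation must
    lie in it. The decoder thus never searches the codebook of the other user. *)
Definition slot_ok bt S c h u t :=
  if t \in own then c t \in S t
  else if t \in oth then u t \in bt t @: S t else h t \in S t.

(** The candidate codeword fixes the list on its own slots, so the search over lists is free only on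
    the slots of the other user. *)
Definition admissible bo (b0 : B) c u :=
  [forall t, if t \in own then u t == bo t (c t) else (t \in oth) || (u t == b0)].

Definition plausible bo bt (b0 : B) (J : {set T}) (e : nat) S
    (cb : {ffun W -> {ffun T -> X}}) (f : {ffun {ffun T -> B} -> {ffun T -> X}})
    (w : W) :=
  [exists u, admissible bo b0 (cb w) u &&
    (#|[set t | (t \notin J) && ~~ slot_ok bt S (cb w) (f u) u t]| <= e)%N].

Lemma plausible_true bo bt (b0 : B) (J Z : {set T}) (e : nat) S
    (cb : {ffun W -> {ffun T -> X}}) (f : {ffun {ffun T -> B} -> {ffun T -> X}}) w x :
  (#|Z| <= e)%N ->
  (forall t, t \notin J -> t \notin Z ->
    sent (cb w) x (f (side_info bo bt b0 (cb w) x)) t \in S t) ->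
  plausible bo bt b0 J e S cb f w.
Proof.
move=> Ze ok; apply/existsP; exists (side_info bo bt b0 (cb w) x).
apply/andP; split.
  apply/forallP => t; rewrite ffunE.
  by case: (t \in own); case: (t \in oth)  => /=; rewrite ?eqxx.
rewrite (leq_trans _ Ze)// subset_leq_card//; apply/fintype.subsetP => t.
rewrite inE => /andP[tJ]; apply: contraR => tZ.
have := ok t tJ tZ; rewrite /sent /slot_ok.
by case: ifP => // town; case: ifP => // toth; rewrite ffunE town toth => /imset_f.
Qed.

End scheme.

Lemma prodr_if_const (R : comRingType) (T : finType) (S : {set T}) (a : R) :
  \prod_t (if t \in S then a else 1) = a ^+ #|S|.
Proof. by rewrite -big_mkcond prodr_const. Qed.

(* [C t x] is the set of inputs explaining what is observed when [x] is sent at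
   [t], and [Z] contains the slots with atypical noise or channels. In [Be] the
   wrong message produces the true list of cells; in [Bn] the union bound runs
   over the wrong lists, whose hash values are fresh. *)
Section random_coding_bound.
Variables (R : realFieldType) (T X B W : finType) (own oth : {set T}).
Hypothesis disj : [disjoint own & oth].
Variables (bo bt : T -> X -> B) (b0 : B) (C : T -> X -> {set X}).
Variables (J Z : {set T}) (e : nat).
Variables (pc pe1 pe2 : R) (Kb : nat).
Hypotheses (pc0 : 0 <= pc) (pe10 : 0 <= pe1) (pe20 : 0 <= pe2).
Hypothesis hC : forall t x, t \notin Z -> upr R (mem (C t x)) <= pc.
Hypothesis hE1 : forall t x, t \notin Z ->
  upr R [pred y | (y \in C t x) && (bo t y == bo t x)] <= pe1.
Hypothesis hE2 : forall t x, t \notin Z -> upr R [pred y | bo t y == bo t x] <= pe2.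
Hypothesis hB : forall t x, t \notin Z -> (#|bt t @: C t x| <= Kb)%N.
Variables (Be Bn : R).
Let U (V : {set T}) := ~: (J :|: Z :|: V).
Hypothesis hBe : forall V : {set T}, (#|V| <= e)%N ->
  pe1 ^+ #|own :&: U V| * pe2 ^+ #|own :\: U V :\: Z| <= Be.
Hypothesis hBn : forall V : {set T}, (#|V| <= e)%N ->
  Kb%:R ^+ #|oth :&: U V| * #|B|%:R ^+ #|oth :\: U V|
    * pc ^+ #|~: oth :&: U V| <= Bn.

Notation book := {ffun W -> {ffun T -> X}}.
Notation hash := {ffun {ffun T -> B} -> {ffun T -> X}}.
Notation si := (side_info own oth bo bt b0).

Lemma UnZ V t : t \in U V -> t \notin Z.
Proof. by rewrite !inE; apply: contraNN => ->; rewrite orbT. Qed.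

Lemma upr_match (S : {set T}) (x : {ffun T -> X}) :
  (forall t, t \in S -> t \notin Z) ->
  upr R [pred y : {ffun T -> X} | [forall t, (t \in S) ==> (y t \in C t (x t))]]
    <= pc ^+ #|S|.
Proof.
move=> SZ; rewrite -prodr_if_const.
apply: (upr_ffun_forall (S := fun t => [pred y | (t \in S) ==> (y \in C t (x t))])) => t.
case: ifP => tS; last exact: upr_le1.
by apply: le_trans (hC (x t) (SZ t tS)); apply: upr_sub => y; rewrite !inE.
Qed.

Lemma upr_fst (A : {pred book}) :
  upr R [pred p : book * hash | A p.1] <= upr R A.
Proof.
rewrite -[leRHS]mulr1.
apply: le_trans (@upr_pair _ _ _ (fun _ => xpredT) A 1 _).
  by apply: upr_sub => p; rewrite !inE andbT.
by move=> *; exact: upr_le1.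
Qed.

Section wrong_message.
Variables (x2 : {ffun T -> X}) (w w' : W) (V : {set T}).
Hypotheses (ww' : w' != w) (Ve : (#|V| <= e)%N).

Let same_info : {pred book * hash} := [pred p : book * hash |
  [forall t, ((t \in own) ==> (bo t (p.1 w' t) == bo t (p.1 w t))) &&
     ((t \in own :&: U V) ==> (p.1 w' t \in C t (p.1 w t)))]].

(** Given the codeword of [w], that of [w'] is fresh. Agreement of the hashed lists forces the cells
    to agree even in the own slots lost to jamming, whence the factor [pe2] there. *)
Lemma upr_same_info : upr R same_info <= Be.
Proof.
apply: le_trans (hBe Ve).
apply: le_trans (upr_fst (fun cb : book => [forall t,
  ((t \in own) ==> (bo t (cb w' t) == bo t (cb w t))) &&
     ((t \in own :&: U V) ==> (cb w' t \in C t (cb w t)))])) _.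
apply: (upr_resample (j := w') (P := fun (cb : book) y => [forall t,
  ((t \in own) ==> (bo t (y t) == bo t (cb w t))) &&
     ((t \in own :&: U V) ==> (y t \in C t (cb w t)))])).
- by rewrite mulr_ge0 ?exprn_ge0.
- by move=> g y y'; apply: eq_forallb => t; rewrite ffunE ifN_eqC.
move=> cb; rewrite -!prodr_if_const -big_split/=.
apply: (upr_ffun_forall (S := fun t => [pred y |
  ((t \in own) ==> (bo t y == bo t (cb w t))) &&
     ((t \in own :&: U V) ==> (y \in C t (cb w t)))])) => t.
have [tU|tU] := boolP (t \in own :&: U V).
  move: (tU); rewrite inE => /andP[town tUV].
  rewrite 2!inE town tUV/= andbF mulr1.
  apply: le_trans (hE1 (cb w t) (UnZ tUV)); apply: upr_sub => y.
  by move=> /andP[] /=; rewrite ?town /= => H1 H2; apply/andP.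
rewrite mul1r; case: ifP => [|_]; last exact: upr_le1.
rewrite 2!inE => /andP[tZ /andP[_ town]].
apply: le_trans (hE2 (cb w t) tZ); apply: upr_sub => y.
by rewrite !inE town => /andP[].
Qed.

(** This family depends on neither the codebooks nor the hash, so a union bound over it can be taken
    before averaging. On the own slots, where a list depends on the random codeword, the candidate
    is frozen to [b0] and completed by [merge]. *)
Let info_fam t : {pred B} :=
  if t \in oth then
    (if t \in U V then (fun b => b \in bt t @: C t (x2 t)) else xpredT)
  else xpred1 b0.

Let merge (c : {ffun T -> X}) (g : {ffun T -> B}) : {ffun T -> B} :=
  [ffun t => if t \in own then bo t (c t) else g t].

Let other_info (g : {ffun T -> B}) : {pred book * hash} := [pred p : book * hash |
  [forall t, (t \in own :&: U V) ==> (p.1 w' t \in C t (p.1 w t))] &&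
  ((merge (p.1 w') g != si (p.1 w) x2) &&
  [forall t, (t \in ~: (own :|: oth) :&: U V) ==>
     (p.2 (merge (p.1 w') g) t \in C t (p.2 (si (p.1 w) x2) t))])].

(** The codeword of [w'] pays for the own slots. Once the codebook is fixed, the hash is evaluated
    at a list different from the true one, so its value is fresh and pays for the common slots. *)
Lemma upr_other_info g : upr R (other_info g) <= pc ^+ #|~: oth :&: U V|.
Proof.
have -> : (#|~: oth :&: U V| =
    #|own :&: U V| + #|~: (own :|: oth) :&: U V|)%N.
  rewrite -cardsUI.
  have -> : (own :&: U V) :&: (~: (own :|: oth) :&: U V) = finset.set0.
    by apply/setP => t; rewrite !inE; case: (t \in own); rewrite ?andbF.
  rewrite cards0 addn0; apply: eq_card => t; rewrite !inE.
  case: (boolP (t \in own)) => town; last by rewrite /=.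
  by rewrite (disjointFr disj town)/= orbF.
rewrite exprD.
apply: le_trans (@upr_pair _ _ _ (fun (cb : book) (f : hash) =>
  (merge (cb w') g != si (cb w) x2) &&
  [forall t, (t \in ~: (own :|: oth) :&: U V) ==>
     (f (merge (cb w') g) t \in C t (f (si (cb w) x2) t))])
  [pred cb : book | [forall t, (t \in own :&: U V) ==> (cb w' t \in C t (cb w t))]]
  (pc ^+ #|~: (own :|: oth) :&: U V|) _) _; last first.
- rewrite ler_wpM2r ?exprn_ge0//.
  apply: (upr_resample (j := w') (P := fun (cb : book) y =>
    [forall t, (t \in own :&: U V) ==> (y t \in C t (cb w t))])).
  + by rewrite exprn_ge0.
  + by move=> cb y y'; apply: eq_forallb => t; rewrite ffunE ifN_eqC.
  + by move=> cb; apply: upr_match => t; rewrite inE => /andP[_ /UnZ].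
- move=> cb _; have [uv|uv] := eqVneq (merge (cb w') g) (si (cb w) x2).
    rewrite [X in X <= _](_ : _ = 0) ?exprn_ge0// /upr.
    by rewrite (@eq_card0 _ _) ?mul0r// => f; rewrite inE.
  apply: (@le_trans _ _ (upr R [pred f : hash |
    [forall t, (t \in ~: (own :|: oth) :&: U V) ==>
     (f (merge (cb w') g) t \in C t (f (si (cb w) x2) t))]])).
    by apply: upr_sub => f.
  apply: (upr_resample (j := merge (cb w') g) (P := fun (f : hash) y =>
    [forall t, (t \in ~: (own :|: oth) :&: U V) ==>
     (y t \in C t (f (si (cb w) x2) t))])).
  + by rewrite exprn_ge0.
  + by move=> f y y'; apply: eq_forallb => t; rewrite ffunE ifN_eqC.
  + by move=> f; apply: upr_match => t; rewrite inE => /andP[_ /UnZ].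
Qed.

(** A usable slot of the other user leaves at most [Kb] cells, a lost one leaves all of [B]. *)
Lemma card_info_fam :
  #|family info_fam|%:R <= Kb%:R ^+ #|oth :&: U V| * #|B|%:R ^+ #|oth :\: U V| :> R.
Proof.
rewrite card_family foldrE big_map big_enum/= natr_prod.
rewrite -!prodr_if_const -big_split/=; apply: ler_prod => t _.
rewrite ler0n/= /info_fam finset.in_setI finset.in_setD.
case: (boolP (t \in oth)) => toth/=; last first.
  by rewrite andbF card1 mulr1.
rewrite andbT; case: (boolP (t \in U V)) => tU /=.
  by rewrite mulr1 ler_nat (hB _ (UnZ tU)).
by rewrite mul1r ler_nat max_card.
Qed.

Definition confusable : {pred book * hash} := [pred p : book * hash |
  [exists u, admissible own oth bo b0 (p.1 w') u &&
    [forall t, (t \notin J :|: V) ==>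
      slot_ok own oth bt
        (fun t => C t (sent own oth (p.1 w) x2 (p.2 (si (p.1 w) x2)) t))
        (p.1 w') (p.2 u) u t]]].

Lemma upr_confusable : upr R confusable <= Be + Bn.
Proof.
have sub : {subset confusable <= predU same_info
    [pred p : book * hash | [exists g in family info_fam, other_info g p]]}.
  move=> [cb f]; rewrite !inE => /existsP[/= u /andP[/forallP adm /forallP ok]].
  have okU t : t \in U V -> slot_ok own oth bt
        (fun t => C t (sent own oth (cb w) x2 (f (si (cb w) x2)) t))
        (cb w') (f u) u t.
    move=> tU; apply: (implyP (ok t)); move: tU; rewrite !inE.
    by apply: contraNN => /orP[] ->; rewrite ?orbT.
  have okown t : t \in own :&: U V -> cb w' t \in C t (cb w t).
    by rewrite inE => /andP[town /okU]; rewrite /slot_ok /sent town.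
  have [uv|uv] := eqVneq u (si (cb w) x2); [apply/orP; left|apply/orP; right].
    apply/forallP => t; apply/andP; split; apply/implyP; last exact: okown.
    by move=> town; have := adm t; rewrite uv ffunE town eq_sym.
  (* Erasing the own slots loses nothing, since admissibility lets [merge] restore them. *)
  pose g : {ffun T -> B} := [ffun t => if t \in own then b0 else u t].
  have mg : merge (cb w') g = u.
    apply/ffunP => t; rewrite !ffunE; have := adm t.
    by case: ifP => // _ /eqP ->.
  apply/existsP; exists g; apply/andP; split.
    apply/familyP => t; rewrite /info_fam ffunE.
    case toth: (t \in oth).
      rewrite (disjointFl disj toth); case: ifP => // tU.
      by have := okU t tU; rewrite /slot_ok /sent (disjointFl disj toth) toth.
    have := adm t; rewrite toth; case town: (t \in own) => //= _.
    by rewrite unfold_in.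
  rewrite /other_info /= mg uv/=; apply/andP; split; apply/forallP => t; apply/implyP.
    exact: okown.
  rewrite finset.in_setI finset.in_setC finset.in_setU negb_or.
  move=> /andP[/andP[/negPf town /negPf toth] /okU].
  by rewrite /slot_ok /sent town toth.
apply: le_trans (upr_sub R sub) _.
apply: (@le_trans _ _ (upr R same_info +
  upr R [pred p : book * hash | [exists g in family info_fam, other_info g p]])).
  rewrite /upr -mulrDl ler_wpM2r ?invr_ge0// -natrD ler_nat.
  by rewrite -cardUI leq_addr.
apply: lerD; first exact: upr_same_info.
apply: le_trans (upr_exists _ _ _) _.
apply: (@le_trans _ _ (\sum_(g in family info_fam) pc ^+ #|~: oth :&: U V|)).
  by apply: ler_sum => g _; exact: upr_other_info.
rewrite sumr_const -[_ *+ _]mulr_natl; apply: le_trans (hBn Ve).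
by rewrite ler_wpM2r ?exprn_ge0// card_info_fam.
Qed.

End wrong_message.

(** Union bound over the wrong messages and over the sets [V] of violated slots. Counting all
    subsets for [V] costs only a factor 2 per slot, which does not depend on the power. *)
Lemma upr_decoding_error (x2 : {ffun T -> X}) (w : W) :
  upr R [pred p : book * hash | [exists w' in predC1 w,
    plausible own oth bo bt b0 J e
      (fun t => C t (sent own oth (p.1 w) x2 (p.2 (si (p.1 w) x2)) t))
      p.1 p.2 w']]
  <= (#|W|.-1)%:R * 2 ^+ #|T| * (Be + Bn).
Proof.
pose D : {pred W * {set T}} := [pred i : W * {set T} | (i.1 != w) && (#|i.2| <= e)%N].
apply: (@le_trans _ _ (upr R [pred p : book * hash | [exists i in D, confusable x2 w i.1 i.2 p]])).
  apply: upr_sub => p; rewrite !inE => /existsP[w' /andP[ww' /existsP[u /andP[adm le]]]].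
  apply/existsP; exists (w', [set t | (t \notin J) && ~~ slot_ok own oth bt
    (fun t => C t (sent own oth (p.1 w) x2 (p.2 (si (p.1 w) x2)) t))
    (p.1 w') (p.2 u) u t]).
  move: ww'; rewrite !inE/= le andbT => -> /=; apply/existsP; exists u; rewrite adm/=.
  apply/forallP => t; apply/implyP; rewrite !inE negb_or => /andP[tJ].
  by rewrite tJ/= negbK.
apply: le_trans (upr_exists _ _ _) _.
have BeBn : 0 <= Be + Bn.
  have V0 : (#|@finset.set0 T| <= e)%N by rewrite cards0.
  rewrite addr_ge0//; [apply: le_trans (hBe V0)|apply: le_trans (hBn V0)];
  by rewrite ?mulr_ge0 ?exprn_ge0 ?ler0n.
apply: (@le_trans _ _ (\sum_(i in D) (Be + Bn))).
  by apply: ler_sum => i /andP[]; exact: upr_confusable.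
rewrite sumr_const -[_ *+ _]mulr_natl ler_wpM2r// -natrX -natrM ler_nat.
have -> : (2 ^ #|T| = #|{set T}|)%N by rewrite -cardsT -card_powerset powersetT cardsT.
have <- : #|predC1 w| = #|W|.-1 by rewrite cardC1.
rewrite -cardX subset_leq_card//; apply/fintype.subsetP => -[w' V].
by rewrite !inE/= => /andP[->].
Qed.

End random_coding_bound.

(** * The random coding bound in exponential form *)

Section random_coding_exponent.
Variables (R : realType) (T X B W : finType) (own oth : {set T}).
Hypothesis disj : [disjoint own & oth].
Variables (bo bt : T -> X -> B) (b0 : B) (C : T -> X -> {set X}).
Variables (J Z : {set T}) (e : nat) (k L th : R) (Kb : nat).
Hypotheses (k0 : 0 <= k) (L0 : 0 <= L) (th0 : 0 <= th).
Hypothesis hC : forall t x, t \notin Z -> upr R (mem (C t x)) <= expR (k - L).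
Hypothesis hE1 : forall t x, t \notin Z ->
  upr R [pred y | (y \in C t x) && (bo t y == bo t x)] <= expR (k - L - th * L).
Hypothesis hE2 : forall t x, t \notin Z ->
  upr R [pred y | bo t y == bo t x] <= expR (k - th * L).
Hypothesis hB : forall t x, t \notin Z -> (#|bt t @: C t x| <= Kb)%N.
Hypothesis hKb : Kb%:R <= expR k.
Hypothesis hBcard : #|B|%:R <= expR (k + th * L).
Hypothesis Ze : (#|Z| <= e)%N.

Let U (V : {set T}) := ~: (J :|: Z :|: V).

Let cardU (A V : {set T}) : (#|V| <= e)%N ->
  (#|A :\: J| <= #|A :&: U V| + 2 * e)%N.
Proof.
move=> Ve; have /subset_leq_card : A :\: J \subset (A :&: U V) :|: (Z :|: V).
  apply/fintype.subsetP => t; rewrite !inE.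
  by case: (t \in A); case: (t \in J); case: (t \in Z); case: (t \in V).
move=> /leq_trans; apply; rewrite (leq_trans (leq_card_setU _ _))//.
by rewrite leq_add2l (leq_trans (leq_card_setU _ _))// mulSn mul1n leq_add.
Qed.

Let ler_card (A : {set T}) : #|A|%:R <= #|T|%:R :> R.
Proof. by rewrite ler_nat max_card. Qed.

(** Each own slot outside [Z] gains [th * L] from its cell, and the usable ones gain [L] besides.
    The two groups are disjoint, so the constant [k] is paid at most [#|T|] times. *)
Lemma same_info_exponent (V : {set T}) : (#|V| <= e)%N ->
  expR (k - L - th * L) ^+ #|own :&: U V| *
    expR (k - th * L) ^+ #|own :\: U V :\: Z| <=
  expR (#|T|%:R * k - L * (#|own :\: J|%:R - 2 * e%:R)
        - th * L * (#|own|%:R - e%:R)).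
Proof.
move=> Ve; rewrite -!expRM_natl -expRD ler_expR.
have eq : (#|own :&: U V| + #|own :\: U V :\: Z| = #|own :\: Z|)%N.
  rewrite -cardsUI.
  have -> : (own :&: U V) :&: (own :\: U V :\: Z) = finset.set0.
    by apply/setP => t; rewrite !inE; case: (t \in J); case: (t \in Z);
      case: (t \in V); rewrite /= ?andbF.
  rewrite cards0 addn0; apply: eq_card => t; rewrite !inE.
  by case: (t \in J); case: (t \in Z); case: (t \in V); case: (t \in own).
have h1 : (#|own| <= #|own :\: Z| + e)%N.
  by rewrite -(cardsID Z own) addnC leq_add2l (leq_trans _ Ze)// subset_leq_card// finset.subsetIr.
have h2 := cardU own Ve; have h3 := ler_card (own :\: Z).
move: h1 h2; rewrite -!(ler_nat R) !natrD ?natrM.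
move: eq => /(congr1 (fun n => n%:R : R)); rewrite natrD => eq h1 h2.
move: h3; rewrite -eq => h3; rewrite -eq in h1.
set a := #|own :&: U V|%:R in h1 h2 h3 *.
set b := #|own :\: U V :\: Z|%:R in h1 h2 h3 *.
have i1 := ler_wpM2r k0 h3; have thL : 0 <= th * L by rewrite mulr_ge0.
have i2 : th * L * (#|own|%:R - e%:R) <= th * L * (a + b).
  by rewrite ler_wpM2l//; lra.
have i3 : L * (#|own :\: J|%:R - 2 * e%:R) <= L * a.
  by rewrite ler_wpM2l//; lra.
lra.
Qed.

(** Each of the three factors pays the constant [k] at most [#|T|] times, hence the 3. A slot
    outside [U V] is jammed, in [Z] or in [V], and the last two sets have at most [e] elements each,
    hence the terms in [2 * e]. *)
Lemma other_info_exponent (V : {set T}) : (#|V| <= e)%N ->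
  Kb%:R ^+ #|oth :&: U V| * #|B|%:R ^+ #|oth :\: U V|
    * expR (k - L) ^+ #|~: oth :&: U V| <=
  expR (3 * #|T|%:R * k + th * L * (#|oth :&: J|%:R + 2 * e%:R)
        - L * (#|~: oth :\: J|%:R - 2 * e%:R)).
Proof.
move=> Ve; apply: (@le_trans _ _ (expR k ^+ #|oth :&: U V| *
   expR (k + th * L) ^+ #|oth :\: U V| * expR (k - L) ^+ #|~: oth :&: U V|)).
  rewrite ler_wpM2r ?exprn_ge0 ?expR_ge0//.
  apply: ler_pM; rewrite ?exprn_ge0 ?ler0n//; apply: lerXn2r;
  by rewrite ?nnegrE ?expR_ge0.
rewrite -!expRM_natl -!expRD ler_expR.
have h1 : (#|oth :\: U V| <= #|oth :&: J| + 2 * e)%N.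
  have /subset_leq_card : oth :\: U V \subset (oth :&: J) :|: (Z :|: V).
    apply/fintype.subsetP => t; rewrite !inE.
    by case: (t \in oth); case: (t \in J); case: (t \in Z); case: (t \in V).
  move=> /leq_trans; apply; rewrite (leq_trans (leq_card_setU _ _))//.
  by rewrite leq_add2l (leq_trans (leq_card_setU _ _))// mulSn mul1n leq_add.
have h2 := cardU (~: oth) Ve.
have h3 := ler_card (oth :&: U V); have h4 := ler_card (oth :\: U V).
have h5 := ler_card (~: oth :&: U V).
move: h1 h2; rewrite -!(ler_nat R) !natrD ?natrM => h1 h2.
set a := #|oth :&: U V|%:R in h1 h2 h3 *.
set b := #|oth :\: U V|%:R in h1 h2 h4 *.
set c := #|~: oth :&: U V|%:R in h1 h2 h5 *.
have i1 := ler_wpM2r k0 h3; have i2 := ler_wpM2r k0 h4.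
have i3 := ler_wpM2r k0 h5; have thL : 0 <= th * L by rewrite mulr_ge0.
have i4 := ler_wpM2l thL h1.
have i5 : L * (#|~: oth :\: J|%:R - 2 * e%:R) <= L * c.
  by rewrite ler_wpM2l//; lra.
lra.
Qed.

Lemma upr_decoding_error_exp (x2 : {ffun T -> X}) (w : W) :
  upr R [pred p : {ffun W -> {ffun T -> X}} * {ffun {ffun T -> B} -> {ffun T -> X}} |
   [exists w' in predC1 w,
    plausible own oth bo bt b0 J e
      (fun t => C t (sent own oth (p.1 w) x2
         (p.2 (side_info own oth bo bt b0 (p.1 w) x2)) t))
      p.1 p.2 w']]
  <= (#|W|.-1)%:R * 2 ^+ #|T| *
    (expR (#|T|%:R * k - L * (#|own :\: J|%:R - 2 * e%:R)
        - th * L * (#|own|%:R - e%:R)) +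
     expR (3 * #|T|%:R * k + th * L * (#|oth :&: J|%:R + 2 * e%:R)
        - L * (#|~: oth :\: J|%:R - 2 * e%:R))).
Proof.
apply: (@upr_decoding_error _ _ _ _ _ _ _ disj _ _ _ _ _ Z _ (expR (k - L))
  (expR (k - L - th * L)) (expR (k - th * L)) Kb); rewrite ?expR_ge0//.
- exact: same_info_exponent.
- exact: other_info_exponent.
Qed.

End random_coding_exponent.

(** * Counting grid points *)

Section grid_counting.
Variable q : nat.

Definition near_pt (k : nat) (x y : 'I_q * 'I_q) : bool :=
  [&& x.1 <= y.1 + k, y.1 <= x.1 + k, x.2 <= y.2 + k & y.2 <= x.2 + k]%N.

Lemma card_near (k : nat) (F : {set 'I_q * 'I_q}) :
  {in F &, forall x y, near_pt k x y} -> (#|F| <= (2 * k).+1 ^ 2)%N.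
Proof.
move=> hF; have [->|[x0 x0F]] := set_0Vmem F; first by rewrite cards0.
(* Measured from a fixed element [x0], shifted by [k], all elements lie in a square of side
   [(2 * k).+1]. *)
pose f (x : 'I_q * 'I_q) : 'I_(2 * k).+1 * 'I_(2 * k).+1 :=
  (inord (x.1 + k - x0.1)%N, inord (x.2 + k - x0.2)%N).
have finj : {in F &, injective f}.
  move=> x y xF yF [].
  have /and4P[x1 x2 x3 x4] := hF _ _ xF x0F.
  have /and4P[y1 y2 y3 y4] := hF _ _ yF x0F.
  move=> /(congr1 val) /=; rewrite !inordK; [|lia..] => e1.
  move=> /(congr1 val) /=; rewrite !inordK; [|lia..] => e2.
  case: x y x1 x2 x3 x4 y1 y2 y3 y4 e1 e2 {xF yF} => x x' [y y'] /= *.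
  by congr pair; apply: val_inj => /=; lia.
rewrite -(card_in_imset finj); apply: leq_trans (max_card _) _.
by rewrite card_prod !card_ord mulnn.
Qed.

Lemma card_near2 (k : nat) (F : {set ('I_q * 'I_q) * ('I_q * 'I_q)}) :
  {in F &, forall x y, near_pt k x.1 y.1 && near_pt k x.2 y.2} ->
  (#|F| <= ((2 * k).+1 ^ 2) ^ 2)%N.
Proof.
move=> hF; have sub : F \subset finset.setX (fst @: F) (snd @: F).
  by apply/fintype.subsetP => -[x1 x2] xF; rewrite finset.in_setX (imset_f fst xF) (imset_f snd xF).
rewrite (leq_trans (subset_leq_card sub))// cardsX -mulnn leq_mul//;
by apply: card_near => _ _ /imsetP[x xF ->] /imsetP[y yF ->];
  have /andP[] := hF _ _ xF yF.
Qed.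

Lemma card_near_fiber (k : nat) (F : {set ('I_q * 'I_q) * ('I_q * 'I_q)}) :
  {in F &, forall x y, x.2 = y.2 -> near_pt k x.1 y.1} ->
  (#|F| <= (2 * k).+1 ^ 2 * q ^ 2)%N.
Proof.
move=> hF.
have -> : #|F| = (\sum_(z : 'I_q * 'I_q) #|[set y | (y, z) \in F]|)%N.
  under eq_bigr do rewrite -sum1dep_card.
  rewrite -sum1_card (partition_big snd predT)//=; apply: eq_bigr => z _.
  rewrite (reindex_onto (fun y => (y, z)) fst)/=.
    by apply: eq_bigl => y; rewrite !eqxx !andbT.
  by move=> [y z'] /= /andP[_ /eqP ->].
apply: (@leq_trans (\sum_(z : 'I_q * 'I_q) (2 * k).+1 ^ 2)).
  apply: leq_sum => z _; apply: card_near => x y.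
  by rewrite !inE => xF yF; exact: hF xF yF _.
by rewrite sum_nat_const card_prod !card_ord mulnn mulnC.
Qed.

End grid_counting.

Section squared_modulus.
Variable R : realType.
Implicit Types (z u v : R[i]) (m : R).

Lemma csqnormM u v : csqnorm (u * v) = csqnorm u * csqnorm v.
Proof. by case: u v => a b [c d]; rewrite /csqnorm /=; ring. Qed.

Lemma csqnormD u v : csqnorm (u + v) <= 2 * (csqnorm u + csqnorm v).
Proof.
case: u v => a b [c d]; rewrite /csqnorm /=.
have := sqr_ge0 (a - c); have := sqr_ge0 (b - d); nra.
Qed.

Lemma csqnormN u : csqnorm (- u) = csqnorm u.
Proof. by case: u => a b; rewrite /csqnorm /= !sqrrN. Qed.

Lemma csqnorm_ge0 u : 0 <= csqnorm u.
Proof. by rewrite addr_ge0// sqr_ge0. Qed.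

Definition in_box m z := (`|complex.Re z| <= m) && (`|complex.Im z| <= m).

Lemma in_boxB m u v : in_box m u -> in_box m v -> in_box (2 * m) (u - v).
Proof.
case: u v => a b [c d]; rewrite /in_box /= => /andP[h1 h2] /andP[h3 h4].
by rewrite !(le_trans (ler_normB _ _))// mulr_natl mulr2n lerD.
Qed.

Lemma in_box_csqnorm m z : in_box m z -> csqnorm z <= 2 * m ^+ 2.
Proof.
case: z => a b; rewrite /in_box /csqnorm /= => /andP[h1 h2].
have m0 : 0 <= m by apply: le_trans h1.
have : `|a| ^+ 2 <= m ^+ 2 by rewrite lerXn2r ?nnegrE.
have : `|b| ^+ 2 <= m ^+ 2 by rewrite lerXn2r ?nnegrE.
by rewrite !real_normK ?num_real//; lra.
Qed.

Lemma csqnorm_cancel (m a : R) u z : 0 <= m -> 1 <= csqnorm u * m ->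
  csqnorm (u * z) <= a -> csqnorm z <= a * m.
Proof.
move=> m0 hu hz; rewrite csqnormM in hz.
have := csqnorm_ge0 z; have := csqnorm_ge0 u; nra.
Qed.

Definition gint q (a : 'I_q * 'I_q) : R[i] := (a.1%:R +i* a.2%:R)%C.

(** A bound on the squared distance serves as a bound on the distance itself, which is safe because
    a natural number exceeding [k] has a square exceeding [k]. *)
Lemma gint_near q (a b : 'I_q * 'I_q) (k : nat) :
  csqnorm (gint a - gint b) <= k%:R -> near_pt k a b.
Proof.
case: a b => [[a ?] [a' ?]] [[b ?] [b' ?]]; rewrite /csqnorm /near_pt /= => h.
have aux (x y : nat) : (x%:R - y%:R) ^+ 2 <= k%:R :> R -> (x <= y + k)%N.
  move=> hxy; rewrite leqNgt; apply/negP => lt.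
  have : (y + k).+1%:R <= x%:R :> R by rewrite ler_nat.
  rewrite -addn1 !natrD => h1.
  have k0 : 0 <= k%:R :> R by [].
  have : k%:R + 1 <= x%:R - y%:R :> R by lra.
  by nra.
have h1 := sqr_ge0 (a%:R - b%:R : R); have h2 := sqr_ge0 (a'%:R - b'%:R : R).
by apply/and4P; split; apply: aux; rewrite -?[(b%:R - a%:R)]opprB
  -?[(b'%:R - a'%:R)]opprB ?sqrrN; lra.
Qed.

End squared_modulus.

Section cells.
Variable R : realType.

Definition residue (M : nat) (x : int) : 'I_M.+1 := inord `|(x %% M.+1%:Z)%Z|%N.

Lemma residue_inj M (x y : int) :
  residue M x = residue M y -> `|x - y| <= M%:Z -> x = y.
Proof.
move=> /(congr1 val) /=; rewrite !inordK; last 2 first.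
- by have := ltz_pmod y (isT : (0 < M.+1%:Z)); have := modz_ge0 y (isT : M.+1%:Z != 0); lia.
- by have := ltz_pmod x (isT : (0 < M.+1%:Z)); have := modz_ge0 x (isT : M.+1%:Z != 0); lia.
move=> e.
have {e} : (x %% M.+1%:Z)%Z = (y %% M.+1%:Z)%Z.
  by have := modz_ge0 x (isT : M.+1%:Z != 0); have := modz_ge0 y (isT : M.+1%:Z != 0); lia.
move=> /eqP; rewrite eqz_mod_dvd => /dvdzP[d hd] le.
have d0 : d = 0 by nia.
by move: hd; rewrite d0 mul0r => /eqP; rewrite subr_eq0 => /eqP.
Qed.

Definition cell (M : nat) (z : R[i]) : 'I_M.+1 * 'I_M.+1 :=
  (residue M (Num.floor (complex.Re z)), residue M (Num.floor (complex.Im z))).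

Lemma floor_eq_dist (x y : R) : Num.floor x = Num.floor y -> `|x - y| <= 1.
Proof.
move=> e.
have := floor_le x; have := floorD1_gt x; have := floor_le y; have := floorD1_gt y.
rewrite e intrD /= ler_norml => *; apply/andP; split; lra.
Qed.

End cells.

(* Pairs of Gaussian integers with coordinates in [0, q[. *)
Local Notation point q := (('I_q * 'I_q) * ('I_q * 'I_q))%type.

Section linear_forms.
Variable R : realType.
Implicit Types (a b h : 'rV[R[i]]_2) (m q : nat).

Definition lin_form q h (x : point q) : R[i] :=
  h ord0 ord0 * gint R x.1 + h ord0 ord_max * gint R x.2.

Definition det2 a b : R[i] :=
  a ord0 ord0 * b ord0 ord_max - a ord0 ord_max * b ord0 ord0.

(** The first entry is kept away from 0 so that, for a given second coordinate, an approximate value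
    of the linear form determines the first coordinate up to O(1) choices. *)
Definition row_good m h :=
  [&& in_box m%:R (h ord0 ord0), in_box m%:R (h ord0 ord_max) &
      1 <= csqnorm (h ord0 ord0) * m%:R].

Definition pair_good m a b :=
  [&& row_good m a, row_good m b & 1 <= csqnorm (det2 a b) * m%:R].

Lemma pair_goodC m a b : pair_good m a b = pair_good m b a.
Proof.
rewrite /pair_good andbCA; congr [&& _, _ & _].
by rewrite -csqnormN; congr (_ <= csqnorm _ * _); rewrite /det2; ring.
Qed.

Definition explaining q m h (y : R[i]) : {set point q} :=
  [set x | in_box m%:R (y - lin_form h x)].

(* Rounded values are only kept modulo [cells.+1], which is harmless because values
   of good linear forms differ by at most [8 * m * q]; [th = false] keeps nothing. *)
Definition cells (th : bool) m q := if th then (8 * m * q).+2%N else 0%N.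

Definition quantize (th : bool) m q h (x : point q) :=
  cell (cells th m q) (lin_form h x).

Lemma in_box_lin_form m q h (x : point q) : row_good m h ->
  in_box (4 * m * q)%:R (lin_form h x).
Proof.
case: x => -[[u uq] [u' u'q]] [[v vq] [v' v'q]].
move=> /and3P[]; rewrite /lin_form /in_box /gint /=.
case: (h ord0 ord0) (h ord0 ord_max) => a a' [b b'] /=.
have aux (c : R) (n : nat) : (n < q)%N -> `|c| <= m%:R -> `|c * n%:R| <= (m * q)%:R.
  move=> nq cm; rewrite normrM natrM ler_pM// ger0_norm// ler_nat; exact: ltnW.
move=> /andP[ha ha'] /andP[hb hb'] _.
rewrite -!mulnA natrM; apply/andP; split.
  have := aux a u uq ha; have := aux a' u' u'q ha'.
  have := aux b v vq hb; have := aux b' v' v'q hb'.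
  rewrite !ler_norml => /andP[? ?] /andP[? ?] /andP[? ?] /andP[? ?].
  by apply/andP; split; lra.
have := aux a u' u'q ha; have := aux a' u uq ha'.
have := aux b v' v'q hb; have := aux b' v vq hb'.
rewrite !ler_norml => /andP[? ?] /andP[? ?] /andP[? ?] /andP[? ?].
by apply/andP; split; lra.
Qed.

Lemma quantize_near m q h (x x' : point q) : row_good m h ->
  quantize true m h x = quantize true m h x' ->
  csqnorm (lin_form h x - lin_form h x') <= 2.
Proof.
move=> gh; have := in_box_lin_form x gh; have := in_box_lin_form x' gh.
rewrite /quantize /cell; case: (lin_form h x) (lin_form h x') => a a' [b b'].
rewrite /in_box /csqnorm /= => /andP[hb hb'] /andP[ha ha'] [e e'].
have aux (c d : R) : `|c| <= (4 * m * q)%:R -> `|d| <= (4 * m * q)%:R ->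
    residue (8 * m * q).+2 (Num.floor c) = residue (8 * m * q).+2 (Num.floor d) ->
    (c - d) ^+ 2 <= 1.
  move=> hc hd /residue_inj H; have /floor_eq_dist : Num.floor c = Num.floor d.
    apply: H.
    suff : `|Num.floor c - Num.floor d|%:~R <= (8 * m * q).+2%:R :> R.
      by rewrite [X in _ <= X]pmulrn ler_int.
    rewrite intr_norm intrD mulrNz.
    have := floor_le c; have := floorD1_gt c; have := floor_le d; have := floorD1_gt d.
    move: hc hd; rewrite -[in X in _ -> _ -> _ -> _ -> _ -> _ -> X]addn2 !natrD !natrM !intrD /=.
    rewrite !ler_norml => /andP[? ?] /andP[? ?] ? ? ? ?.
    by apply/andP; split; lra.
  move=> h1; rewrite -real_normK ?num_real// exprn_ile1//.
by have := aux _ _ ha hb e; have := aux _ _ ha' hb' e'; lra.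
Qed.

End linear_forms.

Section counting_points.
Variable R : realType.
Implicit Types (a b h : 'rV[R[i]]_2) (m q : nat).

(** Squared distance allowed between two candidates. Solving for a coordinate gives [2 * (2 * m ^ 2
    * (8 * m ^ 2) + 2 * m ^ 2 * 2)], that is [32 * m ^ 4 + 8 * m ^ 2], and dividing by the squared
    determinant costs one more factor [m]. The value also dominates [8 * m ^ 3] and [2 * m], needed
    when a single form is known. *)
Definition spread m := (32 * m ^ 5 + 8 * m ^ 3)%N.

Lemma explaining_near q m h y (x x' : point q) :
  x \in explaining q m h y -> x' \in explaining q m h y ->
  csqnorm (lin_form h x - lin_form h x') <= 8 * m%:R ^+ 2.
Proof.
rewrite !inE => hx hx'; have := in_boxB hx' hx.
have -> : y - lin_form h x' - (y - lin_form h x) = lin_form h x - lin_form h x' by ring.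
by move=> /in_box_csqnorm; rewrite exprMn; lra.
Qed.

Lemma csqnorm_fst m q h (x x' : point q) (c : R) :
  row_good m h -> x.2 = x'.2 -> c * m%:R <= (spread m)%:R ->
  csqnorm (lin_form h x - lin_form h x') <= c -> near_pt (spread m) x.1 x'.1.
Proof.
move=> /and3P[_ _ hm] e hc; have -> : lin_form h x - lin_form h x' =
    h ord0 ord0 * (gint R x.1 - gint R x'.1) by rewrite /lin_form e; ring.
move=> /(csqnorm_cancel (ler0n _ m) hm) hle; apply: (@gint_near R).
exact: le_trans hle hc.
Qed.

Lemma card_explaining q m h y : row_good m h ->
  (#|explaining q m h y| <= (2 * spread m).+1 ^ 2 * q ^ 2)%N.
Proof.
move=> gh; apply: card_near_fiber => x x' hx hx' e.
apply: csqnorm_fst gh e _ (explaining_near hx hx').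
rewrite /spread natrD !natrM.
have := ler0n R m => m0; have := exprn_ge0 5 m0; rewrite -subr_ge0; lra.
Qed.

Lemma card_quantize q m h (c : 'I__ * 'I__) : (0 < m)%N -> row_good m h ->
  (#|[set x : point q | quantize true m h x == c]|
    <= (2 * spread m).+1 ^ 2 * q ^ 2)%N.
Proof.
move=> m0 gh; apply: card_near_fiber => x x'; rewrite !inE => /eqP hx /eqP hx' e.
apply: csqnorm_fst gh e _ (quantize_near gh (etrans hx (esym hx'))).
rewrite -natrM ler_nat /spread.
have : (m <= m ^ 3)%N by rewrite -{1}(expn1 m) leq_pexp2l.
lia.
Qed.

(** Cramer's rule: the determinant times a coordinate difference is a combination of the differences
    [A] and [B] of the two forms, both bounded independently of [q]. *)
Lemma card_explaining_quantize q m a b y (c : 'I__ * 'I__) :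
  pair_good m a b ->
  (#|[set x : point q | (x \in explaining q m a y) && (quantize true m b x == c)]|
    <= ((2 * spread m).+1 ^ 2) ^ 2)%N.
Proof.
move=> /and3P[ga gb hdet]; apply: card_near2 => x x'.
rewrite !inE => /andP[hx /eqP qx] /andP[hx' /eqP qx'].
have ha : csqnorm (lin_form a x - lin_form a x') <= 8 * m%:R ^+ 2.
  by apply: (explaining_near (y := y)); rewrite inE.
have hb := quantize_near gb (etrans qx (esym qx')).
set A := lin_form a x - lin_form a x' in ha *.
set B := lin_form b x - lin_form b x' in hb *.
have box2 (z : R[i]) : in_box m%:R z -> csqnorm z <= 2 * m%:R ^+ 2.
  exact: in_box_csqnorm.
have bound (u v : R[i]) : csqnorm u <= 2 * m%:R ^+ 2 -> csqnorm v <= 2 * m%:R ^+ 2 ->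
    csqnorm (u * A - v * B) <= 32 * m%:R ^+ 4 + 8 * m%:R ^+ 2.
  move=> hu hv; apply: le_trans (csqnormD _ _) _; rewrite csqnormN !csqnormM.
  have := csqnorm_ge0 u; have := csqnorm_ge0 v; have := csqnorm_ge0 A.
  have := csqnorm_ge0 B => B0 A0 v0 u0.
  have h1 : csqnorm u * csqnorm A <= (2 * m%:R ^+ 2) * (8 * m%:R ^+ 2).
    by apply: ler_pM.
  have h2 : csqnorm v * csqnorm B <= (2 * m%:R ^+ 2) * 2 by apply: ler_pM.
  have -> : (32 * m%:R ^+ 4 + 8 * m%:R ^+ 2 : R) = 2 * ((2 * m%:R ^+ 2) * (8 * m%:R ^+ 2)
    + (2 * m%:R ^+ 2) * 2) by ring.
  by rewrite ler_pM2l// lerD.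
have fin (z w : 'I_q * 'I_q) :
    csqnorm (det2 a b * (gint R z - gint R w)) <= 32 * m%:R ^+ 4 + 8 * m%:R ^+ 2 ->
    near_pt (spread m) z w.
  move=> /(csqnorm_cancel (ler0n _ m) hdet) hle; apply: (@gint_near R).
  apply: le_trans hle _; rewrite /spread natrD !natrM.
  by rewrite le_eqVlt; apply/orP; left; apply/eqP; ring.
have /and3P[a0 a1 _] := ga; have /and3P[b0 b1 _] := gb.
apply/andP; split; apply: fin.
  have -> : det2 a b * (gint R x.1 - gint R x'.1) =
    b ord0 ord_max * A - a ord0 ord_max * B.
    by rewrite /A /B /lin_form /det2; ring.
  by apply: bound; exact: box2.
have -> : det2 a b * (gint R x.2 - gint R x'.2) =
    - (b ord0 ord0 * A - a ord0 ord0 * B).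
  by rewrite /A /B /lin_form /det2; ring.
by rewrite csqnormN; apply: bound; exact: box2.
Qed.

(** The real and imaginary parts of an explaining form are within [m] of those of [y], so each floor
    is one of [(2 * m).+1] consecutive integers. Reducing them modulo the number of cells can only
    merge values. *)
Lemma card_imset_quantize q th m h y :
  (#|quantize th m h @: explaining q m h y| <= (2 * m).+1 ^ 2)%N.
Proof.
pose s (i : 'I_(2 * m).+1 * 'I_(2 * m).+1) :=
  (residue (cells th m q) (Num.floor (complex.Re y) - m%:Z + i.1%:Z),
   residue (cells th m q) (Num.floor (complex.Im y) - m%:Z + i.2%:Z)).
have aux (c d : R) : `|c - d| <= m%:R -> exists i : 'I_(2 * m).+1,
    Num.floor d = Num.floor c - m%:Z + i%:Z.
  rewrite ler_norml => /andP[h1 h2].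
  have l1 : Num.floor d <= Num.floor c + m%:Z.
    rewrite -ltzD1 floor_lt_int !intrD /=.
    by have := floorD1_gt c; rewrite intrD /=; lra.
  have l2 : Num.floor c - m%:Z <= Num.floor d.
    rewrite floor_ge_int intrD mulrNz /=.
    by have := floor_le c; lra.
  have lt : (absz (Num.floor d - (Num.floor c - m%:Z))%R < (2 * m).+1)%N by lia.
  by exists (Ordinal lt) => /=; lia.
have sub : quantize th m h @: explaining q m h y \subset s @: [set: _].
  apply/fintype.subsetP => _ /imsetP[x + ->]; rewrite inE => hx.
  have ReB (u v : R[i]) : complex.Re (u - v) = complex.Re u - complex.Re v.
    by case: u v => ? ? [].
  have ImB (u v : R[i]) : complex.Im (u - v) = complex.Im u - complex.Im v.
    by case: u v => ? ? [].
  move: hx; rewrite /quantize /cell /in_box ReB ImB => /andP[/aux[i hi] /aux[j hj]].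
  by rewrite hi hj; apply/imsetP; exists (i, j).
rewrite (leq_trans (subset_leq_card sub))// (leq_trans (leq_imset_card _ _))//.
by rewrite cardsT card_prod !card_ord mulnn.
Qed.

End counting_points.

(** One constant for all uses: the first term bounds the points left by one or two forms, the second
    the number of cells divided by [q ^ 2], the third the cells compatible with one observation. *)
Definition overhead m :=
  ((2 * spread m).+1 ^ 4 + (8 * m).+3 ^ 2 + (2 * m).+1 ^ 2)%N.

Section grid_probabilities.
Variables (R : realType) (m q : nat).
Hypotheses (m0 : (0 < m)%N) (q0 : (0 < q)%N).

Let k : R := ln (overhead m)%:R.
Let L : R := ln (q ^ 2)%:R.
Let Q : R := (q ^ 2)%:R.
Let K : R := (overhead m)%:R.

Let Q0 : 0 < Q. Proof. by rewrite ltr0n expn_gt0 q0. Qed.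

Let Q1 : 1 <= Q. Proof. by rewrite ler1n expn_gt0 q0. Qed.

Let K1 : 1 <= K.
Proof. by rewrite ler1n /overhead !addn_gt0 !expn_gt0. Qed.

Let K0 : 0 < K. Proof. exact: lt_le_trans K1. Qed.

Let expL : expR L = Q. Proof. by rewrite lnK// posrE. Qed.
Let expk : expR k = K. Proof. by rewrite lnK// posrE. Qed.

Lemma overhead_ln_ge0 : 0 <= k. Proof. exact: ln_ge0. Qed.

Lemma grid_ln_ge0 : 0 <= L. Proof. exact: ln_ge0. Qed.

Let uprE (A : {pred point q}) : upr R A = #|A|%:R / Q ^+ 2.
Proof. by rewrite /upr !card_prod !card_ord -natrX mulnn -(mulnn (q ^ 2)). Qed.

Let le_K1 : ((2 * spread m).+1 ^ 2)%:R <= K.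
Proof.
rewrite ler_nat /overhead -addnA (@leq_trans ((2 * spread m).+1 ^ 4))//.
  by rewrite leq_pexp2l.
by rewrite leq_addr.
Qed.

Let le_K2 : (((2 * spread m).+1 ^ 2) ^ 2)%:R <= K.
Proof. by rewrite ler_nat /overhead -addnA -expnM leq_addr. Qed.

Lemma upr_explaining (h : 'rV[R[i]]_2) y : row_good m h ->
  upr R (mem (explaining q m h y)) <= expR (k - L).
Proof.
move=> gh; rewrite expRB expk expL uprE ler_pdivrMr ?exprn_gt0//.
rewrite expr2 mulrA divfK ?gt_eqF//.
apply: (@le_trans _ _ ((2 * spread m).+1 ^ 2 * q ^ 2)%:R).
  by rewrite ler_nat card_explaining.
by rewrite natrM ler_wpM2r// ltW.
Qed.

Lemma upr_explaining_quantize th (a b : 'rV[R[i]]_2) y c : pair_good m a b ->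
  upr R [pred x | (x \in explaining q m a y) && (quantize th m b x == c)]
    <= expR (k - L - th%:R * L).
Proof.
move=> gab; case: th c => c.
  rewrite mul1r !expRB expk expL uprE.
  rewrite -mulrA -invfM -expr2 ler_wpM2r ?invr_ge0 ?exprn_ge0 ?(ltW Q0)//.
  apply: le_trans le_K2; rewrite ler_nat.
  apply: leq_trans (card_explaining_quantize y c gab).
  by rewrite cardsE.
rewrite mul0r subr0; have /and3P[ga _ _] := gab.
by apply: le_trans (upr_explaining y ga); apply: upr_sub => x; rewrite !inE => /andP[].
Qed.

Lemma upr_quantize th (h : 'rV[R[i]]_2) c : row_good m h ->
  upr R [pred x : point q | quantize th m h x == c] <= expR (k - th%:R * L).
Proof.
move=> gh; case: th c => c.
  rewrite mul1r expRB expk expL uprE ler_pdivrMr ?exprn_gt0//.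
  rewrite expr2 mulrA divfK ?gt_eqF//.
  apply: (@le_trans _ _ ((2 * spread m).+1 ^ 2 * q ^ 2)%:R).
    by rewrite ler_nat -cardsE card_quantize.
  by rewrite natrM ler_wpM2r// ltW.
by rewrite mul0r subr0 expk; apply: le_trans (upr_le1 _ _) _.
Qed.

Lemma card_imset_quantize_overhead th (h : 'rV[R[i]]_2) y :
  (#|quantize th m h @: explaining q m h y| <= overhead m)%N.
Proof. by rewrite (leq_trans (card_imset_quantize _ _ _ _ _))// leq_addl. Qed.

Lemma card_cells th :
  #|{: 'I_(cells th m q).+1 * 'I_(cells th m q).+1}|%:R <= expR (k + th%:R * L).
Proof.
rewrite card_prod !card_ord mulnn; case: th => /=; last first.
  by rewrite mul0r addr0 expk.
rewrite mul1r expRD expk expL -natrM ler_nat.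
apply: (@leq_trans ((8 * m).+3 ^ 2 * q ^ 2)).
  by rewrite -expnMn leq_exp2r//; nia.
by rewrite leq_mul2r; apply/orP; right; rewrite /overhead -addnA addnCA leq_addr.
Qed.

End grid_probabilities.

(** * Finitely valued random variables *)

Local Open Scope classical_set_scope.
Local Open Scope ring_scope.

Section finite_valued_maps.
Context d (T : measurableType d).

(** Measurability through fibres needs no sigma-algebra on [F], and it is preserved by every
    function between finite types, however it is computed. *)
Definition finmeas (F : finType) (g : T -> F) :=
  forall y, measurable (g @^-1` [set y]).

Lemma finmeas_preimage (F : finType) (g : T -> F) (A : set F) :
  finmeas g -> measurable (g @^-1` A).
Proof.
move=> mg; have -> : g @^-1` A = \bigcup_(y in A) (g @^-1` [set y]).
  apply/seteqP; split => [x Ax|x [y Ay xy]]; first by exists (g x).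
  by rewrite /preimage/= xy.
by apply: fin_bigcup_measurable => // y _; exact: mg.
Qed.

Lemma finmeas_comp (F F' : finType) (phi : F -> F') (g : T -> F) :
  finmeas g -> finmeas (phi \o g).
Proof. by move=> mg y; rewrite comp_preimage; exact: finmeas_preimage. Qed.

Lemma finmeas_cst (F : finType) (y : F) : finmeas (fun=> y).
Proof.
by move=> z; rewrite preimage_cst; case: ifPn => _; [exact: measurableT|exact: measurable0].
Qed.

Lemma finmeas_ffun (I F : finType) (g : I -> T -> F) :
  (forall i, finmeas (g i)) -> finmeas (fun x => [ffun i => g i x]).
Proof.
move=> mg y.
have -> : (fun x => [ffun i => g i x]) @^-1` [set y] =
    \bigcap_(i in [set: I]) (g i @^-1` [set y i]).
  apply/seteqP; split => [x /= <- i _ /=|x H /=]; first by rewrite ffunE.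
  by apply/ffunP => i; rewrite ffunE; exact: H.
by apply: fin_bigcap_measurable => // i _; exact: mg.
Qed.

(** Reduces the measurability of encoders, decoders and typical events to that of finitely many
    elementary tests, with no condition on [phi]. *)
Lemma finmeas_app (I F F' : finType) (phi : (I -> F) -> F') (g : I -> T -> F) :
  (forall i, finmeas (g i)) -> finmeas (fun x => phi (g^~ x)).
Proof.
move=> mg.
have -> : (fun x => phi (g^~ x)) =
    (fun y : {ffun I -> F} => phi y) \o (fun x => [ffun i => g i x]).
  apply/funext => x /=; congr phi; apply/funext => i; by rewrite ffunE.
by apply: finmeas_comp; exact: finmeas_ffun.
Qed.

Lemma finmeas_pair (F F' : finType) (g : T -> F) (g' : T -> F') :
  finmeas g -> finmeas g' -> finmeas (fun x => (g x, g' x)).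
Proof.
move=> mg mg' [y y'].
have -> : (fun x => (g x, g' x)) @^-1` [set (y, y')] =
    g @^-1` [set y] `&` g' @^-1` [set y'].
  by apply/seteqP; split => x /= => [[]//|[-> ->]].
by apply: measurableI; [exact: mg|exact: mg'].
Qed.

Lemma finmeas_app2 (F F' G : finType) (phi : F -> F' -> G) (g : T -> F) (g' : T -> F') :
  finmeas g -> finmeas g' -> finmeas (fun x => phi (g x) (g' x)).
Proof.
by move=> mg mg'; exact: (finmeas_comp (uncurry phi) (finmeas_pair mg mg')).
Qed.

Lemma finmeas_bool (b : T -> bool) : measurable [set x | b x] -> finmeas b.
Proof.
move=> mb [].
  rewrite [X in measurable X](_ : _ = [set x | b x])//.
rewrite [X in measurable X](_ : _ = ~` [set x | b x]); first exact: measurableC.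
by apply/seteqP; split => x /=; [move=> ->|move/negP/negPf].
Qed.

Lemma measurable_finmeas (F : finType) d' (U : measurableType d') (phi : F -> U)
  (g : T -> F) : finmeas g -> measurable_fun setT (phi \o g).
Proof.
move=> mg _ Y _; rewrite setTI comp_preimage; exact: finmeas_preimage.
Qed.

End finite_valued_maps.

Lemma finmeas_measurable_comp d d' (T : measurableType d) (U : measurableType d')
    (F : finType) (h : U -> T) (g : T -> F) :
  measurable_fun setT h -> finmeas g -> finmeas (g \o h).
Proof.
move=> mh mg y; rewrite comp_preimage -[X in measurable X]setTI.
by apply: mh => //; exact: mg.
Qed.

Section finite_law.
Context d (T : measurableType d) (R : realType) (P : probability T R).

Lemma finmeas_prob (F : finType) (g : T -> F) (A : {pred F}) : finmeas g ->
  P (g @^-1` [set y | y \in A]) = (\sum_(y in A) fine (P (g @^-1` [set y])))%:E.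
Proof.
move=> mg; rewrite -sumEFin.
under eq_bigr do rewrite fineK ?fin_num_measure//.
rewrite -big_enum fsbig_seq ?enum_uniq// -measure_fin_bigcup//.
- congr (P _); apply/seteqP; split => [x /= Ax|x [y /= Ay xy]].
    by exists (g x) => //=; rewrite mem_enum.
  by rewrite /preimage/= xy; rewrite mem_enum in Ay.
- by apply/trivIsetP => y z _ _ /eqP yz; apply/seteqP; split => x //= [xy xz];
    case: yz; rewrite -xy -xz.
Qed.

(* Chebyshev's inequality, computed on the finite law of the indicators. *)
Lemma pairwise_independent_deviation (I : finType) (E : I -> set T) (p : I -> R)
    (A : {set I}) (a : R) :
  0 < a ->
  (forall i, measurable (E i)) -> (forall i, P (E i) = (p i)%:E) ->
  (forall i j, i != j -> P (E i `&` E j) = (P (E i) * P (E j))%E) ->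
  (P [set x | (a <= `| #|[set i in A | x \in E i]%SET|%:R - \sum_(i in A) p i |)%R]
    <= (#|A|%:R / a ^+ 2)%:E)%E.
Proof.
move=> a0 mE pE indE.
pose g (x : T) : {ffun I -> bool} := [ffun i => x \in E i].
have mg : finmeas g.
  apply: finmeas_ffun => i; apply: finmeas_bool.
  by rewrite [X in measurable X](_ : _ = E i)//; apply/seteqP; split => x /=; rewrite inE.
pose mu y : R := fine (P (g @^-1` [set y])).
have mu0 y : 0 <= mu y by rewrite fine_ge0.
have muA (D : {pred {ffun I -> bool}}) :
    P (g @^-1` [set y | y \in D]) = (\sum_(y in D) mu y)%:E by exact: finmeas_prob.
have mu1 : \sum_y mu y = 1.
  have := muA predT; rewrite [g @^-1` _](_ : _ = setT) ?probability_setT; last first.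
    by apply/seteqP; split.
  by move=> /(congr1 fine)/= e; rewrite [RHS]e; apply: eq_bigl.
have muE i : \sum_y mu y * (y i)%:R = p i.
  have := muA [pred y : {ffun I -> bool} | y i].
  rewrite [g @^-1` _](_ : _ = E i); last first.
    by apply/seteqP; split => x /=; rewrite /preimage/= inE/= ffunE inE.
  rewrite pE => /(congr1 fine)/= ->; rewrite [RHS]big_mkcond; apply: eq_bigr => y _.
  by rewrite inE/=; case: (y i); rewrite ?mulr1 ?mulr0.
have muEE i j : i != j -> \sum_y mu y * ((y i)%:R * (y j)%:R) = p i * p j.
  move=> ij; have := muA [pred y : {ffun I -> bool} | y i && y j].
  rewrite [g @^-1` _](_ : _ = E i `&` E j); last first.
    apply/seteqP; split => x /=; rewrite /preimage/= inE/= !ffunE.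
      by move=> /andP[]; rewrite !inE.
    by move=> [? ?]; apply/andP; rewrite !inE.
  rewrite indE// !pE -EFinM => /(congr1 fine)/= ->.
  rewrite [RHS]big_mkcond; apply: eq_bigr => y _.
  by rewrite inE/=; case: (y i); case: (y j); rewrite ?mulr1 ?mulr0.
pose X (y : {ffun I -> bool}) : R := \sum_(i in A) ((y i)%:R - p i).
have XE x : #|[set i in A | x \in E i]%SET|%:R - \sum_(i in A) p i = X (g x).
  rewrite /X sumrB; congr (_ - _).
  rewrite -sum1_card natr_sum [in LHS]big_mkcond [in RHS]big_mkcond/=.
  by apply: eq_bigr => i _; rewrite inE ffunE; case: (i \in A); case: (x \in E i).
(* The cross terms vanish by pairwise independence, and each diagonal term is the mean of a quantity
   at most 1. *)
have secmom : \sum_y mu y * X y ^+ 2 <= #|A|%:R.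
  under eq_bigr do rewrite expr2 big_distrlr/= mulr_sumr.
  rewrite exchange_big/= -sum1_card natr_sum; apply: ler_sum => i iA.
  under eq_bigr do rewrite mulr_sumr.
  rewrite exchange_big/= (bigD1 i)//= [X in _ + X]big1 ?addr0.
    apply: (@le_trans _ _ (\sum_y mu y)); last by rewrite mu1.
    apply: ler_sum => y _; rewrite ler_piMr// -expr2.
    have p0 : 0 <= p i by rewrite -lee_fin -pE measure_ge0.
    have p1 : p i <= 1 by rewrite -lee_fin -pE probability_le1.
    by case: (y i) => /=; nra.
  move=> j /andP[jA ji].
  transitivity (\sum_y (mu y * ((y i)%:R * (y j)%:R) - p j * (mu y * (y i)%:R)
     - p i * (mu y * (y j)%:R) + p i * p j * mu y)).
    by apply: eq_bigr => y _; ring.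
  rewrite big_split/= !sumrB -!mulr_sumr !muE mu1 muEE 1?eq_sym//; ring.
rewrite [X in P X](_ : _ = g @^-1` [set y | y \in [pred y | a <= `|X y|]]); last first.
  by apply/seteqP; split => x /=; rewrite /preimage/= inE/= XE.
rewrite muA lee_fin ler_pdivlMr ?exprn_gt0//; apply: le_trans secmom.
rewrite mulr_suml [leLHS]big_mkcond/=; apply: ler_sum => y _.
case: ifP => [|_]; last by rewrite mulr_ge0// sqr_ge0.
rewrite inE => aX; rewrite ler_wpM2l// -[leRHS]real_normK ?num_real//.
by rewrite lerXn2r ?nnegrE// ltW.
Qed.

End finite_law.

(** * Measurability of complex and matrix valued maps *)

Section measurable_coordinates.
Variable R : realType.

Lemma measurable_complex_coords : measurable_fun setT (@complex_coords R).
Proof. by move=> _ Y mY; exists Y. Qed.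

Lemma measurable_Re : measurable_fun setT (@complex.Re R).
Proof. exact: (measurableT_comp measurable_fst measurable_complex_coords). Qed.

Lemma measurable_Im : measurable_fun setT (@complex.Im R).
Proof. exact: (measurableT_comp measurable_snd measurable_complex_coords). Qed.

Lemma measurable_entry d (T : measurableType d) m n (i : 'I_m) (j : 'I_n) :
  measurable_fun setT (fun A : 'M[T]_(m, n) => A i j).
Proof.
move=> _ Y mY; apply: sub_sigma_algebra.
by exists (i, j) => //; exists Y.
Qed.

Context d (T : measurableType d).

Lemma measurable_fun_complexP (f : T -> R[i]) :
  measurable_fun setT f <->
  measurable_fun setT (fun x => complex.Re (f x)) /\
  measurable_fun setT (fun x => complex.Im (f x)).
Proof.
split=> [mf|[mr mi]].
  by split; [exact: (measurableT_comp measurable_Re mf)|exact: (measurableT_comp measurable_Im mf)].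
move=> _ _ [Y mY <-].
have := measurable_fun_pair mr mi measurableT mY.
by rewrite !setTI.
Qed.

Lemma measurable_complexD (f g : T -> R[i]) :
  measurable_fun setT f -> measurable_fun setT g ->
  measurable_fun setT (fun x => f x + g x).
Proof.
move=> /measurable_fun_complexP[fr fi] /measurable_fun_complexP[gr gi].
apply/measurable_fun_complexP; split.
  rewrite (_ : (fun _ => _) = (fun x => complex.Re (f x) + complex.Re (g x))).
    exact: measurable_funD.
  by apply/funext => x; case: (f x) (g x) => ? ? [].
rewrite (_ : (fun _ => _) = (fun x => complex.Im (f x) + complex.Im (g x))).
  exact: measurable_funD.
by apply/funext => x; case: (f x) (g x) => ? ? [].
Qed.

Lemma measurable_complexN (f : T -> R[i]) :
  measurable_fun setT f -> measurable_fun setT (fun x => - f x).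
Proof.
move=> /measurable_fun_complexP[fr fi].
apply/measurable_fun_complexP; split.
  rewrite (_ : (fun _ => _) = (fun x => - complex.Re (f x))).
    exact: measurableT_comp.
  by apply/funext => x; case: (f x).
rewrite (_ : (fun _ => _) = (fun x => - complex.Im (f x))).
  exact: measurableT_comp.
by apply/funext => x; case: (f x).
Qed.

Lemma measurable_complexM (f g : T -> R[i]) :
  measurable_fun setT f -> measurable_fun setT g ->
  measurable_fun setT (fun x => f x * g x).
Proof.
move=> /measurable_fun_complexP[fr fi] /measurable_fun_complexP[gr gi].
apply/measurable_fun_complexP; split.
  rewrite (_ : (fun _ => _) = (fun x => complex.Re (f x) * complex.Re (g x)
    - complex.Im (f x) * complex.Im (g x))).
    by apply: measurable_funB; exact: measurable_funM.
  by apply/funext => x; case: (f x) (g x) => ? ? [].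
rewrite (_ : (fun _ => _) = (fun x => complex.Re (f x) * complex.Im (g x)
    + complex.Im (f x) * complex.Re (g x))).
  by apply: measurable_funD; exact: measurable_funM.
by apply/funext => x; case: (f x) (g x) => ? ? [].
Qed.

Lemma measurable_csqnorm (f : T -> R[i]) :
  measurable_fun setT f -> measurable_fun setT (fun x => csqnorm (f x)).
Proof.
move=> /measurable_fun_complexP[fr fi].
by apply: measurable_funD; exact: measurable_funX.
Qed.

Lemma finmeas_le (f g : T -> R) : measurable_fun setT f -> measurable_fun setT g ->
  finmeas (fun x => f x <= g x).
Proof.
move=> mf mg y; have := measurable_fun_ler mf mg measurableT (Y := [set y]).
by rewrite setTI; apply.
Qed.

Lemma finmeas_in_box m (f : T -> R[i]) : measurable_fun setT f ->
  finmeas (fun x => in_box m (f x)).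
Proof.
move=> /measurable_fun_complexP[fr fi].
by apply: (finmeas_app2 andb); apply: finmeas_le => //; exact: measurableT_comp.
Qed.

(** The floor takes infinitely many values, so a fibre is a countable union of preimages of
    half-open intervals. *)
Lemma finmeas_floor (F : finType) (phi : int -> F) (f : T -> R) :
  measurable_fun setT f -> finmeas (fun x => phi (Num.floor (f x))).
Proof.
move=> mf y.
have -> : (fun x => phi (Num.floor (f x))) @^-1` [set y] =
    \bigcup_z (f @^-1` [set r | phi z = y /\ z%:~R <= r < (z + 1)%:~R]).
  apply/seteqP; split => [x /= h|x [z _ [/= zy h]]].
    by exists (Num.floor (f x)) => //=; split => //; exact: floor_itv.
  by rewrite (floor_def h).
apply: countable_bigcupT_measurable => [|z]; first exact: countableP.
rewrite -[X in measurable X]setTI; apply: mf => //.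
have [zy|zy] := pselect (phi z = y); last first.
  rewrite [X in measurable X](_ : _ = set0); first exact: measurable0.
  by apply/seteqP; split => r // [].
rewrite [X in measurable X](_ : _ = [set` `[z%:~R, (z + 1)%:~R[]).
  exact: measurable_itv.
by apply/seteqP; split => r /=; rewrite in_itv/=; [case|split].
Qed.

Lemma finmeas_cell M (f : T -> R[i]) : measurable_fun setT f ->
  finmeas (fun x => cell M (f x)).
Proof.
move=> /measurable_fun_complexP[fr fi].
by apply: finmeas_pair; exact: finmeas_floor.
Qed.

Lemma measurable_lin_form q (h : T -> 'rV[R[i]]_2) (x : point q) :
  measurable_fun setT h -> measurable_fun setT (fun w => lin_form (h w) x).
Proof.
move=> mh; have me j : measurable_fun setT (fun w => h w ord0 j).
  exact: (measurableT_comp (measurable_entry _ _) mh).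
by apply: measurable_complexD; apply: measurable_complexM => //; exact: measurable_cst.
Qed.

Lemma finmeas_row_good m (h : T -> 'rV[R[i]]_2) : measurable_fun setT h ->
  finmeas (fun w => row_good m (h w)).
Proof.
move=> mh; have me j : measurable_fun setT (fun w => h w ord0 j).
  exact: (measurableT_comp (measurable_entry _ _) mh).
apply: (finmeas_app2 andb); first exact: finmeas_in_box.
apply: (finmeas_app2 andb); first exact: finmeas_in_box.
apply: finmeas_le; first exact: measurable_cst.
by apply: measurable_funM; [exact: measurable_csqnorm|exact: measurable_cst].
Qed.

Lemma finmeas_pair_good m (a b : T -> 'rV[R[i]]_2) :
  measurable_fun setT a -> measurable_fun setT b ->
  finmeas (fun w => pair_good m (a w) (b w)).
Proof.
move=> ma mb; have mea j : measurable_fun setT (fun w => a w ord0 j).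
  exact: (measurableT_comp (measurable_entry _ _) ma).
have meb j : measurable_fun setT (fun w => b w ord0 j).
  exact: (measurableT_comp (measurable_entry _ _) mb).
apply: (finmeas_app2 andb); first exact: finmeas_row_good.
apply: (finmeas_app2 andb); first exact: finmeas_row_good.
apply: finmeas_le; first exact: measurable_cst.
apply: measurable_funM; last exact: measurable_cst.
apply: measurable_csqnorm; apply: measurable_complexD.
  exact: measurable_complexM.
by apply: measurable_complexN; exact: measurable_complexM.
Qed.

End measurable_coordinates.

Lemma measurable_matrix d d' (T : measurableType d) (U : measurableType d') m n
    (f : T -> 'M[U]_(m, n)) :
  (forall i j, measurable_fun setT (fun x => f x i j)) -> measurable_fun setT f.
Proof.
move=> mf; apply: (@measurability _ _ _ _ _ _ (\bigcup_(ij in [set: 'I_m * 'I_n])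
   preimage_set_system setT (fun A : 'M[U]_(m, n) => A ij.1 ij.2) measurable)) => //.
move=> _ [_ [[i j] _ [Y mY <-]] <-]; rewrite !setTI.
have := mf i j measurableT Y mY; rewrite setTI.
by [].
Qed.

(** * Almost sure independence of the channel vectors *)

Section nondegenerate_channels.
Variable R : realType.

Lemma eventually_ge (x : R) : exists m0 : nat, forall m, (m0 <= m)%N -> x <= m%:R.
Proof.
exists (Num.truncn `|x|).+1 => m hm; apply: (le_trans (ler_norm x)).
apply: (@le_trans _ _ (Num.truncn `|x|).+1%:R); last by rewrite ler_nat.
by apply: ltW; rewrite truncnS_gt.
Qed.

Lemma product_measure_null d d' (T : measurableType d) (U : measurableType d')
    (m1 : {measure set T -> \bar R}) (m2 : {sigma_finite_measure set U -> \bar R})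
    (A : set (T * U)) : (forall x, m2 (xsection A x) = 0)%E -> ((m1 \x m2) A = 0)%E.
Proof.
by move=> A0; rewrite /product_measure1; apply: integral0_eq => x _; exact: A0.
Qed.

Lemma lebesgue2_point (p : R * R) :
  ((@lebesgue_measure R \x @lebesgue_measure R) [set p] = 0)%E.
Proof.
apply: product_measure_null => x.
have [xp|xp] := eqVneq x p.1.
  rewrite [xsection _ _](_ : _ = [set p.2]); first exact: lebesgue_measure_set1.
  apply/seteqP; split => y; rewrite xsectionP/=; first by move=> <-.
  by move=> ->; rewrite xp; case: p {xp}.
rewrite [xsection _ _](_ : _ = set0) ?measure0//.
by apply/seteqP; split => y //; rewrite xsectionP/= => e; move: xp; rewrite -e eqxx.
Qed.

Lemma measurable_complex_of_pair : measurable_fun setT (@complex_of_pair R).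
Proof.
by apply/measurable_fun_complexP; split; rewrite /complex_of_pair /=;
  [exact: measurable_fst|exact: measurable_snd].
Qed.

Lemma measurable_row_of_coords : measurable_fun setT (@row_of_coords R).
Proof.
apply: measurable_matrix => i j.
have [j0|j0] := eqVneq j ord0.
  rewrite (_ : (fun _ => _) = @complex_of_pair R \o fst); last first.
    by apply/funext => x /=; rewrite mxE j0.
  exact: measurableT_comp measurable_complex_of_pair measurable_fst.
rewrite (_ : (fun _ => _) = @complex_of_pair R \o snd); last first.
  by apply/funext => x /=; rewrite mxE (negPf j0).
exact: measurableT_comp measurable_complex_of_pair measurable_snd.
Qed.

Lemma lebesgue2_sigma_finite : sigma_finite setT (@lebesgue_measure R \x @lebesgue_measure R)%E.
Proof.
pose I n := `[- n%:R, n%:R]%classic : set R.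
exists (fun n => I n `*` I n).
  apply/seteqP; split => // -[x y] _.
  have [n hn] := eventually_ge (Num.max `|x| `|y|).
  have := hn n (leqnn n); rewrite ge_max => /andP[hx hy].
  by exists n => //; split; rewrite /I/= in_itv/= -ler_norml.
move=> n; split; first by apply: measurableX; exact: measurable_itv.
rewrite product_measure1E; [|exact: measurable_itv..].
have fI : (@lebesgue_measure R (I n) < +oo)%E.
  by rewrite /I lebesgue_measure_itv/=; case: ifP => _; rewrite -?EFinB ltry.
by rewrite lte_mul_pinfty// ge0_fin_numE.
Qed.

Definition lebesgue2 :=
  HB.pack_for {sigma_finite_measure set (measurableTypeR R * measurableTypeR R)%type -> \bar R}
    (@lebesgue_measure R \x @lebesgue_measure R)%E
    (Measure_isSigmaFinite.Build _ _ _ (@lebesgue_measure R \x @lebesgue_measure R)%E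
       lebesgue2_sigma_finite).

(* The library does not see a product of two sigma-finite measures as
   sigma-finite; naming [lebesgue2] makes the 4-dimensional product a measure. *)
Definition lebesgue4 : {measure set _ -> \bar R} := (lebesgue2 \x lebesgue2)%E.

Lemma density_null (mu : probability 'rV[R[i]]_2 R) (A : set 'rV[R[i]]_2) :
  has_density mu -> measurable A ->
  lebesgue4 (@row_of_coords R @^-1` A) = 0%E -> mu A = 0%E.
Proof.
move=> [f [mf _ fE]] mA A0; rewrite (fE A mA).
have mN : measurable (@row_of_coords R @^-1` A).
  by rewrite -[X in measurable X]setTI; apply: measurable_row_of_coords.
have mfN : measurable_fun (@row_of_coords R @^-1` A) (EFin \o f).
  by apply/measurable_EFinP; exact: measurable_funTS mf.
have H := @null_set_integral _ _ _ lebesgue4 _ (EFin \o f) mN mfN A0.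
exact: H.
Qed.

Lemma complex_of_pair_inj : injective (@complex_of_pair R).
Proof. by case=> a b [c d] [-> ->]. Qed.

Lemma complex_of_pairK (z : R[i]) : complex_of_pair (complex.Re z, complex.Im z) = z.
Proof. by case: z. Qed.

Lemma measurable_point (p : R * R) : measurable [set p].
Proof.
rewrite [X in measurable X](_ : _ = [set p.1] `*` [set p.2]).
  by apply: measurableX; exact: measurable_set1.
by case: p => a b; apply/seteqP; split => -[u v] /=; [case=> -> ->|case=> -> ->].
Qed.

Lemma measurable_zeros d (T : measurableType d) (f : T -> R[i]) :
  measurable_fun setT f -> measurable [set x | f x = 0].
Proof.
move=> mf; have -> : [set x | f x = 0] = f @^-1` [set 0] by [].
rewrite -[X in measurable X]setTI; apply: mf => //.
exists [set (0, 0)]; first exact: measurable_point.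
by apply/seteqP; split => -[a b] /=; [move=> [_ [-> ->]]|move=> [-> ->]].
Qed.

Lemma measurable_entry_zero : measurable [set h : 'rV[R[i]]_2 | h ord0 ord0 = 0].
Proof. by apply: measurable_zeros; exact: measurable_entry. Qed.

Lemma measurable_det_zero (a : 'rV[R[i]]_2) : measurable [set b | det2 a b = 0].
Proof.
apply: measurable_zeros.
have me j : measurable_fun setT (fun b : 'rV[R[i]]_2 => b ord0 j).
  exact: measurable_entry.
apply: measurable_complexD; last apply: measurable_complexN;
  by apply: measurable_complexM => //; exact: measurable_cst.
Qed.

Lemma row_entry_null (mu : probability 'rV[R[i]]_2 R) : has_density mu ->
  mu [set h | h ord0 ord0 = 0] = 0%E.
Proof.
move=> dmu; apply: density_null => //.
  exact: measurable_entry_zero.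
have -> : @row_of_coords R @^-1` [set h | h ord0 ord0 = 0] = [set (0, 0)] `*` setT.
  apply/seteqP; split => -[a b] /=; rewrite mxE/=.
    by move=> /(@complex_of_pair_inj a (0, 0)) ->.
  by move=> [-> _].
transitivity (lebesgue2 [set (0%R, 0%R)] * lebesgue2 setT)%E.
  by apply: product_measure1E; [exact: measurable_point|exact: measurableT].
by rewrite [X in (X * _)%E](_ : _ = 0%E) ?mul0e//; exact: lebesgue2_point.
Qed.

(** As the first entry of [a] is nonzero, the first entry of [b] determines the second: every
    section of the zero set is a single point. *)
Lemma det_null (mu : probability 'rV[R[i]]_2 R) (a : 'rV[R[i]]_2) : has_density mu ->
  a ord0 ord0 != 0 -> mu [set b | det2 a b = 0] = 0%E.
Proof.
move=> dmu a0; apply: density_null => //.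
  exact: measurable_det_zero.
apply: product_measure_null => p.
pose z : R[i] := a ord0 ord_max * complex_of_pair p / a ord0 ord0.
rewrite [xsection _ _](_ : _ = [set (complex.Re z, complex.Im z)]).
  exact: lebesgue2_point.
apply/seteqP; split => y; rewrite xsectionP /det2 /preimage/= !mxE/=.
  move=> /eqP; rewrite subr_eq0 => /eqP e; apply: complex_of_pair_inj.
  by rewrite complex_of_pairK /z -e mulrAC mulfV// mul1r.
by move=> ->; rewrite complex_of_pairK /z mulrC divfK// subrr.
Qed.

Definition bad_pairs (m : nat) : set ('rV[R[i]]_2 * 'rV[R[i]]_2) :=
  [set ab | ~~ pair_good m ab.1 ab.2].

Lemma measurable_bad_pairs m : measurable (bad_pairs m).
Proof.
have h := finmeas_pair_good m (@measurable_fst _ _ 'rV[R[i]]_2 'rV[R[i]]_2)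
  measurable_snd.
rewrite [bad_pairs m](_ : _ = (fun ab : 'rV[R[i]]_2 * 'rV[R[i]]_2 =>
  pair_good m ab.1 ab.2) @^-1` [set false]); first exact: h.
by apply/seteqP; split => ab /=; [move=> /negPf|move=> /negbT].
Qed.

Lemma in_box_mono (x y : R) z : x <= y -> in_box x z -> in_box y z.
Proof. by move=> xy /andP[h1 h2]; apply/andP; split; apply: le_trans xy. Qed.

Lemma row_good_mono m m' (h : 'rV[R[i]]_2) : (m <= m')%N -> row_good m h -> row_good m' h.
Proof.
move=> mm' /and3P[h1 h2 h3].
have mmR : m%:R <= m'%:R :> R by rewrite ler_nat.
apply/and3P; split; [exact: in_box_mono h1|exact: in_box_mono h2|].
by apply: le_trans h3 _; rewrite ler_wpM2l// csqnorm_ge0.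
Qed.

Lemma pair_good_mono m m' (a b : 'rV[R[i]]_2) : (m <= m')%N ->
  pair_good m a b -> pair_good m' a b.
Proof.
move=> mm' /and3P[h1 h2 h3].
apply/and3P; split; [exact: row_good_mono h1|exact: row_good_mono h2|].
by apply: le_trans h3 _; rewrite ler_wpM2l ?csqnorm_ge0// ler_nat.
Qed.

Lemma csqnorm_gt0 (z : R[i]) : z != 0 -> 0 < csqnorm z.
Proof.
case: z => a b; rewrite eq_complex/= negb_and /csqnorm/= => /orP[|] h.
  by rewrite ltr_wpDr ?sqr_ge0// lt_def sqr_ge0 sqrf_eq0 h.
by rewrite ltr_wpDl ?sqr_ge0// lt_def sqr_ge0 sqrf_eq0 h.
Qed.

Lemma eventually_in_box (z : R[i]) :
  exists m0 : nat, forall m, (m0 <= m)%N -> in_box m%:R z.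
Proof.
have [m1 h1] := eventually_ge `|complex.Re z|.
have [m2 h2] := eventually_ge `|complex.Im z|.
exists (maxn m1 m2) => m; rewrite geq_max => /andP[l1 l2].
by rewrite /in_box h1// h2.
Qed.

Lemma eventually_scaled (z : R[i]) : z != 0 ->
  exists m0 : nat, forall m, (m0 <= m)%N -> 1 <= csqnorm z * m%:R.
Proof.
move=> /csqnorm_gt0 z0; have [m0 h] := eventually_ge (csqnorm z)^-1.
by exists m0 => m /h hm; rewrite mulrC -ler_pdivrMr// div1r.
Qed.

Lemma eventually_row_good (h : 'rV[R[i]]_2) : h ord0 ord0 != 0 ->
  exists m0 : nat, forall m, (m0 <= m)%N -> row_good m h.
Proof.
move=> /eventually_scaled[m1 h1]; have [m2 h2] := eventually_in_box (h ord0 ord0).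
have [m3 h3] := eventually_in_box (h ord0 ord_max).
exists (maxn m1 (maxn m2 m3)) => m; rewrite !geq_max => /and3P[l1 l2 l3].
by rewrite /row_good h1// h2// h3.
Qed.

(** Outside these three degenerate cases each requirement of [pair_good] holds from some level
    on. *)
Lemma bigcap_bad_pairs (a b : 'rV[R[i]]_2) : (\bigcap_m bad_pairs m) (a, b) ->
  [\/ a ord0 ord0 = 0, b ord0 ord0 = 0 | det2 a b = 0].
Proof.
move=> bad; have [|/eventually_row_good[m1 h1]] := eqVneq (a ord0 ord0) 0; first by constructor 1.
have [|/eventually_row_good[m2 h2]] := eqVneq (b ord0 ord0) 0; first by constructor 2.
have [|/eventually_scaled[m3 h3]] := eqVneq (det2 a b) 0; first by constructor 3.
exfalso; have /negP := bad (maxn m1 (maxn m2 m3)) I; apply.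
rewrite /pair_good/= h1 ?h2 ?h3//= ?leq_max ?leqnn ?orbT//.
Qed.

(** Continuity from above along the decreasing sets [bad_pairs m]. The intersection is null: pairs
    whose first vector has a vanishing first entry are split off as [A], and on the rest the
    sections are null by [det_null]. *)
Lemma product_bad_pairs (mu1 mu2 : probability 'rV[R[i]]_2 R) :
  has_density mu1 -> has_density mu2 ->
  ((mu1 \x mu2)%E \o bad_pairs) m @[m --> \oo] --> 0%E.
Proof.
move=> d1 d2; pose mu12 : {measure set _ -> \bar R} := (mu1 \x mu2)%E.
rewrite -[X in X \o _]/(mu12 : _ -> _).
have mcap : measurable (\bigcap_m bad_pairs m).
  by apply: bigcapT_measurable; exact: measurable_bad_pairs.
have cap0 : mu12 (\bigcap_m bad_pairs m) = 0%E.
  pose A := [set h : 'rV[R[i]]_2 | h ord0 ord0 = 0].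
  have mA : measurable A.
    exact: measurable_entry_zero.
  have mA2 : measurable (A `*` [set: 'rV[R[i]]_2]) by exact: measurableX.
  pose B := (\bigcap_m bad_pairs m) `\` (A `*` setT).
  have mB : measurable B by exact: measurableD.
  apply: (@subset_measure0 _ _ _ _ _ ((A `*` setT) `|` B)) => //.
  - exact: measurableU.
  - move=> x xc; have [xA|xA] := pselect ((A `*` setT) x); first by left.
    by right; split.
  have B0 : mu12 B = 0%E; last first.
    apply: etrans (measureU0 mA2 mB B0) _.
    transitivity (mu1 A * mu2 setT)%E; first exact: product_measure1E.
    by rewrite row_entry_null// mul0e.
  apply: product_measure_null => a.
  have [a0|a0] := eqVneq (a ord0 ord0) 0.
    rewrite [xsection _ _](_ : _ = set0) ?measure0//.
    by apply/seteqP; split => b //; rewrite xsectionP => -[_ []]; split.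
  pose N := [set b : 'rV[R[i]]_2 | b ord0 ord0 = 0] `|` [set b | det2 a b = 0].
  apply: (@subset_measure0 _ _ _ _ _ N).
  - exact: measurable_xsection.
  - exact: measurableU measurable_entry_zero (measurable_det_zero a).
  - move=> b; rewrite xsectionP => -[/bigcap_bad_pairs[e|e|e] _].
    + by rewrite e eqxx in a0.
    + by left.
    + by right.
  apply: etrans (measureU0 measurable_entry_zero (measurable_det_zero a) _) _.
    exact: det_null.
  exact: row_entry_null.
rewrite -cap0; apply: nonincreasing_cvg_mu => //.
- by apply: le_lt_trans (ltry 1); exact: probability_le1 (measurable_bad_pairs 0).
- exact: measurable_bad_pairs.
- apply/nonincreasing_seqP => m; apply/subsetPset => ab /=.
  by apply: contraNN; exact: pair_good_mono.
Qed.

End nondegenerate_channels.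

(** * Consequences of mutual independence *)

Section independence_lemmas.
Context d (T : measurableType d) (R : realType) (P : probability T R).

Lemma mutually_independent2 (I : eqType) (F : I -> set (set T)) (i j : I) A B :
  mutually_independent P F -> i != j -> F i A -> F j B ->
  P (A `&` B) = (P A * P B)%E.
Proof.
move=> ind ij FA FB; have ji : (j == i) = false by rewrite eq_sym (negPf ij).
have := ind [:: i; j] (fun x => if x == i then A else B).
rewrite /= inE ij => /(_ isT) h.
have : forall x, x \in [:: i; j] -> F x (if x == i then A else B).
  by move=> x; rewrite !inE => /orP[]/eqP ->; rewrite ?eqxx ?ji.
move=> /h; rewrite !big_cons !big_nil eqxx ji mule1 => <-; congr (P _).
apply/seteqP; split => [x [xA xB] k|x xAB].
  by rewrite /= !inE => /orP[]/eqP ->; rewrite ?eqxx ?ji.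
split; [have := xAB i|have := xAB j]; rewrite /= !inE !eqxx ?ji ?orbT; exact.
Qed.

Lemma mutually_independent4 (I : eqType) (F : I -> set (set T)) (i j k l : I) A B C D :
  mutually_independent P F -> uniq [:: i; j; k; l] ->
  F i A -> F j B -> F k C -> F l D ->
  P (A `&` B `&` (C `&` D)) = (P A * P B * (P C * P D))%E.
Proof.
move=> ind u FA FB FC FD; have := ind _ (fun x => if x == i then A else if x == j then B
   else if x == k then C else D) u.
move: u; rewrite /= !inE !negb_or => /and4P[/and3P[ij ik il] /andP[jk jl] kl _].
have ji : (j == i) = false by rewrite eq_sym (negPf ij).
have ki : (k == i) = false by rewrite eq_sym (negPf ik).
have li : (l == i) = false by rewrite eq_sym (negPf il).
have kj : (k == j) = false by rewrite eq_sym (negPf jk).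
have lj : (l == j) = false by rewrite eq_sym (negPf jl).
have lk : (l == k) = false by rewrite eq_sym (negPf kl).
move=> h.
have : forall x, x \in [:: i; j; k; l] -> F x (if x == i then A else if x == j then B
   else if x == k then C else D).
  by move=> x; rewrite !inE => /or4P[]/eqP ->; rewrite ?eqxx ?ji ?ki ?li ?kj ?lj ?lk.
move=> /h; rewrite !big_cons !big_nil !eqxx ji ki li kj lj lk mule1 -muleA => <-.
congr (P _); apply/seteqP; split => [x [[xA xB] [xC xD]] m|x xF].
  by rewrite /= !inE => /or4P[]/eqP ->; rewrite ?eqxx ?ji ?ki ?li ?kj ?lj ?lk.
split; split; [have := xF i|have := xF j|have := xF k|have := xF l];
  rewrite /= !inE !eqxx ?ji ?ki ?li ?kj ?lj ?lk ?orbT; exact.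
Qed.

(** Dynkin's pi-lambda argument: rectangles are stable under intersection and generate the product
    sigma-algebra, and the sets satisfying the conclusion form a lambda-system. *)
Lemma independent_of_rectangles d1 d2 (U1 : measurableType d1) (U2 : measurableType d2)
    (X : T -> U1) (Y : T -> U2) (F : set T) :
  measurable_fun setT X -> measurable_fun setT Y -> measurable F ->
  (forall A B, measurable A -> measurable B ->
    P (X @^-1` A `&` Y @^-1` B `&` F) = (P (X @^-1` A `&` Y @^-1` B) * P F)%E) ->
  forall D, measurable D ->
    P ((fun x => (X x, Y x)) @^-1` D `&` F) = (P ((fun x => (X x, Y x)) @^-1` D) * P F)%E.
Proof.
move=> mX mY mF rect D mD; set XY := fun x => (X x, Y x).
have mXY E : measurable E -> measurable (XY @^-1` E).
  by move=> mE; rewrite -[X in measurable X]setTI; exact: measurable_fun_pair.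
have := mD; rewrite measurable_prod_measurableType; move: D {mD}.
apply: dynkin_induction.
- exact: measurable_prod_measurableType.
- move=> _ _ [A1 mA1 [B1 mB1 <-]] [A2 mA2 [B2 mB2 <-]].
  exists (A1 `&` A2); first exact: measurableI.
  by exists (B1 `&` B2); [exact: measurableI|rewrite setXI].
- by rewrite preimage_setT setTI probability_setT mul1e.
- by move=> _ [A mA [B mB <-]]; exact: rect.
- move=> S mS IH; set A := XY @^-1` S in IH *.
  have mA : measurable A by exact: mXY.
  have -> : XY @^-1` (~` S) = ~` A by [].
  rewrite probability_setC// setIC -setDE measureD//; last first.
    by rewrite ltey_eq fin_num_measure.
  rewrite [X in (_ - X)%E](_ : _ = (P A * P F)%E); last by rewrite setIC; exact: IH.
  rewrite -[P F]fineK ?fin_num_measure//.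
  rewrite -[P A]fineK ?fin_num_measure//.
  rewrite -EFinM [X in (X - _)%E](_ : _ = (fine (P F))%:E); last by rewrite fineK ?fin_num_measure.
  by rewrite -!EFinB -EFinM; congr (_%:E)%E; ring.
- move=> S mS tS IH; rewrite preimage_bigcup setI_bigcupl.
  rewrite !measure_bigcup//; last 4 first.
  + by move=> k _; exact: mXY.
  + apply/trivIsetP => a b _ _ ab; rewrite -preimage_setI.
    by have /trivIsetP -> := tS; rewrite ?preimage_set0.
  + by move=> k _; apply: measurableI => //; exact: mXY.
  + apply/trivIsetP => a b _ _ ab; rewrite setIACA -preimage_setI.
    by have /trivIsetP -> := tS; rewrite ?preimage_set0 ?set0I.
  rewrite muleC -[X in (X * _)%E]fineK ?fin_num_measure// -nneseriesZl//.
  apply: eq_eseriesr => k _; apply: etrans (IH k) _.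
  by rewrite fineK ?fin_num_measure// muleC.
Qed.

End independence_lemmas.

Lemma finmeas_bool_pair : finmeas (id : (bool * bool)%type -> (bool * bool)%type).
Proof.
move=> [a b]; rewrite preimage_id.
rewrite [X in measurable X](_ : _ = [set a] `*` [set b]); first exact: measurableX.
by apply/seteqP; split => -[u v] /=; [case=> -> ->|case=> -> ->].
Qed.

Lemma not_finmeas d (T : measurableType d) (b : T -> bool) :
  finmeas b -> measurable [set x | ~~ b x].
Proof.
move=> /(_ false); rewrite (_ : _ @^-1` _ = [set x | ~~ b x])//.
by apply/seteqP; split => x /=; [move=> ->|move/negbTE].
Qed.

(** * Typical channel realizations *)

Section channel_events.
Variables (R : realType) (muH muG : 'I_2 -> probability 'rV[R[i]]_2 R).
Variables (lam : bool -> bool -> R) (PT : R) (c : channel R).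
Hypothesis hc : jammed_miso_bc muH muG lam PT c.
Notation P := (ch_prob c).

Definition channel_pair (t : nat) (w : ch_space c) := (chH c ord0 t w, chH c ord_max t w).

Lemma measurable_channel_pair t : measurable_fun setT (channel_pair t).
Proof. exact: measurable_fun_pair. Qed.

Let sigma_ofP d (U : measurableType d) (X : {mfun ch_space c >-> U}) A :
  measurable A -> sigma_of X (X @^-1` A).
Proof. by move=> mA; exists A => //; rewrite setTI. Qed.

Let meas_pre d (U : measurableType d) (X : ch_space c -> U) A :
  measurable_fun setT X -> measurable A -> measurable (X @^-1` A).
Proof. by move=> mX mA; rewrite -[X in measurable X]setTI; exact: mX. Qed.

Lemma channel_pair_rect t A B : measurable A -> measurable B ->
  P (chH c ord0 t @^-1` A `&` chH c ord_max t @^-1` B) =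
  (P (chH c ord0 t @^-1` A) * P (chH c ord_max t @^-1` B))%E.
Proof.
move=> mA mB.
apply: (mutually_independent2 (i := (ord0, t)) (j := (ord_max, t)) (H_indep hc)) => //;
  exact: sigma_ofP.
Qed.

Lemma channel_pair_law t D : measurable D ->
  P (channel_pair t @^-1` D) = (muH ord0 \x muH ord_max)%E D.
Proof.
move=> mD.
pose f : {mfun ch_space c >-> ('rV[R[i]]_2 * 'rV[R[i]]_2)%type} :=
  mfun_Sub (mem_set (measurable_channel_pair t)).
rewrite (product_measure_unique (m' := pushforward P f))//.
move=> A B mA mB.
transitivity (P (chH c ord0 t @^-1` A `&` chH c ord_max t @^-1` B)); first by [].
by rewrite channel_pair_rect// !(H_law hc).
Qed.

(** The passage from rectangles to general sets is made once for each time, leaving four mutually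
    independent channel vectors. *)
Lemma channel_pair_independent s t D E : s != t -> measurable D -> measurable E ->
  P (channel_pair s @^-1` D `&` channel_pair t @^-1` E) =
  (P (channel_pair s @^-1` D) * P (channel_pair t @^-1` E))%E.
Proof.
move=> st mD mE.
apply: (independent_of_rectangles (X := chH c ord0 s) (Y := chH c ord_max s)) => //.
  by apply: meas_pre => //; exact: measurable_channel_pair.
move=> A B mA mB; rewrite setIC [RHS]muleC.
apply: (independent_of_rectangles (X := chH c ord0 t) (Y := chH c ord_max t)) => //.
  by apply: measurableI; exact: meas_pre.
move=> A' B' mA' mB'.
rewrite (mutually_independent4 (i := (ord0, t)) (j := (ord_max, t))
  (k := (ord0, s)) (l := (ord_max, s)) (H_indep hc)).
- by rewrite !channel_pair_rect.
- by rewrite /= !inE !xpair_eqE/= [t == s]eq_sym (negPf st).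
all: exact: sigma_ofP.
Qed.

Lemma noise_law k t m : P [set w | ~~ in_box m%:R (chN c k t w)] =
  cnormal01 [set z : R[i] | ~~ in_box m%:R z].
Proof.
rewrite -(N_law hc k t)//; apply: not_finmeas; apply: finmeas_in_box.
exact: measurable_id.
Qed.

Definition unjammed_prob (k : 'I_2) := if k == ord0 then unjammed1 lam else unjammed2 lam.

Lemma finmeas_jammed k t : finmeas (fun w => jammed (chS c t w) k).
Proof.
have h : finmeas (chS c t : ch_space c -> _).
  exact: (finmeas_measurable_comp (h := chS c t) _ finmeas_bool_pair).
exact: (finmeas_comp (fun s => jammed s k) h).
Qed.

Let S_singleton t (s : bool * bool) : measurable (chS c t @^-1` [set s]).
Proof. by apply: meas_pre => //; exact: finmeas_bool_pair. Qed.

Lemma unjammed_law k t :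
  P [set w | ~~ jammed (chS c t w) k] = (unjammed_prob k)%:E.
Proof.
have add (s s' : bool * bool) : s != s' ->
    [set w | ~~ jammed (chS c t w) k] = chS c t @^-1` [set s] `|` chS c t @^-1` [set s'] ->
    P [set w | ~~ jammed (chS c t w) k] = (lam s.1 s.2 + lam s'.1 s'.2)%:E.
  move=> ss' ->; rewrite measureU//.
    by rewrite EFinD; congr (_ + _)%E; rewrite -(S_law hc t); case: (s) (s') => ? ? [].
  by apply/seteqP; split => w //= [-> e]; move: ss'; rewrite e eqxx.
rewrite /jammed in add *; rewrite /unjammed_prob /unjammed1 /unjammed2.
case: (k == ord0) in add *.
  apply: (add (false, false) (false, true)) => //.
  by apply/seteqP; split => w; rewrite /preimage /=; case: (chS c t w) => -[] [] //=; auto; case.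
apply: (add (false, false) (true, false)) => //.
by apply/seteqP; split => w; rewrite /preimage /=; case: (chS c t w) => -[] [] //=; auto; case.
Qed.

Lemma unjammed_independent k s t : s != t ->
  P ([set w | ~~ jammed (chS c s w) k] `&` [set w | ~~ jammed (chS c t w) k]) =
  (P [set w | ~~ jammed (chS c s w) k] * P [set w | ~~ jammed (chS c t w) k])%E.
Proof.
move=> st; apply: (mutually_independent2 (i := s) (j := t) (S_indep hc)) => //;
  exists [set x | ~~ jammed x k]; rewrite ?setTI//;
  exact: (finmeas_preimage [set x | ~~ jammed x k] finmeas_bool_pair).
Qed.

Lemma noise_independent k s t m : s != t ->
  P ([set w | ~~ in_box m%:R (chN c k s w)] `&` [set w | ~~ in_box m%:R (chN c k t w)]) =
  (P [set w | ~~ in_box m%:R (chN c k s w)] * P [set w | ~~ in_box m%:R (chN c k t w)])%E.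
Proof.
move=> st; apply: (mutually_independent2 (i := (k, s)) (j := (k, t)) (N_indep hc)).
- by rewrite xpair_eqE eqxx.
all: exists [set x | ~~ in_box m%:R x]; rewrite ?setTI//;
  apply: not_finmeas; apply: finmeas_in_box; exact: measurable_id.
Qed.

End channel_events.

Section finite_unions.
Context d (T : measurableType d) (R : realType) (P : probability T R).

Lemma probability_bigcup_le (I : finType) (B : I -> set T) (a : R) :
  (forall i, measurable (B i)) -> (forall i, P (B i) <= a%:E)%E ->
  (P (\bigcup_i B i) <= (#|I|%:R * a)%:E)%E.
Proof.
move=> mB Ba.
have -> : \bigcup_i B i = \big[setU/set0]_(i <- enum I) B i.
  rewrite -bigcup_seq (_ : [set` enum I] = setT)//.
  by apply/seteqP; split => i //= _; rewrite mem_enum.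
have : (P (\big[setU/set0]_(i <- enum I) B i) <= (\sum_(i <- enum I) a)%:E)%E.
  elim: (enum I) => [|i r ih]; first by rewrite !big_nil measure0.
  rewrite !big_cons EFinD.
  have mr : measurable (\big[setU/set0]_(j <- r) B j).
    by apply: bigsetU_measurable => *; exact: mB.
  apply: (@le_trans _ _ (P (B i) + P (\big[setU/set0]_(j <- r) B j))%E).
    exact: measureU2 (mB i) mr.
  exact: leeD.
by move=> /le_trans; apply; rewrite lee_fin big_enum sumr_const -[leLHS]mulr_natl.
Qed.

(* Exchanging a finite average over codes with the expectation over the channel. *)
Lemma sum_probability_le (I : finType) (E : I -> set T) (a : R) :
  (forall i, measurable (E i)) ->
  (forall x, #|[set i | x \in E i]%SET|%:R <= a) ->
  (\sum_i P (E i) <= a%:E)%E.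
Proof.
move=> mE Ea.
have -> : (\sum_i P (E i) = \int[P]_x (\sum_i (\1_(E i) x)%:E))%E.
  rewrite ge0_integral_sum//.
  - by apply: eq_bigr => i _; rewrite integral_indic// setIT.
  - by move=> i; apply/measurable_EFinP; exact: measurable_indic.
apply: (@le_trans _ _ (\int[P]_x (cst a%:E x))%E); last first.
  rewrite integral_cst// [X in (_ * X)%E](_ : _ = 1%E) ?mule1//; exact: probability_setT.
apply: ge0_le_integral => //.
- by move=> x _; apply: sume_ge0 => i _; rewrite lee_fin.
- apply: emeasurable_sum => i; apply/measurable_EFinP; exact: measurable_indic.
- move=> x _; rewrite sumEFin lee_fin; apply: le_trans (Ea x).
  rewrite -sum1_card natr_sum [leRHS]big_mkcond/=.
  by apply: ler_sum => i _; rewrite inE indicE; case: (x \in E i).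
Qed.

End finite_unions.

Section typical_channels.
Variables (R : realType) (muH muG : 'I_2 -> probability 'rV[R[i]]_2 R).
Variables (lam : bool -> bool -> R) (PT : R) (c : channel R).
Hypothesis hc : jammed_miso_bc muH muG lam PT c.
Notation P := (ch_prob c).
Variables (n m : nat) (I : finType) (A : I -> {set 'I_n}) (eta : R).
Hypotheses (eta0 : 0 < eta) (n0 : (0 < n)%N).

Definition bad_pair_prob : R := fine ((muH ord0 \x muH ord_max)%E (@bad_pairs R m)).
Definition bad_noise_prob : R := fine (cnormal01 [set z : R[i] | ~~ in_box m%:R z]).

Let pair_ok (t : 'I_n) w := pair_good m (chH c ord0 t w) (chH c ord_max t w).
Let noise_ok k (t : 'I_n) w := in_box m%:R (chN c k t w).
Let clear k (t : 'I_n) w := ~~ jammed (chS c t w) k.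

Definition typical (w : ch_space c) : bool :=
  [&& #|[set t | ~~ pair_ok t w]%SET|%:R < (bad_pair_prob + eta) * n%:R,
      [forall k, #|[set t | ~~ noise_ok k t w]%SET|%:R < (bad_noise_prob + eta) * n%:R] &
      [forall k, forall i, `| #|[set t in A i | clear k t w]%SET|%:R
          - unjammed_prob lam k * #|A i|%:R | < eta * n%:R]].

Let mpair t : finmeas (pair_ok t).
Proof. exact: finmeas_pair_good. Qed.

Let mnoise k t : finmeas (noise_ok k t).
Proof. exact: finmeas_in_box. Qed.

Let mclear k t : finmeas (clear k t).
Proof. exact: (finmeas_comp negb (finmeas_jammed _ _ _)). Qed.

Lemma finmeas_typical : finmeas typical.
Proof.
apply: (finmeas_app2 (fun a b : bool => a && b)).
  exact: (finmeas_app (fun f : 'I_n -> bool =>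
    #|[set t | ~~ f t]%SET|%:R < (bad_pair_prob + eta) * n%:R) mpair).
apply: (finmeas_app2 (fun a b : bool => a && b)).
  apply: (finmeas_app (fun f : 'I_2 * 'I_n -> bool => [forall k,
    #|[set t | ~~ f (k, t)]%SET|%:R < (bad_noise_prob + eta) * n%:R])
    (g := fun kt => noise_ok kt.1 kt.2)).
  by move=> kt; exact: mnoise.
apply: (finmeas_app (fun f : 'I_2 * 'I_n -> bool => [forall k, forall i,
   `| #|[set t in A i | f (k, t)]%SET|%:R
          - unjammed_prob lam k * #|A i|%:R | < eta * n%:R])
    (g := fun kt => clear kt.1 kt.2)).
by move=> kt; exact: mclear.
Qed.

Let devset (D : {set 'I_n}) (E : 'I_n -> ch_space c -> bool) (p : R) :=
  [set w | eta * n%:R <= `| #|[set t in D | E t w]%SET|%:R - p * #|D|%:R |].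

Let deviation (D : {set 'I_n}) (E : 'I_n -> ch_space c -> bool) (p : R) :
  (forall t, measurable [set w | E t w]) -> (forall t, P [set w | E t w] = p%:E) ->
  (forall s t : 'I_n, s != t :> nat ->
    P ([set w | E s w] `&` [set w | E t w]) =
    (P [set w | E s w] * P [set w | E t w])%E) ->
  (P (devset D E p) <= ((eta ^+ 2 * n%:R)^-1)%:E)%E.
Proof.
move=> mE pE iE.
have en : 0 < eta * n%:R by rewrite mulr_gt0// ltr0n.
have -> : devset D E p = [set w | eta * n%:R <=
    `| #|[set t in D | w \in [set w | E t w]%classic]%SET|%:R - p * #|D|%:R |].
  apply/seteqP; split => w; rewrite /devset/=;
  suff -> : [set t in D | w \in [set w | E t w]%classic]%SET = [set t in D | E t w]%SET by [];
  by apply/setP => t; rewrite !inE; congr andb; apply/idP/idP; rewrite inE.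
have := pairwise_independent_deviation D en mE pE iE.
rewrite sumr_const -(mulr_natr p) => /le_trans; apply.
have nn : n%:R != 0 :> R by rewrite pnatr_eq0 -lt0n.
rewrite lee_fin (_ : (eta ^+ 2 * n%:R)^-1 = n%:R / (eta * n%:R) ^+ 2); last first.
  by field; rewrite nn gt_eqF.
by rewrite ler_wpM2r ?invr_ge0 ?sqr_ge0// ler_nat -[leqRHS](card_ord n) max_card.
Qed.

(** The index encodes the deviations to be excluded: channel pairs, noise at receiver [k], and
    jamming at receiver [k] within [A i], which makes [3 + 2 * #|I|] events. *)
Let dev (i : option ('I_2 * option I)) : set (ch_space c) :=
  match i with
  | None => devset [set: 'I_n] (fun t w => ~~ pair_ok t w) bad_pair_prob
  | Some (k, None) => devset [set: 'I_n] (fun t w => ~~ noise_ok k t w) bad_noise_prob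
  | Some (k, Some i) => devset (A i) (clear k) (unjammed_prob lam k)
  end.

Let sub_dev : [set w | ~~ typical w] `<=` \bigcup_i dev i.
Proof.
move=> w; apply: contraPP => /= out; apply/negP; rewrite negbK.
have notin i : ~ dev i w by move=> h; apply: out; exists i.
have upper (x p : R) : ~ (eta * n%:R <= `|x - p * n%:R|) -> x < (p + eta) * n%:R.
  by move/negP; rewrite -ltNge ltr_norml mulrDl => /andP[_]; rewrite ltrBlDl.
have cardT : #|[set: 'I_n]%SET| = n by rewrite cardsT card_ord.
have setTE (E : 'I_n -> bool) : [set t in [set: 'I_n] | E t]%SET = [set t | E t]%SET.
  by apply/setP => t; rewrite !inE.
apply/and3P; split.
- by have := notin None; rewrite /dev /devset/= cardT setTE => /upper.
- apply/forallP => k; have := notin (Some (k, None)).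
  by rewrite /dev /devset/= cardT setTE => /upper.
apply/forallP => k; apply/forallP => i; have := notin (Some (k, Some i)).
by rewrite /dev /devset/= => /negP; rewrite -ltNge.
Qed.

Lemma measurable_not_typical : measurable [set w | ~~ typical w].
Proof. exact: not_finmeas finmeas_typical. Qed.

Lemma probability_not_typical :
  (P [set w | ~~ typical w] <=
    ((3 + 2 * #|I|)%:R * (eta ^+ 2 * n%:R)^-1)%:E)%E.
Proof.
have mdev i : measurable (dev i).
  have mset (D : {set 'I_n}) (E : 'I_n -> ch_space c -> bool) (p : R) :
      (forall t, finmeas (E t)) -> measurable (devset D E p).
    move=> mE; exact: (finmeas_app (fun f : 'I_n -> bool =>
      eta * n%:R <= `| #|[set t in D | f t]%SET|%:R - p * #|D|%:R |) mE true).
  case: i => [[k [i|]]|]; apply: mset => t; first exact: mclear.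
    exact: (finmeas_comp negb (mnoise k t)).
  exact: (finmeas_comp negb (mpair t)).
apply: (@le_trans _ _ (P (\bigcup_i dev i))).
  apply: le_measure; rewrite ?inE; [exact: measurable_not_typical| |exact: sub_dev].
  by apply: fin_bigcup_measurable.
rewrite [X in X%:R](_ : _ = #|{: option ('I_2 * option I)}|); last first.
  by rewrite card_option card_prod card_option card_ord; lia.
apply: probability_bigcup_le => // -[[k [i|]]|] /=.
- apply: deviation => [t|t|s t st].
  + exact: (mclear k t true).
  + exact: unjammed_law hc k t.
  + exact: unjammed_independent hc k s t st.
- apply: deviation => [t|t|s t st].
  + exact: not_finmeas (mnoise k t).
  + rewrite (noise_law hc) fineK// -(noise_law hc k t) fin_num_measure//.
    exact: not_finmeas (mnoise k t).
  + exact: (noise_independent hc k m st).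
- apply: deviation => [t|t|s t st].
  + exact: not_finmeas (mpair t).
  + rewrite fineK; last first.
      rewrite -(channel_pair_law hc t (measurable_bad_pairs m)) fin_num_measure//.
      exact: not_finmeas (mpair t).
    exact: (channel_pair_law hc t (measurable_bad_pairs m)).
  + exact: (channel_pair_independent hc st (measurable_bad_pairs m) (measurable_bad_pairs m)).
Qed.

End typical_channels.

Lemma finmeas_app3 d (T : measurableType d) (I1 I2 I3 F1 F2 F3 G : finType)
    (phi : (I1 -> F1) -> (I2 -> F2) -> (I3 -> F3) -> G)
    (g1 : I1 -> T -> F1) (g2 : I2 -> T -> F2) (g3 : I3 -> T -> F3) :
  (forall i, finmeas (g1 i)) -> (forall i, finmeas (g2 i)) ->
  (forall i, finmeas (g3 i)) ->
  finmeas (fun x => phi (g1^~ x) (g2^~ x) (g3^~ x)).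
Proof.
move=> m1 m2 m3.
have h := finmeas_app2
  (fun (a : {ffun I1 -> F1} * {ffun I2 -> F2}) (b : {ffun I3 -> F3}) => phi a.1 a.2 b)
  (finmeas_pair (finmeas_ffun m1) (finmeas_ffun m2)) (finmeas_ffun m3).
rewrite (_ : (fun _ => _) = (fun x => phi [ffun i => g1 i x] [ffun i => g2 i x]
  [ffun i => g3 i x]))//.
by apply/funext => x; congr phi; apply/funext => i; rewrite ffunE.
Qed.

Lemma side_infoC (T X B : finType) (A A' : {set T}) (b b' : T -> X -> B) (b0 : B)
    (c c' : {ffun T -> X}) : [disjoint A & A']%B ->
  side_info A A' b b' b0 c c' = side_info A' A b' b b0 c' c.
Proof.
move=> AA'; apply/ffunP => t; rewrite !ffunE.
by case: ifP => // tA; rewrite (disjointFr AA' tA).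
Qed.

Lemma sentC (T X : finType) (A A' : {set T}) (c c' h : {ffun T -> X}) t :
  [disjoint A & A']%B -> sent A A' c c' h t = sent A' A c' c h t.
Proof.
move=> AA'; rewrite /sent; case: ifP => // tA; by rewrite (disjointFr AA' tA).
Qed.

Lemma plausible_ext (T X B W : finType) (own oth : {set T}) (bo bt : T -> X -> B)
    (b0 : B) (J : {set T}) (e : nat) (S S' : T -> {set X})
    (cb : {ffun W -> {ffun T -> X}}) (f : {ffun {ffun T -> B} -> {ffun T -> X}}) w :
  (forall t, t \notin J -> S t = S' t) ->
  plausible own oth bo bt b0 J e S cb f w = plausible own oth bo bt b0 J e S' cb f w.
Proof.
move=> SS'; apply: eq_existsb => u; congr (_ && (_ <= e)%N).
apply: eq_card => t; rewrite !inE; case: (boolP (t \in J)) => //= tJ.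
by rewrite /slot_ok SS'.
Qed.

(** * The coding scheme *)

Section coding_scheme.
Variables (R : realType) (n m q e M1 M2 : nat) (th : bool).
Variables (A1 A2 : {set 'I_n}).
Notation X := (point q).
Notation B := ('I_(cells th m q).+1 * 'I_(cells th m q).+1)%type.
Notation hash := {ffun {ffun 'I_n -> B} -> {ffun 'I_n -> X}}.
Notation book M := {ffun 'I_M -> {ffun 'I_n -> X}}.

Definition gvec (x : X) : 'cV[R[i]]_2 :=
  \col_j (if j == ord0 then gint R x.1 else gint R x.2).

Lemma mul_gvec (h : 'rV[R[i]]_2) (x : X) : (h *m gvec x) ord0 ord0 = lin_form h x.
Proof.
rewrite mxE big_ord_recl big_ord1 !mxE/= /lin_form.
by congr (_ + h _ _ * _); apply: val_inj.
Qed.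

Definition bins (h : 'I_n -> 'M[R[i]]_2) (k : 'I_2) (t : 'I_n) (x : X) : B :=
  quantize th m (row k (h t)) x.

Definition scheme_input (b : 'I_2 -> 'I_n -> X -> B) (c1 c2 : {ffun 'I_n -> X})
    (f : hash) (t : 'I_n) : X :=
  sent A1 A2 c1 c2 (f (side_info A1 A2 (b ord_max) (b ord0) (ord0, ord0) c1 c2)) t.

(** Channels at times from [t] on are replaced by the default 0. This is harmless because the cells
    enter only the inputs of common slots, which come after all the slots whose cells they use. *)
Definition scheme_enc (cb1 : book M1) (cb2 : book M2) (f : hash) (t : nat)
    (w1 : 'I_M1) (w2 : 'I_M2) (hs : t.-tuple 'M[R[i]]_2) : 'cV[R[i]]_2 :=
  if insub t is Some i then
    gvec (scheme_input (bins (fun s : 'I_n => nth 0 hs s)) (cb1 w1) (cb2 w2) f i)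
  else 0.

(** Any plausible message may be picked: when the true one is plausible, an error requires a second
    plausible message. The other receiver is [rev_ord k]. *)
Definition scheme_dec (k : 'I_2) (own oth : {set 'I_n}) (M : nat) (w0 : 'I_M)
    (cb : book M) (f : hash) (o : observation R n) : 'I_M :=
  let b := bins (fun s => tnth o.1.2 s) in
  odflt w0 [pick w | plausible own oth (b (rev_ord k)) (b k) (ord0, ord0)
    [set t | jammed (tnth o.2 t) k]%SET e
    (fun t => explaining q m (row k (tnth o.1.2 t)) (tnth o.1.1 t)) cb f w].

Lemma measurable_row d (T : measurableType d) (k : 'I_2) (h : T -> 'M[R[i]]_2) :
  measurable_fun setT h -> measurable_fun setT (fun w => row k (h w)).
Proof.
move=> mh; apply: measurable_matrix => i j.
under eq_fun do rewrite mxE.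
exact: (measurableT_comp (measurable_entry _ _) mh).
Qed.

Lemma finmeas_quantize d (T : measurableType d) (h : T -> 'rV[R[i]]_2) (x : X) :
  measurable_fun setT h -> finmeas (fun w => quantize th m (h w) x : B).
Proof. by move=> mh; apply: finmeas_cell; exact: measurable_lin_form. Qed.

Lemma measurable_nth t (s : nat) :
  measurable_fun setT (fun hs : t.-tuple 'M[R[i]]_2 => nth 0 hs s).
Proof.
have [st|st] := ltnP s t.
  rewrite (_ : (fun _ => _) = (fun hs : t.-tuple 'M[R[i]]_2 => tnth hs (Ordinal st))).
    exact: measurable_tnth.
  by apply/funext => hs; rewrite (tnth_nth 0).
rewrite (_ : (fun _ => _) = cst 0); first exact: measurable_cst.
by apply/funext => hs; rewrite nth_default// size_tuple.
Qed.

Lemma measurable_scheme_enc cb1 cb2 f t w1 w2 :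
  measurable_fun setT (@scheme_enc cb1 cb2 f t w1 w2).
Proof.
rewrite /scheme_enc; case: (insub t : option 'I_n) => [i|]; last exact: measurable_cst.
apply: (@measurable_finmeas _ _ _ _ _ gvec (fun hs : t.-tuple 'M[R[i]]_2 =>
  scheme_input (bins (fun s : 'I_n => nth 0 hs s)) (cb1 w1) (cb2 w2) f i)).
apply: (finmeas_app (fun b : ('I_2 * 'I_n * X) -> B =>
  scheme_input (fun k t x => b (k, t, x)) (cb1 w1) (cb2 w2) f i)
  (g := fun ktx (hs : t.-tuple 'M[R[i]]_2) =>
    bins (fun s : 'I_n => nth 0 hs s) ktx.1.1 ktx.1.2 ktx.2)).
move=> [[k s] x]; apply: finmeas_quantize.
by apply: measurable_row; exact: measurable_nth.
Qed.

Lemma finmeas_explaining d (T : measurableType d) (h : T -> 'rV[R[i]]_2)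
    (y : T -> R[i]) (x : X) :
  measurable_fun setT h -> measurable_fun setT y ->
  finmeas (fun w => x \in explaining q m (h w) (y w)).
Proof.
move=> mh my; under eq_fun do rewrite inE.
apply: finmeas_in_box; apply: measurable_complexD => //.
by apply: measurable_complexN; exact: measurable_lin_form.
Qed.

(** The decoder depends on the observation only through finitely many cells, jamming flags and
    membership tests. *)
Lemma finmeas_scheme_dec k own oth M (w0 : 'I_M) cb f :
  finmeas (scheme_dec k own oth w0 cb f).
Proof.
have mH t : measurable_fun setT (fun o : observation R n => tnth o.1.2 t).
  apply: (measurableT_comp (measurable_tnth t)).
  by apply: (measurableT_comp measurable_snd); exact: measurable_fst.
have mY t : measurable_fun setT (fun o : observation R n => tnth o.1.1 t).
  apply: (measurableT_comp (measurable_tnth t)).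
  by apply: (measurableT_comp measurable_fst); exact: measurable_fst.
have mS t : measurable_fun setT (fun o : observation R n => tnth o.2 t).
  by apply: (measurableT_comp (measurable_tnth t)); exact: measurable_snd.
have := @finmeas_app3 _ (observation R n) ('I_2 * 'I_n * X)%type 'I_n ('I_n * X)%type
  B bool bool _ (fun b j s => odflt w0
    [pick w | plausible own oth (fun t x => b (rev_ord k, t, x)) (fun t x => b (k, t, x))
      (ord0, ord0) [set t | j t]%SET e (fun t => [set x | s (t, x)]%SET) cb f w])
  (fun ktx o => bins (fun s => tnth o.1.2 s) ktx.1.1 ktx.1.2 ktx.2)
  (fun t o => jammed (tnth o.2 t) k)
  (fun tx o => tx.2 \in explaining q m (row k (tnth o.1.2 tx.1)) (tnth o.1.1 tx.1)).
rewrite (_ : (fun _ => _) = scheme_dec k own oth w0 cb f); last first.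
  apply/funext => o; rewrite /scheme_dec; congr odflt; apply: eq_pick => w.
  by apply: plausible_ext => t _; apply/setP => x; rewrite inE.
apply.
- move=> [[k' t] x]; apply: finmeas_quantize; apply: measurable_row; exact: mH.
- move=> t; exact: (finmeas_comp (fun s => jammed s k)
    (finmeas_measurable_comp (mS t) finmeas_bool_pair)).
- by move=> [t x]; apply: finmeas_explaining; [apply: measurable_row; exact: mH|exact: mY].
Qed.

Definition scheme_code (w01 : 'I_M1) (w02 : 'I_M2) (cb1 : book M1) (cb2 : book M2)
    (f : hash) : dn_code R n M1 M2 :=
  {| enc := @scheme_enc cb1 cb2 f;
     enc_measurable := @measurable_scheme_enc cb1 cb2 f;
     dec1 := scheme_dec ord0 A1 A2 w01 cb1 f;
     dec1_measurable := finmeas_scheme_dec ord0 A1 A2 w01 cb1 f;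
     dec2 := scheme_dec ord_max A2 A1 w02 cb2 f;
     dec2_measurable := finmeas_scheme_dec ord_max A2 A1 w02 cb2 f |}.

End coding_scheme.

Lemma upr_bij (R : realFieldType) (T U : finType) (phi : T -> U) (A : {pred U}) :
  bijective phi -> upr R [pred t | A (phi t)] = upr R A.
Proof.
move=> bphi; rewrite /upr (bij_eq_card bphi); congr (_%:R / _).
rewrite -(card_imset _ (bij_inj bphi)); apply: eq_card => u.
have [psi phiK psiK] := bphi; apply/imsetP/idP => [[t At ->]//|Au].
by exists (psi u); rewrite ?inE ?psiK.
Qed.

(** * Decoding at one receiver for a fixed channel realization *)

Section receivers.
Variables (R : realType) (n m q e M1 M2 : nat) (th : bool).
Variables (A1 A2 : {set 'I_n}).
Hypothesis disj : [disjoint A1 & A2]%B.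
Hypothesis causal : forall s t : 'I_n, (s \in A1) || (s \in A2) ->
  t \notin A1 -> t \notin A2 -> (s < t)%N.
Hypotheses (m0 : (0 < m)%N) (q0 : (0 < q)%N).
Variables (w01 : 'I_M1) (w02 : 'I_M2).
Variable c : channel R.
Notation X := (point q).
Notation B := ('I_(cells th m q).+1 * 'I_(cells th m q).+1)%type.
Notation hash := {ffun {ffun 'I_n -> B} -> {ffun 'I_n -> X}}.
Notation book M := {ffun 'I_M -> {ffun 'I_n -> X}}.

Definition cell_of (w : ch_space c) (k : 'I_2) (t : 'I_n) (x : X) : B :=
  quantize th m (chH c k t w) x.

(** The jamming term is omitted: this is the set the decoder uses in unjammed slots, the only ones
    it tests. *)
Definition explained (w : ch_space c) (k : 'I_2) (t : 'I_n) (x : X) : {set X} :=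
  explaining q m (chH c k t w) (lin_form (chH c k t w) x + chN c k t w).

Definition jammed_slots (w : ch_space c) (k : 'I_2) : {set 'I_n} :=
  [set t : 'I_n | jammed (chS c t w) k]%SET.

Definition bad_slots (w : ch_space c) (k : 'I_2) : {set 'I_n} :=
  [set t : 'I_n | ~~ pair_good m (chH c ord0 t w) (chH c ord_max t w)]%SET :|:
  [set t : 'I_n | ~~ in_box m%:R (chN c k t w)]%SET.

Lemma row_csi k t (w : ch_space c) : row k (csi t w) = chH c k t w.
Proof. by rewrite /csi rowK. Qed.

Lemma bins_csi w k t x : bins m th (fun s : 'I_n => csi s w) k t x = cell_of w k t x.
Proof. by rewrite /bins row_csi. Qed.

(** By [causal], every cell hashed at a common slot is computed from a channel already present in
    the encoder's tuple, so the default value never appears. *)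
Lemma input_scheme_code (cb1 : book M1) (cb2 : book M2) (f : hash) w1 w2 (t : 'I_n) w :
  input (scheme_code R e A1 A2 w01 w02 cb1 cb2 f) w1 w2 t w =
  gvec R (scheme_input A1 A2 (cell_of w) (cb1 w1) (cb2 w2) f t).
Proof.
rewrite /input/= /scheme_enc valK; congr gvec; rewrite /scheme_input /sent.
case: ifPn => // t1; case: ifPn => // t2; congr (f _ t).
apply/ffunP => s; rewrite !ffunE.
have hs : (s \in A1) || (s \in A2) -> forall k x, bins m th
    (fun s0 : 'I_n => nth 0 (csi_block t w) s0) k s x = cell_of w k s x.
  move=> sA k x; have st := causal sA t1 t2.
  rewrite -bins_csi /bins; congr (quantize _ _ (row _ _) _).
  by rewrite -[val s]/(val (Ordinal st)) -tnth_nth tnth_mktuple.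
case: ifP => s1; first by rewrite hs ?s1.
by case: ifP => s2 //; rewrite hs ?s2 ?orbT.
Qed.

Lemma output_gvec k t (x : X) w : ~~ jammed (chS c t w) k ->
  output k t (gvec R x) w = lin_form (chH c k t w) x + chN c k t w.
Proof. by rewrite /output => /negPf ->; rewrite mul_gvec mul0r addr0. Qed.

Section one_receiver.
Variables (k : 'I_2) (own oth : {set 'I_n}) (M : nat) (u0 : 'I_M).
Notation kk := (rev_ord k).
Notation info := (fun w (c1 c2 : {ffun 'I_n -> X}) =>
  side_info own oth (cell_of w kk) (cell_of w k) ((ord0, ord0) : B) c1 c2).

Definition confused (w : ch_space c) (x2 : {ffun 'I_n -> X}) (u : 'I_M)
    (p : book M * hash) : bool :=
  [exists u' in predC1 u, plausible own oth (cell_of w kk) (cell_of w k) (ord0, ord0)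
    (jammed_slots w k) e
    (fun t => explained w k t (sent own oth (p.1 u) x2 (p.2 (info w (p.1 u) x2)) t))
    p.1 p.2 u'].

(** With at most [e] bad slots the true message is plausible, so a wrong output is a second
    plausible message. *)
Lemma scheme_dec_error (cb : book M) (f : hash) (x2 : {ffun 'I_n -> X}) (u : 'I_M)
    (w : ch_space c) (ys : n.-tuple R[i]) :
  (#|bad_slots w k| <= e)%N ->
  (forall t : 'I_n, ~~ jammed (chS c t w) k ->
    tnth ys t = lin_form (chH c k t w) (sent own oth (cb u) x2 (f (info w (cb u) x2)) t)
      + chN c k t w) ->
  scheme_dec e k own oth u0 cb f (ys, csi_block n w, jam_block n w) != u ->
  confused w x2 u (cb, f).
Proof.
move=> Ze hys; rewrite /scheme_dec/=.
set S' := fun t => explained w k t (sent own oth (cb u) x2 (f (info w (cb u) x2)) t).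
have plE v : plausible own oth
      (bins m th (fun s => tnth (csi_block n w) s) kk)
      (bins m th (fun s => tnth (csi_block n w) s) k) (ord0, ord0)
      [set t | jammed (tnth (jam_block n w) t) k]%SET e
      (fun t => explaining q m (row k (tnth (csi_block n w) t)) (tnth ys t)) cb f v =
    plausible own oth (cell_of w kk) (cell_of w k) (ord0, ord0) (jammed_slots w k) e
      S' cb f v.
  have -> : [set t | jammed (tnth (jam_block n w) t) k]%SET = jammed_slots w k.
    by apply/setP => t; rewrite !inE tnth_mktuple.
  have bE k' : bins m th (fun s => tnth (csi_block n w) s) k' = cell_of w k'.
    by apply/funext => t; apply/funext => x; rewrite -bins_csi /bins tnth_mktuple.
  rewrite !bE; apply: plausible_ext => t; rewrite inE => tJ.
  by rewrite tnth_mktuple row_csi hys.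
have true_u : plausible own oth (cell_of w kk) (cell_of w k) (ord0, ord0)
    (jammed_slots w k) e S' cb f u.
  apply: (plausible_true (x := x2) Ze) => t _.
  rewrite /bad_slots finset.in_setU negb_or => /andP[_].
  by rewrite inE negbK /S' /explained /explaining inE [_ + chN _ _ _ _]addrC addrK.
case: pickP => [v|]; last by move=> /(_ u); rewrite plE true_u.
by rewrite plE => pv /= vu; apply/existsP; exists v; apply/andP; split.
Qed.

Hypothesis disj' : [disjoint own & oth]%B.

Definition confusion_bound (w : ch_space c) : R :=
  let lK := ln (overhead m)%:R in let L := ln (q ^ 2)%:R in
  (M.-1)%:R * 2 ^+ n *
    (expR (n%:R * lK - L * (#|own :\: jammed_slots w k|%:R - 2 * e%:R)
        - th%:R * L * (#|own|%:R - e%:R)) +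
     expR (3 * n%:R * lK + th%:R * L * (#|oth :&: jammed_slots w k|%:R + 2 * e%:R)
        - L * (#|~: oth :\: jammed_slots w k|%:R - 2 * e%:R))).

Lemma upr_confused (w : ch_space c) (x2 : {ffun 'I_n -> X}) (u : 'I_M) :
  (#|bad_slots w k| <= e)%N ->
  upr R (confused w x2 u) <= confusion_bound w.
Proof.
move=> Ze.
have good t : t \notin bad_slots w k -> pair_good m (chH c k t w) (chH c kk t w).
  rewrite /bad_slots finset.in_setU negb_or => /andP[]; rewrite inE negbK => g _.
  have [k0|k1] : k = ord0 \/ k = ord_max.
  - by case: k => -[|[|//]] h; [left|right]; apply: val_inj.
  - by rewrite k0 (_ : rev_ord ord0 = ord_max)//; apply: val_inj.
  - rewrite k1 (_ : rev_ord ord_max = ord0); last exact: val_inj.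
    by rewrite pair_goodC.
have := @upr_decoding_error_exp R 'I_n X B 'I_M own oth disj' (cell_of w kk)
  (cell_of w k) (ord0, ord0) (explained w k) (jammed_slots w k) (bad_slots w k) e
  (ln (overhead m)%:R) (ln (q ^ 2)%:R) th%:R (overhead m).
rewrite /confusion_bound !card_ord => h; apply: h => //.
- exact: overhead_ln_ge0.
- exact: grid_ln_ge0.
- by move=> t x /good/and3P[g _ _]; exact: upr_explaining.
- by move=> t x /good g; apply: upr_explaining_quantize.
- by move=> t x /good/and3P[_ g _]; exact: upr_quantize.
- by move=> t x _; exact: card_imset_quantize_overhead.
- rewrite lnK// posrE ltr0n /overhead !addn_gt0 !expn_gt0//.
- exact: card_cells.
Qed.

End one_receiver.

End receivers.

(** * Measurability of what is sent and received *)

Section measurable_reception.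
Variables (R : realType) (c : channel R) (n M1 M2 : nat) (cd : dn_code R n M1 M2).

Lemma measurable_csi_block t : measurable_fun setT (@csi_block R c t).
Proof.
apply/measurable_fun_tnthP => s.
rewrite (_ : _ \o _ = csi s); last by apply/funext => w /=; rewrite tnth_mktuple.
apply: measurable_matrix => i j; under eq_fun do rewrite mxE.
exact: (measurableT_comp (measurable_entry _ _)).
Qed.

Lemma measurable_jam_block t : measurable_fun setT (@jam_block R c t).
Proof.
apply/measurable_fun_tnthP => s.
by rewrite (_ : _ \o _ = chS c s)//; apply/funext => w /=; rewrite tnth_mktuple.
Qed.

Lemma measurable_input w1 w2 t : measurable_fun setT (@input R c n M1 M2 cd w1 w2 t).
Proof.
have mc := @measurable_csi_block t.
have me := enc_measurable cd w1 w2 (t := t).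
exact: measurableT_comp me mc.
Qed.

Lemma measurable_mulmx_entry (a : ch_space c -> 'rV[R[i]]_2) (x : ch_space c -> 'cV[R[i]]_2) :
  measurable_fun setT a -> measurable_fun setT x ->
  measurable_fun setT (fun w => (a w *m x w) ord0 ord0).
Proof.
move=> ma mx; under eq_fun do rewrite mxE big_ord_recl big_ord1.
by apply: measurable_complexD; apply: measurable_complexM;
  exact: (measurableT_comp (measurable_entry _ _)).
Qed.

Lemma measurable_output k t (x : ch_space c -> 'cV[R[i]]_2) : measurable_fun setT x ->
  measurable_fun setT (fun w => output k t (x w) w).
Proof.
move=> mx; apply: measurable_complexD => //; apply: measurable_complexD.
  exact: measurable_mulmx_entry.
apply: measurable_complexM; last exact: measurable_mulmx_entry.
exact: (measurable_finmeas (fun b : bool => b%:R : R[i]) (finmeas_jammed _ k t)).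
Qed.

Lemma measurable_received k w1 w2 : measurable_fun setT (@received R c n M1 M2 cd k w1 w2).
Proof.
apply: measurable_fun_pair; last exact: measurable_jam_block.
apply: measurable_fun_pair; last exact: measurable_csi_block.
apply/measurable_fun_tnthP => t.
rewrite (_ : _ \o _ = fun w => output k t (input cd w1 w2 t w) w); last first.
  by apply/funext => w /=; rewrite tnth_mktuple.
by apply: measurable_output; exact: measurable_input.
Qed.

Lemma measurable_error M k w1 w2 (dec : observation R n -> 'I_M) (u : 'I_M) :
  (forall v, measurable (dec @^-1` [set v])) ->
  measurable [set w : ch_space c | dec (received cd k w1 w2 w) <> u].
Proof.
move=> mdec; rewrite [X in measurable X](_ : _ =
  ~` ((@received R c n M1 M2 cd k w1 w2) @^-1` (dec @^-1` [set u])))//.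
apply: measurableC; rewrite -[X in measurable X]setTI.
exact: measurable_received (mdec u).
Qed.

End measurable_reception.

(** * Averaging over random codes *)

Section good_code.
Variables (R : realType) (n m q e M1 M2 : nat) (th : bool).
Variables (A1 A2 : {set 'I_n}).
Hypothesis disj : [disjoint A1 & A2]%B.
Hypothesis causal : forall s t : 'I_n, (s \in A1) || (s \in A2) ->
  t \notin A1 -> t \notin A2 -> (s < t)%N.
Hypotheses (m0 : (0 < m)%N) (q0 : (0 < q)%N).
Variables (w01 : 'I_M1) (w02 : 'I_M2).
Variable c : channel R.
Notation P := (ch_prob c).
Notation X := (point q).
Notation B := ('I_(cells th m q).+1 * 'I_(cells th m q).+1)%type.
Notation hash := {ffun {ffun 'I_n -> B} -> {ffun 'I_n -> X}}.
Notation book M := {ffun 'I_M -> {ffun 'I_n -> X}}.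
Notation codes := (book M1 * book M2 * hash)%type.

Variables (G : ch_space c -> bool) (p beta1 beta2 : R).
Hypothesis mG : finmeas G.
Hypothesis pG : (P [set w | ~~ G w] <= p%:E)%E.
Hypothesis badG : forall w k, G w -> (#|bad_slots n m w k| <= e)%N.
Hypotheses (beta1_ge0 : 0 <= beta1) (beta2_ge0 : 0 <= beta2).
Hypothesis bound1 : forall w, G w -> confusion_bound m q e th ord0 A1 A2 M1 w <= beta1.
Hypothesis bound2 : forall w, G w -> confusion_bound m q e th ord_max A2 A1 M2 w <= beta2.

Let code (C : codes) := scheme_code R e A1 A2 w01 w02 C.1.1 C.1.2 C.2.
Let ev1 w1 w2 (C : codes) : set (ch_space c) :=
  [set w | dec1 (code C) (received (code C) ord0 w1 w2 w) <> w1].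
Let ev2 w1 w2 (C : codes) : set (ch_space c) :=
  [set w | dec2 (code C) (received (code C) ord_max w1 w2 w) <> w2].

Let mev1 w1 w2 C : measurable (ev1 w1 w2 C).
Proof. by apply: measurable_error; exact: dec1_measurable. Qed.

Let mev2 w1 w2 C : measurable (ev2 w1 w2 C).
Proof. by apply: measurable_error; exact: dec2_measurable. Qed.

Lemma error1_confused w1 w2 C w : G w -> ev1 w1 w2 C w ->
  confused (th := th) e ord0 A1 A2 w (C.1.2 w2) w1 (C.1.1, C.2).
Proof.
move=> Gw /eqP err.
apply: (scheme_dec_error (u0 := w01) _ _ err); first exact: badG.
move=> t tJ; rewrite tnth_mktuple input_scheme_code// output_gvec//.
rewrite /scheme_input (_ : rev_ord ord0 = ord_max)//; exact: val_inj.
Qed.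

Lemma error2_confused w1 w2 C w : G w -> ev2 w1 w2 C w ->
  confused (th := th) e ord_max A2 A1 w (C.1.1 w1) w2 (C.1.2, C.2).
Proof.
move=> Gw /eqP err.
apply: (scheme_dec_error (u0 := w02) _ _ err); first exact: badG.
move=> t tJ; rewrite tnth_mktuple input_scheme_code// output_gvec//.
rewrite /scheme_input (_ : rev_ord ord_max = ord0); last exact: val_inj.
by rewrite sentC// (side_infoC _ _ _ _ _ disj).
Qed.

(** Outside [G] the probability [p] is charged to every code. Inside [G] the fraction of failing
    codes is at most [beta] for each realization, and sum and expectation are exchanged. *)
Let sum_error (E : codes -> set (ch_space c)) (beta : R) : 0 <= beta ->
  (forall C, measurable (E C)) ->
  (forall w, G w -> upr R [pred C | w \in E C] <= beta) ->
  (\sum_C P (E C) <= (#|{: codes}|%:R * (p + beta))%:E)%E.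
Proof.
move=> beta0 mE Ebeta.
have mGs : measurable [set w | G w] by exact: (mG true).
have split C : (P (E C) <= p%:E + P (E C `&` [set w | G w]))%E.
  rewrite (measureDI P (mE C) mGs) leeD2r//; apply: le_trans pG.
  apply: le_measure; rewrite ?inE; [exact: measurableD|exact: not_finmeas|].
  by move=> w [_ /= h]; apply/negP.
apply: (@le_trans _ _ (\sum_(C : codes) (p%:E + P (E C `&` [set w | G w])))%E).
  exact: lee_sum.
rewrite big_split/= sumEFin sumr_const mulrDr EFinD leeD//.
  by rewrite -[p *+ _]mulr_natl.
apply: sum_probability_le => [C|w]; first exact: measurableI.
case: (boolP (G w)) => Gw; last first.
  rewrite [X in X%:R](_ : _ = 0%N) ?mulr_ge0//; apply: eq_card0 => C.
  by rewrite !inE; apply/negP; rewrite inE => -[_ /=]; apply/negP.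
have := Ebeta w Gw; rewrite /upr => h.
have [C0|C0] := posnP #|{: codes}|.
  rewrite [X in X%:R](_ : _ = 0%N) ?mulr_ge0//.
  by apply/eqP; rewrite -leqn0 -C0 max_card.
rewrite -ler_pdivrMl ?ltr0n// mulrC; apply: le_trans h.
rewrite ler_wpM2r ?invr_ge0// ler_nat subset_leq_card//; apply/fintype.subsetP => C.
rewrite inE => /set_mem[h _]; rewrite unfold_in; exact: mem_set.
Qed.

Let sum_error1 w1 w2 :
  (\sum_C P (ev1 w1 w2 C) <= (#|{: codes}|%:R * (p + beta1))%:E)%E.
Proof.
apply: sum_error => // w Gw.
apply: (@le_trans _ _ (upr R [pred C : codes |
    confused (th := th) e ord0 A1 A2 w (C.1.2 w2) w1 (C.1.1, C.2)])).
  apply: upr_sub => C; rewrite !unfold_in => /set_mem; exact: error1_confused.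
(* Reordering puts the codebook of the other user first, so that it can be frozen while the
   remaining randomness is averaged. *)
pose phi (C : codes) := (C.1.2, (C.1.1, C.2)).
have bphi : bijective phi by exists (fun D : book M2 * (book M1 * hash) =>
  ((D.2.1, D.1), D.2.2)) => [[[]]|[? []]].
rewrite (upr_bij R (fun D : book M2 * (book M1 * hash) =>
  confused (th := th) e ord0 A1 A2 w (D.1 w2) w1 D.2) bphi).
apply: (@upr_snd _ _ _ (fun cb2 : book M2 =>
  confused (th := th) e ord0 A1 A2 w (cb2 w2) w1)) => // cb2.
apply: le_trans (bound1 Gw); apply: upr_confused => //; exact: badG.
Qed.

Let sum_error2 w1 w2 :
  (\sum_C P (ev2 w1 w2 C) <= (#|{: codes}|%:R * (p + beta2))%:E)%E.
Proof.
apply: sum_error => // w Gw.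
apply: (@le_trans _ _ (upr R [pred C : codes |
    confused (th := th) e ord_max A2 A1 w (C.1.1 w1) w2 (C.1.2, C.2)])).
  apply: upr_sub => C; rewrite !unfold_in => /set_mem; exact: error2_confused.
pose phi (C : codes) := (C.1.1, (C.1.2, C.2)).
have bphi : bijective phi by exists (fun D : book M1 * (book M2 * hash) =>
  ((D.1, D.2.1), D.2.2)) => [[[]]|[? []]].
rewrite (upr_bij R (fun D : book M1 * (book M2 * hash) =>
  confused (th := th) e ord_max A2 A1 w (D.1 w1) w2 D.2) bphi).
apply: (@upr_snd _ _ _ (fun cb1 : book M1 =>
  confused (th := th) e ord_max A2 A1 w (cb1 w1) w2)) => // cb1.
apply: le_trans (bound2 Gw); apply: upr_confused => //; first by rewrite fintype.disjoint_sym.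
exact: badG.
Qed.

Let sum_average (E : 'I_M1 -> 'I_M2 -> codes -> set (ch_space c)) (b : R) :
  (forall w1 w2 C, measurable (E w1 w2 C)) ->
  (forall w1 w2, \sum_C P (E w1 w2 C) <= b%:E)%E ->
  \sum_C fine (message_average (fun w1 w2 => P (E w1 w2 C))) <= b.
Proof.
move=> mE bE.
have M0 : (0 < M1 * M2)%N by
  rewrite muln_gt0 (leq_ltn_trans _ (ltn_ord w01))// (leq_ltn_trans _ (ltn_ord w02)).
have fE C : fine (message_average (fun w1 w2 => P (E w1 w2 C))) =
    (M1 * M2)%:R^-1 * \sum_w1 \sum_w2 fine (P (E w1 w2 C)).
  rewrite /message_average.
  under eq_bigr do under eq_bigr do rewrite -[P _]fineK ?fin_num_measure//.
  by under eq_bigr do rewrite sumEFin; rewrite sumEFin -EFinM.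
under eq_bigr do rewrite fE.
rewrite -mulr_sumr exchange_big/= ler_pdivrMl ?ltr0n//.
under eq_bigr do rewrite exchange_big/=.
apply: (@le_trans _ _ (\sum_(w1 < M1) \sum_(w2 < M2) b)).
  apply: ler_sum => w1 _; apply: ler_sum => w2 _.
  rewrite -lee_fin -sumEFin; apply: le_trans (bE w1 w2).
  by apply: lee_sum => C _; rewrite fineK ?fin_num_measure.
by rewrite !sumr_const !card_ord -mulrnA -[b *+ _]mulr_natl mulnC.
Qed.

Lemma message_average_fin M M' (E : 'I_M -> 'I_M' -> set (ch_space c)) :
  (forall w1 w2, measurable (E w1 w2)) ->
  message_average (fun w1 w2 => P (E w1 w2)) \is a fin_num.
Proof.
move=> mE; rewrite /message_average fin_numM//.
by apply/sum_fin_numP => w1 _ _; apply/sum_fin_numP => w2 _ _; rewrite fin_num_measure.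
Qed.

(** The sum of both errors is averaged, so that a single code is good for both receivers at once. *)
Lemma good_code_exists : exists C : codes,
  (error1 c (code C) + error2 c (code C) <= (2 * p + beta1 + beta2)%:E)%E.
Proof.
have codes0 : (0 < #|{: codes}|)%N.
  apply/card_gt0P; pose x0 : X := ((Ordinal q0, Ordinal q0), (Ordinal q0, Ordinal q0)).
  by exists ([ffun=> [ffun=> x0]], [ffun=> [ffun=> x0]], [ffun=> [ffun=> x0]]).
have s1 := sum_average mev1 sum_error1; have s2 := sum_average mev2 sum_error2.
have fE C : (error1 c (code C) + error2 c (code C) =
    (fine (message_average (fun w1 w2 => P (ev1 w1 w2 C))) +
     fine (message_average (fun w1 w2 => P (ev2 w1 w2 C))))%:E)%E.
  by rewrite EFinD !fineK// message_average_fin.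
apply/not_existsP => no.
have : \sum_(C : codes) (2 * p + beta1 + beta2) <
   \sum_(C : codes) (fine (message_average (fun w1 w2 => P (ev1 w1 w2 C))) +
     fine (message_average (fun w1 w2 => P (ev2 w1 w2 C)))).
  apply: ltr_sum => [|C _]; last by rewrite -lte_fin -fE ltNge; exact/negP.
  by have /card_gt0P[C _] := codes0; apply/hasP; exists C => //; rewrite mem_index_enum.
rewrite [X in _ < X]big_split/= sumr_const -(mulr_natl (2 * p + beta1 + beta2)).
rewrite (_ : 2 * p + beta1 + beta2 = (p + beta1) + (p + beta2)); last by ring.
by rewrite mulrDr => /lt_le_trans/(_ (lerD s1 s2)); rewrite ltxx.
Qed.

End good_code.

(** * Rates *)

(** The term [2 * L] pays for truncating the number of own slots to an integer, since [la + th] is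
    at most 2. The deviations cost only [13 * eta]; the bound is stated with 18 to match the other
    exponent. *)
Lemma own_exponent (R : realType) (N L lK th la eta al d e own ownc : R) :
  0 <= N -> 0 <= L -> 0 <= lK -> 0 <= th -> th <= 1 -> 0 <= la -> la <= 1 -> 0 <= eta ->
  al * N - 1 <= own -> e <= 4 * eta * N -> la * own - eta * N <= ownc ->
  d <= (la + th) * al ->
  N * lK - L * (ownc - 2 * e) - th * L * (own - e) <=
  N * (3 * lK - L * (d - 18 * eta)) + 2 * L.
Proof.
move=> N0 L0 lK0 th0 th1 la0 la1 eta0 own_ge eN ownc_ge hd.
have etaN : 0 <= eta * N by rewrite mulr_ge0.
have h1 : (la + th) * (al * N - 1) <= (la + th) * own by rewrite ler_wpM2l// addr_ge0.
have h2 : d * N <= (la + th) * al * N by rewrite ler_wpM2r.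
have h3 : th * e <= 4 * eta * N.
  apply: (@le_trans _ _ (th * (4 * eta * N))); first by rewrite ler_wpM2l.
  by rewrite ler_piMl// -mulrA mulr_ge0.
have h4 : d * N - 18 * eta * N - 2 <= ownc - 2 * e + th * (own - e) by lra.
have := ler_wpM2l L0 h4; have := mulr_ge0 N0 lK0; lra.
Qed.

(** The constant 18 is 9 + 9: both the lost slots of the other user and the usable remaining slots
    are off by [eta * N] from the jamming count and by [8 * eta * N] from [2 * e]. *)
Lemma other_exponent (R : realType) (N L lK th la eta al' d e oth othj coc : R) :
  0 <= N -> 0 <= L -> 0 <= th -> th <= 1 -> la <= 1 -> 0 <= la -> 0 <= eta ->
  oth <= al' * N -> e <= 4 * eta * N ->
  othj <= (1 - la) * oth + eta * N -> la * (N - oth) - eta * N <= coc ->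
  d + th * (1 - la) * al' <= la * (1 - al') ->
  3 * N * lK + th * L * (othj + 2 * e) - L * (coc - 2 * e) <=
  N * (3 * lK - L * (d - 18 * eta)) + 2 * L.
Proof.
move=> N0 L0 th0 th1 la1 la0 eta0 oth_le eN othj_le coc_ge hd.
have etaN : 0 <= eta * N by rewrite mulr_ge0.
have h1 : th * (1 - la) * oth <= th * (1 - la) * (al' * N).
  by rewrite ler_wpM2l// mulr_ge0// subr_ge0.
have h1' : la * oth <= la * (al' * N) by rewrite ler_wpM2l.
have h2 : (d + th * (1 - la) * al') * N <= (la * (1 - al')) * N by rewrite ler_wpM2r.
have h3 : th * (othj + 2 * e) <= th * (1 - la) * oth + 9 * (eta * N).
  apply: (@le_trans _ _ (th * ((1 - la) * oth + 9 * (eta * N)))).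
    by rewrite ler_wpM2l//; lra.
  have : th * (eta * N) <= eta * N by rewrite ler_piMl.
  lra.
have h4 : th * (othj + 2 * e) - (coc - 2 * e) <= 18 * eta * N - d * N by lra.
have := ler_wpM2l L0 h4; lra.
Qed.

Section confusion.
Variables (R : realType) (c : channel R) (n m q e M : nat) (th : bool).
Variables (k : 'I_2) (own oth : {set 'I_n}) (w : ch_space c).
Variables (la eta al al' d r : R).
Let L : R := ln (q ^ 2)%:R.
Let lK : R := ln (overhead m)%:R.
Hypothesis q0 : (0 < q)%N.
Hypotheses (la0 : 0 <= la) (la1 : la <= 1) (eta0 : 0 <= eta).
Hypotheses (own_ge : al * n%:R - 1 <= #|own|%:R) (oth_le : #|oth|%:R <= al' * n%:R).
Hypothesis eN : e%:R <= 4 * eta * n%:R.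
Let clear (D : {set 'I_n}) : R := #|[set t in D | ~~ jammed (chS c t w) k]%SET|%:R.
Hypotheses (own_c : `|clear own - la * #|own|%:R| < eta * n%:R)
  (oth_c : `|clear oth - la * #|oth|%:R| < eta * n%:R)
  (co_c : `|clear (~: oth) - la * #|~: oth|%:R| < eta * n%:R).
Hypotheses (hd1 : d <= (la + th%:R) * al)
  (hd2 : d + th%:R * (1 - la) * al' <= la * (1 - al')).
Hypothesis M1 : (0 < M)%N.
Hypothesis Mr : M%:R <= expR (n%:R * r).
Hypothesis small : r + ln 2 + 3 * lK - L * (d - 18 * eta) <= -1.

(** In [small], [ln 2] pays for the choice of the violated slots and [3 * lK] for the constants of
    the counting; the remaining margin of 1 per slot yields the decay in [n]. *)
Lemma confusion_bound_le :
  confusion_bound m q e th k own oth M w <= 2 * expR (2 * L - n%:R).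
Proof.
have L0 : 0 <= L by rewrite ln_ge0// ler1n expn_gt0 q0.
have lK0 : 0 <= lK by rewrite ln_ge0// ler1n /overhead !addn_gt0 !expn_gt0.
have th1 : (th%:R : R) <= 1 by case: (th).
have N0 : 0 <= n%:R :> R by [].
have clearE (D : {set 'I_n}) : #|D :\: jammed_slots n w k|%:R = clear D.
  by congr _%:R; apply: eq_card => t; rewrite !inE andbC.
have jamE : #|oth :&: jammed_slots n w k|%:R = #|oth|%:R - clear oth :> R.
  by rewrite -clearE -(cardsID (jammed_slots n w k) oth) natrD addrK.
have coE : #|~: oth|%:R = n%:R - #|oth|%:R :> R.
  have := cardsC oth; rewrite card_ord => /(congr1 (fun i => i%:R : R)).
  by rewrite natrD => <-; rewrite addrAC subrr add0r.
move: own_c oth_c co_c; rewrite !ltr_norml => /andP[c1 _] /andP[c2 _] /andP[c3 _].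
have ex1 : n%:R * lK - L * (#|own :\: jammed_slots n w k|%:R - 2 * e%:R)
    - th%:R * L * (#|own|%:R - e%:R) <= n%:R * (3 * lK - L * (d - 18 * eta)) + 2 * L.
  rewrite clearE; apply: (@own_exponent R _ _ _ _ la eta al d) => //.
  by lra.
have ex2 : 3 * n%:R * lK + th%:R * L * (#|oth :&: jammed_slots n w k|%:R + 2 * e%:R)
    - L * (#|~: oth :\: jammed_slots n w k|%:R - 2 * e%:R)
    <= n%:R * (3 * lK - L * (d - 18 * eta)) + 2 * L.
  rewrite clearE jamE; apply: (@other_exponent R _ _ _ _ la eta al' d _ #|oth|%:R) => //.
    by lra.
  by move: c3; rewrite coE; lra.
rewrite /confusion_bound -/L -/lK.
have e2 : 2 ^+ n = expR (n%:R * ln 2) :> R by rewrite expRM_natl lnK// posrE.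
have M1r : M.-1%:R <= expR (n%:R * r) by apply: le_trans Mr; rewrite ler_nat leq_pred.
apply: (@le_trans _ _ (expR (n%:R * r) * expR (n%:R * ln 2) *
  (expR (n%:R * (3 * lK - L * (d - 18 * eta)) + 2 * L) +
   expR (n%:R * (3 * lK - L * (d - 18 * eta)) + 2 * L)))).
  rewrite e2; apply: ler_pM; rewrite ?mulr_ge0 ?addr_ge0 ?expR_ge0//.
    by rewrite ler_wpM2r ?expR_ge0.
  by rewrite lerD// ler_expR.
rewrite -mulr2n mulrnAr -[leLHS]mulr_natl ler_wpM2l// -!expRD ler_expR.
have := ler_wpM2l N0 small; lra.
Qed.

End confusion.

Section power.
Variable R : realType.

Lemma sqnorm_gvec q (x : point q) : sqnorm (gvec R x) <= (4 * q ^ 2)%:R.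
Proof.
have gle (u : 'I_q * 'I_q) : csqnorm (gint R u) <= 2 * (q ^ 2)%:R.
  rewrite /csqnorm/gint/= -!natrX -natrD -natrM ler_nat.
  have : (u.1 ^ 2 <= q ^ 2)%N by rewrite leq_exp2r// ltnW.
  have : (u.2 ^ 2 <= q ^ 2)%N by rewrite leq_exp2r// ltnW.
  lia.
rewrite /sqnorm big_ord_recl big_ord1 !big_ord1 !mxE/=.
have := gle x.1; have := gle x.2; rewrite (natrM _ 4); lra.
Qed.

Lemma measurable_sqnorm d (T : measurableType d) (x : T -> 'cV[R[i]]_2) :
  measurable_fun setT x -> measurable_fun setT (fun w => sqnorm (x w)).
Proof.
move=> mx; rewrite /sqnorm; apply: measurable_sum => i; apply: measurable_sum => j.
by apply: measurable_csqnorm; exact: (measurableT_comp (measurable_entry _ _)).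
Qed.

Lemma sqnorm_ge0 k l (x : 'M[R[i]]_(k, l)) : 0 <= sqnorm x.
Proof. by apply: sumr_ge0 => i _; apply: sumr_ge0 => j _; exact: csqnorm_ge0. Qed.

Lemma peak_power_constraint (c : channel R) n M1 M2 (cd : dn_code R n M1 M2) (PT : R) :
  (0 < M1)%N -> (0 < M2)%N ->
  (forall w1 w2 t w, (t < n)%N -> sqnorm (@input R c n M1 M2 cd w1 w2 t w) <= PT) ->
  power_constraint c cd PT.
Proof.
move=> M1_gt0 M2_gt0 peak t tn.
have each w1 w2 : ('E_(ch_prob c)[fun w => sqnorm (@input R c n M1 M2 cd w1 w2 t w)] <= PT%:E)%E.
  rewrite -(expectation_cst (ch_prob c) PT) unlock.
  apply: ge0_le_integral => //.
  - by move=> w _; rewrite lee_fin sqnorm_ge0.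
  - apply/measurable_EFinP; apply: measurable_sqnorm; exact: measurable_input.
  - by apply/measurable_EFinP; exact: measurable_cst.
  - by move=> w _; rewrite lee_fin peak.
rewrite /message_average; apply: (@le_trans _ _ (((M1 * M2)%:R^-1)%:E *
   \sum_(w1 < M1) \sum_(w2 < M2) PT%:E)%E).
  rewrite lee_pmul2l// ?lte_fin ?invr_gt0 ?ltr0n ?muln_gt0 ?M1_gt0//.
  by apply: lee_sum => w1 _; apply: lee_sum => w2 _; exact: each.
under eq_bigr do rewrite sumEFin.
rewrite sumEFin -EFinM lee_fin !sumr_const !card_ord -mulrnA -(mulr_natl PT) [(M2 * M1)%N]mulnC.
by rewrite mulKf// pnatr_eq0 -lt0n muln_gt0 M1_gt0.
Qed.

End power.

Section slots.
Variables (n l1 l2 : nat).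
Definition first_slots : {set 'I_n} := [set t : 'I_n | (t < l1)%N]%SET.
Definition second_slots : {set 'I_n} := [set t : 'I_n | (l1 <= t < l1 + l2)%N]%SET.

Lemma slots_disjoint : [disjoint first_slots & second_slots]%B.
Proof.
rewrite -finset.setI_eq0; apply/eqP/setP => t; rewrite !inE.
by case: ltnP => //=; lia.
Qed.

Lemma slots_causal (s t : 'I_n) : (s \in first_slots) || (s \in second_slots) ->
  t \notin first_slots -> t \notin second_slots -> (s < t)%N.
Proof. by rewrite !inE; lia. Qed.

Lemma card_prefix l : (l <= n)%N -> #|[set t : 'I_n | (t < l)%N]%SET| = l.
Proof.
move=> ln; rewrite -sum1dep_card (big_ord_narrow ln) sum1_card card_ord.
by [].
Qed.

Lemma card_first_slots : (l1 + l2 <= n)%N -> #|first_slots| = l1.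
Proof. by move=> h; rewrite card_prefix//; lia. Qed.

Lemma card_second_slots : (l1 + l2 <= n)%N -> #|second_slots| = l2.
Proof.
move=> h; have := cardsUI first_slots second_slots.
rewrite (eqP (_ : first_slots :&: second_slots == finset.set0)); last first.
  by rewrite finset.setI_eq0 slots_disjoint.
have -> : first_slots :|: second_slots = [set t : 'I_n | (t < l1 + l2)%N]%SET.
  by apply/setP => t; rewrite !inE; lia.
by rewrite cards0 card_prefix// card_first_slots//; lia.
Qed.

End slots.

Section code_at_length.
Variables (R : realType) (muH muG : 'I_2 -> probability 'rV[R[i]]_2 R).
Variables (lam : bool -> bool -> R) (PT : R) (c : channel R).
Hypothesis hc : jammed_miso_bc muH muG lam PT c.
Variables (m q : nat) (eta : R) (th : bool) (a1 a2 d1 d2 r1 r2 : R).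
Let la1 := unjammed_prob lam ord0.
Let la2 := unjammed_prob lam ord_max.
Let L : R := ln (q ^ 2)%:R.
Let lK : R := ln (overhead m)%:R.
Hypotheses (m0 : (0 < m)%N) (q0 : (0 < q)%N) (qPT : (4 * q ^ 2)%:R <= PT).
Hypotheses (eta0 : 0 < eta) (pair_eta : bad_pair_prob muH m <= eta)
  (noise_eta : bad_noise_prob R m <= eta).
Hypotheses (la10 : 0 <= la1) (la11 : la1 <= 1) (la20 : 0 <= la2) (la21 : la2 <= 1).
Hypotheses (a10 : 0 <= a1) (a20 : 0 <= a2) (a12 : a1 + a2 <= 1).
Hypotheses (hd1 : d1 <= (la1 + th%:R) * a1)
  (hd1' : d1 + th%:R * (1 - la1) * a2 <= la1 * (1 - a2)).
Hypotheses (hd2 : d2 <= (la2 + th%:R) * a2)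
  (hd2' : d2 + th%:R * (1 - la2) * a1 <= la2 * (1 - a1)).

(** Covers a user whose rate is 0: a single message cannot be confused, so no condition on the
    exponents is required. *)
Lemma confusion_bound1 n e k own oth (w : ch_space c) :
  confusion_bound (n := n) m q e th k own oth 1 w = 0.
Proof. by rewrite /confusion_bound !mul0r. Qed.

Lemma code_at_length (n M1 M2 : nat) :
  (0 < n)%N -> (0 < M1)%N -> (0 < M2)%N ->
  M1%:R <= expR (n%:R * r1) -> M2%:R <= expR (n%:R * r2) ->
  (M1 = 1%N \/ r1 + ln 2 + 3 * lK - L * (d1 - 18 * eta) <= -1) ->
  (M2 = 1%N \/ r2 + ln 2 + 3 * lK - L * (d2 - 18 * eta) <= -1) ->
  exists cd : dn_code R n M1 M2, power_constraint c cd PT /\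
    (error1 c cd + error2 c cd <=
      (22 * (eta ^+ 2 * n%:R)^-1 + 4 * expR (2 * L - n%:R))%:E)%E.
Proof.
move=> n0 M10 M20 Mr1 Mr2 small1 small2.
pose w01 := Ordinal M10; pose w02 := Ordinal M20.
have N0 : 0 <= n%:R :> R by [].
have aN1 : 0 <= a1 * n%:R by rewrite mulr_ge0.
have aN2 : 0 <= a2 * n%:R by rewrite mulr_ge0.
pose l1 := Num.truncn (a1 * n%:R); pose l2 := Num.truncn (a2 * n%:R).
have /andP[l1le l1gt] := truncn_itv aN1; have /andP[l2le l2gt] := truncn_itv aN2.
rewrite -/l1 in l1le l1gt; rewrite -/l2 in l2le l2gt.
have l12 : (l1 + l2 <= n)%N.
  rewrite -(ler_nat R) natrD; apply: (@le_trans _ _ ((a1 + a2) * n%:R)).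
    by rewrite mulrDl lerD.
  by rewrite ler_piMl.
pose A1 := first_slots n l1; pose A2 := second_slots n l1 l2.
have cA1 : #|A1| = l1 by exact: (card_first_slots l12).
have cA2 : #|A2| = l2 by exact: card_second_slots.
have e0 : 0 <= 4 * eta * n%:R by rewrite !mulr_ge0// ltW.
(* Bad channel pairs and large noise each affect at most [2 * eta * n] slots in a typical
   realization. *)
pose e := Num.truncn (4 * eta * n%:R).
have eN : e%:R <= 4 * eta * n%:R by rewrite truncn_le.
(* Jamming is counted over both slot sets and their complements; a receiver uses its own slots,
   those of the other user and the complement of the latter. *)
pose A (b : bool * bool) : {set 'I_n} :=
  let S := if b.1 then A1 else A2 in if b.2 then S else ~: S.
pose G := typical muH lam (c := c) m A eta.
have Gpair w : G w -> #|[set t : 'I_n | ~~ pair_good m (chH c ord0 t w) (chH c ord_max t w)]%SET|%:R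
    <= 2 * eta * n%:R.
  move=> /and3P[+ _ _]; move/ltW/le_trans; apply; rewrite ler_wpM2r//.
  by have := pair_eta; lra.
have Gnoise w k : G w -> #|[set t : 'I_n | ~~ in_box m%:R (chN c k t w)]%SET|%:R
    <= 2 * eta * n%:R.
  move=> /and3P[_ /forallP/(_ k) + _]; move/ltW/le_trans; apply.
  by rewrite ler_wpM2r//; have := noise_eta; lra.
have Gclear w k b : G w -> `| #|[set t in A b | ~~ jammed (chS c t w) k]%SET|%:R
    - unjammed_prob lam k * #|A b|%:R | < eta * n%:R.
  by move=> /and3P[_ _ /forallP/(_ k)/forallP/(_ b)].
have badG w k : G w -> (#|bad_slots n m w k| <= e)%N.
  move=> Gw; rewrite truncn_ge_nat//.
  apply: (@le_trans _ _ (2 * eta * n%:R + 2 * eta * n%:R)); last by rewrite -!mulrDl -natrD.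
  apply: le_trans (lerD (Gpair w Gw) (Gnoise w k Gw)).
  by rewrite -natrD ler_nat /bad_slots leq_card_setU.
have exp0 : 0 <= 2 * expR (2 * L - n%:R) by rewrite mulr_ge0// expR_ge0.
have bound1 w : G w -> confusion_bound m q e th ord0 A1 A2 M1 w <= 2 * expR (2 * L - n%:R).
  move=> Gw; case: small1 => [->|small1]; first by rewrite confusion_bound1.
  apply: (@confusion_bound_le R c n m q e M1 th ord0 A1 A2 w la1 eta a1 a2 d1 r1) => //.
  - exact: ltW.
  - by rewrite cA1; rewrite -natr1 in l1gt; lra.
  - by rewrite cA2.
  - exact: (Gclear w ord0 (true, true)).
  - exact: (Gclear w ord0 (false, true)).
  - exact: (Gclear w ord0 (false, false)).
have bound2 w : G w -> confusion_bound m q e th ord_max A2 A1 M2 w <= 2 * expR (2 * L - n%:R).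
  move=> Gw; case: small2 => [->|small2]; first by rewrite confusion_bound1.
  apply: (@confusion_bound_le R c n m q e M2 th ord_max A2 A1 w la2 eta a2 a1 d2 r2) => //.
  - exact: ltW.
  - by rewrite cA2; rewrite -natr1 in l2gt; lra.
  - by rewrite cA1.
  - exact: (Gclear w ord_max (false, true)).
  - exact: (Gclear w ord_max (true, true)).
  - exact: (Gclear w ord_max (true, false)).
have disj : [disjoint A1 & A2]%B := slots_disjoint n l1 l2.
have mG : finmeas G by exact: finmeas_typical.
have pG := probability_not_typical hc m A eta0 n0.
rewrite card_prod card_bool in pG.
have [C hC] := good_code_exists disj (@slots_causal n l1 l2) m0 q0 w01 w02 mG pG badG
  exp0 exp0 bound1 bound2.
exists (scheme_code R e A1 A2 w01 w02 C.1.1 C.1.2 C.2); split.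
  apply: peak_power_constraint => // w1 w2 t w tn.
  have /= -> := input_scheme_code e (@slots_causal n l1 l2) w01 w02 C.1.1 C.1.2 C.2 w1 w2
    (Ordinal tn) w.
  exact: le_trans (sqnorm_gvec _ _) qPT.
(* With four slot sets there are 11 deviation events, and atypicality is charged once per receiver:
   hence 22. *)
apply: le_trans hC _; rewrite lee_fin; lra.
Qed.

End code_at_length.

Section rates.
Variable R : realType.

Lemma cvg_div_nat (C : R) : C / n%:R @[n --> \oo] --> (0 : R).
Proof.
apply/cvgrPdist_le => e e0; near=> n.
have n0 : 0 < n%:R :> R by near: n; exact: nbhs_infty_gtr.
rewrite sub0r normrN normrM normfV (ger0_norm (ltW n0)) ler_pdivrMr// mulrC.
rewrite -ler_pdivrMr//; near: n; exact: nbhs_infty_ger.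
Unshelve. all: by end_near. Qed.

Definition message_count (r : R) (n : nat) : nat := Num.truncn (expR (n%:R * r)).

Lemma message_count_gt0 r n : 0 <= r -> (0 < message_count r n)%N.
Proof. by move=> r0; rewrite truncn_gt0 -expR0 ler_expR mulr_ge0. Qed.

Lemma message_count_le r n : (message_count r n)%:R <= expR (n%:R * r).
Proof. by rewrite truncn_le expR_ge0. Qed.

Lemma message_count0 n : message_count 0 n = 1%N.
Proof. by rewrite /message_count mulr0 expR0 truncn1. Qed.

(** The count is at least 1, so truncation at most halves the exponential and the rate loses at most
    [ln 2 / n]. *)
Lemma message_count_rate r : 0 <= r ->
  ln (message_count r n)%:R / n%:R @[n --> \oo] --> r.
Proof.
move=> r0; apply: (@squeeze_cvgr _ _ _ _ (fun n : nat => r - ln 2 / n%:R) (fun=> r)).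
- near=> n; have n0 : 0 < n%:R :> R by near: n; exact: nbhs_infty_gtr.
  have M0 : (0 < message_count r n)%N by exact: message_count_gt0.
  have Mr0 : 0 < (message_count r n)%:R :> R by rewrite ltr0n.
  apply/andP; split; last first.
    rewrite ler_pdivrMr// mulrC -[leRHS]expRK ler_ln ?posrE ?expR_gt0//.
    exact: message_count_le.
  rewrite ler_pdivlMr// mulrBl divfK ?gt_eqF// mulrC lerBlDr -lnM ?posrE//.
  rewrite -[leLHS]expRK ler_ln ?posrE ?expR_gt0 ?mulr_gt0//.
  have /andP[_ /ltW h] := truncn_itv (expR_ge0 (n%:R * r)).
  apply: le_trans h _; rewrite -/(message_count r n) -natrM ler_nat; lia.
- by rewrite -[X in _ --> X]subr0; apply: cvgB; [exact: cvg_cst|exact: cvg_div_nat].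
- exact: cvg_cst.
Unshelve. all: by end_near. Qed.

End rates.

(** * From codes to the degrees-of-freedom region *)

Section achievability.
Variable R : realType.

Lemma squeeze_error (f : nat -> \bar R) (C : R) :
  (forall n, (0 <= f n)%E) -> (forall n, (0 < n)%N -> (f n <= (C / n%:R)%:E)%E) ->
  f n @[n --> \oo] --> 0%E.
Proof.
move=> f0 fC.
apply: (@squeeze_cvge _ _ _ _ (fun=> 0%E) _ (fun n => (C / n%:R)%:E)).
- near=> n; rewrite f0 fC//; near: n; exact: nbhs_infty_gt.
- exact: cvg_cst.
- by apply: cvg_EFin; [near=> n|exact: cvg_div_nat].
Unshelve. all: by end_near. Qed.

Lemma message_average_ge0 M1 M2 (f : 'I_M1 -> 'I_M2 -> \bar R) :
  (forall w1 w2, (0 <= f w1 w2)%E) -> (0 <= message_average f)%E.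
Proof.
move=> f0; rewrite /message_average mule_ge0//.
by apply: sume_ge0 => w1 _; apply: sume_ge0.
Qed.

Definition silent_code n M1 M2 (w1 : 'I_M1) (w2 : 'I_M2) : dn_code R n M1 M2.
Proof.
refine {| enc := fun _ _ _ _ => 0; dec1 := fun=> w1; dec2 := fun=> w2 |}.
- by move=> *; exact: measurable_cst.
- by move=> v; exact: finmeas_cst.
- by move=> v; exact: finmeas_cst.
Defined.

Lemma achievable_of_codes (c : channel R) (PT r1 r2 C : R) :
  0 <= r1 -> 0 <= r2 ->
  (forall n, (0 < n)%N ->
    exists cd : dn_code R n (message_count r1 n) (message_count r2 n),
      power_constraint c cd PT /\ (error1 c cd + error2 c cd <= (C / n%:R)%:E)%E) ->
  achievable c PT r1 r2.
Proof.
move=> r10 r20 codes.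
have ex n : exists cd : dn_code R n (message_count r1 n) (message_count r2 n),
    power_constraint c cd PT /\ ((0 < n)%N ->
      (error1 c cd + error2 c cd <= (C / n%:R)%:E)%E).
  (* A code is required for the empty block too, where the power constraint is vacuous. *)
  case: n => [|n]; last by have [//|cd [? ?]] := codes n.+1; exists cd.
  exists (silent_code 0 (Ordinal (message_count_gt0 0 r10)) (Ordinal (message_count_gt0 0 r20))).
  by split.
have e1_ge0 n (cd : dn_code R n (message_count r1 n) (message_count r2 n)) :
    (0 <= error1 c cd)%E by exact: message_average_ge0.
have e2_ge0 n (cd : dn_code R n (message_count r1 n) (message_count r2 n)) :
    (0 <= error2 c cd)%E by exact: message_average_ge0.
exists (message_count r1), (message_count r2), (fun n => projT1 (cid (ex n))); split.
- by move=> n; rewrite !message_count_gt0.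
- by move=> n; case: (cid (ex n)) => cd [].
- by split; exact: message_count_rate.
- apply: (@squeeze_error _ C) => // n n0; case: (cid (ex n)) => cd [_ /(_ n0) h] /=.
  by apply: le_trans h; rewrite leeDl.
- apply: (@squeeze_error _ C) => // n n0; case: (cid (ex n)) => cd [_ /(_ n0) h] /=.
  by apply: le_trans h; rewrite leeDr.
Qed.

Lemma achievable_zero (c : channel R) (PT : R) : 0 < PT -> achievable c PT 0 0.
Proof.
move=> PT0; apply: (@achievable_of_codes _ _ _ _ 0) => // n n0.
rewrite !message_count0; exists (silent_code n ord0 ord0); split.
  apply: peak_power_constraint => // w1 w2 t w _.
  rewrite /input/= /sqnorm big1 ?ltW// => i _; rewrite big1// => j _.
  by rewrite mxE /csqnorm/= expr0n/= addr0.
have no (f : ch_space c -> 'I_1) (g : 'I_1) : ch_prob c [set w | f w <> g] = 0%E.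
  rewrite [X in ch_prob c X](_ : _ = set0) ?measure0//.
  by apply/seteqP; split => // w /=; rewrite (ord1 (f w)) (ord1 g).
have avg0 (f : 'I_1 -> 'I_1 -> \bar R) : (forall w1 w2, f w1 w2 = 0%E) ->
    message_average f = 0%E.
  by move=> f0; rewrite /message_average big1 ?mule0// => w1 _; rewrite big1.
by rewrite /error1 /error2 !avg0 ?adde0 ?mul0r// => w1 w2; exact: no.
Qed.

(** At each power a loss within [PT^-1] of the infimum of the achievable ones is selected, since the
    infimum need not be attained. For every [eps] this infimum is eventually at most [eps], so the
    selected losses tend to 0. *)
Lemma dof_region_of_backoff (c : R -> channel R) (d1 d2 : R) : 0 <= d1 -> 0 <= d2 ->
  (forall eps, 0 < eps -> exists P0, forall PT, P0 <= PT ->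
    achievable (c PT) PT (Num.max 0 (d1 - eps) * ln PT) (Num.max 0 (d2 - eps) * ln PT)) ->
  dof_region c d1 d2.
Proof.
move=> d10 d20 near_d.
pose good PT : set R := [set eps | 0 < eps /\
  achievable (c PT) PT (Num.max 0 (d1 - eps) * ln PT) (Num.max 0 (d2 - eps) * ln PT)].
have inf_good PT : 0 < PT -> has_inf (good PT).
  move=> PT0; split; last by exists 0 => eps [/ltW].
  (* With so large a loss both rates are 0, which silence achieves at any positive power. *)
  exists (d1 + d2 + 1); split; first by rewrite ltr_wpDl// addr_ge0.
  rewrite !max_l ?mul0r; [exact: achievable_zero|lra|lra].
have ex PT : exists eps, 0 < PT -> good PT eps /\ eps < inf (good PT) + PT^-1.
  have [PT0|PT0] := ltP 0 PT; last by exists 0.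
  have PTV : 0 < PT^-1 by rewrite invr_gt0.
  by have [eps ge lt] := inf_adherent PTV (inf_good PT PT0); exists eps.
pose eps PT := projT1 (cid (ex PT)).
have epsP PT : 0 < PT -> good PT (eps PT) /\ eps PT < inf (good PT) + PT^-1.
  by rewrite /eps; case: (cid (ex PT)).
have limit d : 0 <= d ->
    Num.max 0 (d - eps PT) * ln PT / ln PT @[PT --> +oo] --> d.
  move=> d0; apply/cvgrPdist_le => e e0.
  have e2 : 0 < e / 2 by rewrite divr_gt0.
  have [P0 hP0] := near_d _ e2.
  near=> PT.
  have PT1 : 1 < PT by near: PT; apply: nbhs_pinfty_gt; rewrite num_real.
  have PT0 : 0 < PT by exact: lt_trans PT1.
  have lnPT : 0 < ln PT by exact: ln_gt0.
  have PTP : P0 <= PT by near: PT; apply: nbhs_pinfty_ge; rewrite num_real.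
  have PTe : (e / 2)^-1 <= PT by near: PT; apply: nbhs_pinfty_ge; rewrite num_real.
  rewrite mulfK ?gt_eqF//.
  have [[eps0 _] lt] := epsP PT PT0.
  have inf_le : inf (good PT) <= e / 2.
    by apply: ge_inf; [exact: (inf_good PT PT0).2|split => //; exact: hP0].
  have PTV : PT^-1 <= e / 2 by rewrite -[leRHS]invrK lef_pV2 ?posrE ?invr_gt0.
  have small : eps PT <= e by lra.
  have [h|h] := leP 0 (d - eps PT).
    by rewrite opprB addrC subrK ger0_norm// ltW.
  by rewrite subr0 ger0_norm//; lra.
exists (fun PT => Num.max 0 (d1 - eps PT) * ln PT),
  (fun PT => Num.max 0 (d2 - eps PT) * ln PT); split.
- by move=> PT PT0; have [[_ h] _] := epsP PT PT0.
- exact: limit.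
- exact: limit.
Unshelve. all: by end_near. Qed.

End achievability.

Section scheme_region.
Variables (R : realType) (muH muG : 'I_2 -> probability 'rV[R[i]]_2 R).
Hypothesis muH_density : forall k, has_density (muH k).
Variables (lam : bool -> bool -> R) (c : R -> channel R).
Hypothesis c_model : forall PT, 0 < PT -> jammed_miso_bc muH muG lam PT (c PT).

(** Continuity from above is applied on the probability space of the channel at power 1, where the
    Gaussian law is that of an actual noise variable. *)
Lemma bad_noise_cvg0 : bad_noise_prob R m @[m --> \oo] --> 0.
Proof.
have hc := c_model (@ltr01 R).
have mN m : measurable [set w : ch_space (c 1) | ~~ in_box m%:R (chN (c 1) ord0 0 w)].
  by apply: not_finmeas; exact: finmeas_in_box.
have cap0 : \bigcap_m [set w : ch_space (c 1) | ~~ in_box m%:R (chN (c 1) ord0 0 w)] = set0.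
  apply/seteqP; split => // w bad.
  have [m0 hm] := eventually_in_box (chN (c 1) ord0 0 w).
  by have /negP := bad m0 I; apply; exact: hm.
rewrite (_ : (fun _ => _) = fine \o (fun m : nat => ch_prob (c 1)
    [set w | ~~ in_box m%:R (chN (c 1) ord0 0 w)])); last first.
  by apply/funext => m; rewrite /bad_noise_prob -(noise_law hc ord0 0).
have e0 : ch_prob (c 1) (\bigcap_m [set w : ch_space (c 1) |
    ~~ in_box m%:R (chN (c 1) ord0 0 w)]) = 0%:E by rewrite cap0 measure0.
apply: fine_cvg; rewrite -e0.
apply: (@nonincreasing_cvg_mu _ _ _ (ch_prob (c 1))
  (fun m : nat => [set w | ~~ in_box m%:R (chN (c 1) ord0 0 w)])) => //.
- by apply: le_lt_trans (ltry 1); exact: probability_le1.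
- by rewrite cap0; exact: measurable0.
- apply/nonincreasing_seqP => m; apply/subsetPset => w /=.
  by apply: contraNN; apply: in_box_mono; rewrite ler_nat.
Qed.

Lemma good_level (eta : R) : 0 < eta -> exists m : nat,
  [/\ (0 < m)%N, bad_pair_prob muH m <= eta & bad_noise_prob R m <= eta].
Proof.
move=> eta0.
have h1 : bad_pair_prob muH m @[m --> \oo] --> (0 : R).
  by apply: fine_cvg; exact: product_bad_pairs.
have h2 := bad_noise_cvg0.
near \oo => m; exists m; split.
- by near: m; exact: nbhs_infty_gt.
- by apply/ltW; near: m; exact: (cvgr_lt _ h1).
- by apply/ltW; near: m; exact: (cvgr_lt _ h2).
Unshelve. all: by end_near. Qed.

(** The choice is the integer part of half the square root of [PT]. Since that root is at least 4,
    truncation leaves at least a quarter of it, so [q ^ 2] is at least [PT / 16]. *)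
Lemma grid_size (PT : R) : 16 <= PT -> exists q : nat,
  [/\ (0 < q)%N, (4 * q ^ 2)%:R <= PT & ln PT - ln 16 <= ln (q ^ 2)%:R].
Proof.
move=> PT16; have PT0 : 0 <= PT by apply: le_trans PT16.
set s := Num.sqrt PT; have s2 : s ^+ 2 = PT by rewrite sqr_sqrtr.
have s4 : 4 <= s by rewrite -(@ler_pXn2r _ 2)// ?nnegrE ?sqrtr_ge0// s2; lra.
have s0 : 0 <= s / 2 by lra.
exists (Num.truncn (s / 2)); have /andP[qle qgt] := truncn_itv s0.
set q := Num.truncn (s / 2) in qle qgt *; rewrite -[q.+1%:R]natr1 in qgt.
have q0 : (0 < q)%N by rewrite truncn_gt0; lra.
split => //.
  by rewrite natrM natrX -s2; have := ler0n R q; nra.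
have PTpos : 0 < PT by lra.
rewrite -ln_div ?posrE//.
rewrite ler_ln ?posrE ?divr_gt0//; last by rewrite ltr0n expn_gt0 q0.
have sq : s <= 4 * q%:R by lra.
have : s * s <= (4 * q%:R) * (4 * q%:R) by rewrite ler_pM//; lra.
rewrite ler_pdivrMr// natrX -s2; lra.
Qed.

Lemma unjammed_prob_le1 k : unjammed_prob lam k <= 1.
Proof.
have hc := c_model (@ltr01 R).
rewrite -lee_fin -(unjammed_law hc k 0); apply: probability_le1.
exact: not_finmeas (finmeas_jammed _ k 0).
Qed.

Variables (th : bool) (a1 a2 d1 d2 : R).
Let la1 := unjammed_prob lam ord0.
Let la2 := unjammed_prob lam ord_max.
Hypotheses (la10 : 0 <= la1) (la20 : 0 <= la2).
Hypotheses (a10 : 0 <= a1) (a20 : 0 <= a2) (a12 : a1 + a2 <= 1).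
Hypotheses (d10 : 0 <= d1) (d20 : 0 <= d2).
Hypotheses (hd1 : d1 <= (la1 + th%:R) * a1)
  (hd1' : d1 + th%:R * (1 - la1) * a2 <= la1 * (1 - a2)).
Hypotheses (hd2 : d2 <= (la2 + th%:R) * a2)
  (hd2' : d2 + th%:R * (1 - la2) * a1 <= la2 * (1 - a1)).

Lemma scheme_dof_region : dof_region c d1 d2.
Proof.
apply: dof_region_of_backoff => // eps eps0.
(* Then [18 * eta] is below [eps / 2], so at least half of the loss [eps] remains to absorb the
   constants. *)
pose eta := eps / 40; have eta0 : 0 < eta by rewrite divr_gt0.
have [m [m0 pair_eta noise_eta]] := good_level eta0.
pose lK : R := ln (overhead m)%:R.
(* Threshold for [ln PT] beyond which the remaining half of the loss covers all constants, including
   the factor 16 lost in the grid size. *)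
pose K0 : R := (1 + ln 2 + 3 * lK + ln 16 * (d1 + d2)) / (eps / 2).
exists (Num.max 16 (expR K0)) => PT; rewrite ge_max => /andP[PT16 PTK].
have PT0 : 0 < PT by lra.
have [q [q0 qPT Lge]] := grid_size PT16.
have lnPT : K0 <= ln PT by rewrite -[leLHS]expRK ler_ln ?posrE ?expR_gt0.
have lnPT0 : 0 <= ln PT by rewrite ln_ge0//; lra.
have ln16 : 0 <= ln 16 :> R by rewrite ln_ge0//; lra.
have key d : 0 <= d -> d <= d1 + d2 -> Num.max 0 (d - eps) * ln PT = 0 \/
    Num.max 0 (d - eps) * ln PT + ln 2 + 3 * lK - ln (q ^ 2)%:R * (d - 18 * eta) <= -1.
  move=> d0 dle; have [h|h] := leP 0 (d - eps); [right|by left; rewrite mul0r].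
  have e18 : 18 * eta = eps * (18 / 40) by rewrite /eta; field.
  have i1 : (ln PT - ln 16) * (d - 18 * eta) <= ln (q ^ 2)%:R * (d - 18 * eta).
    by rewrite ler_wpM2r//; lra.
  have i2 : ln 16 * d <= ln 16 * (d1 + d2) by rewrite ler_wpM2l.
  have i3 : 1 + ln 2 + 3 * lK + ln 16 * (d1 + d2) <= eps / 2 * ln PT.
    by rewrite -ler_pdivrMl ?divr_gt0// mulrC.
  have i4 : 0 <= ln 16 * eps by rewrite mulr_ge0// ltW.
  have i5 : 0 <= eps * ln PT by rewrite mulr_ge0// ltW.
  rewrite e18 in i1 *; lra.
have r_ge0 d : 0 <= Num.max 0 (d - eps) * ln PT by rewrite mulr_ge0// le_max lexx.
pose C := 22 / eta ^+ 2 + 4 * expR (2 * ln (q ^ 2)%:R).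
apply: (@achievable_of_codes _ _ _ _ _ C) => // n n0.
set r1 := Num.max 0 (d1 - eps) * ln PT; set r2 := Num.max 0 (d2 - eps) * ln PT.
have small1 : message_count r1 n = 1%N \/
    r1 + ln 2 + 3 * lK - ln (q ^ 2)%:R * (d1 - 18 * eta) <= -1.
  have d1le : d1 <= d1 + d2 by rewrite lerDl.
  by have [e|?] := key d1 d10 d1le; [left; rewrite /r1 e message_count0|right].
have small2 : message_count r2 n = 1%N \/
    r2 + ln 2 + 3 * lK - ln (q ^ 2)%:R * (d2 - 18 * eta) <= -1.
  have d2le : d2 <= d1 + d2 by rewrite lerDr.
  by have [e|?] := key d2 d20 d2le; [left; rewrite /r2 e message_count0|right].
have [cd [pcd ecd]] := code_at_length (c_model PT0) m0 q0 qPT eta0 pair_eta noise_eta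
  la10 (unjammed_prob_le1 _) la20 (unjammed_prob_le1 _) a10 a20 a12 hd1 hd1' hd2 hd2' n0
  (message_count_gt0 n (r_ge0 d1)) (message_count_gt0 n (r_ge0 d2))
  (message_count_le r1 n) (message_count_le r2 n) small1 small2.
exists cd; split => //; apply: le_trans ecd _; rewrite lee_fin.
have nR : 0 < n%:R :> R by rewrite ltr0n.
have -> : C / n%:R = 22 * (eta ^+ 2 * n%:R)^-1 + 4 * (expR (2 * ln (q ^ 2)%:R) / n%:R).
  by rewrite /C; field; rewrite !gt_eqF.
rewrite lerD2l ler_pM2l// expRD expRN ler_pM2l ?expR_gt0//.
rewrite lef_pV2 ?posrE ?expR_gt0//.
(* The exponential term is weakened to order 1/n, like the Chebyshev term, by [n <= expR n]. *)
by apply: le_trans (expR_ge1Dx _); rewrite lerDr.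
Qed.

End scheme_region.

Theorem theorem6 (R : realType)
  (muH muG : 'I_2 -> probability 'rV[R[i]]_2 R)
  (muH_density : forall k, has_density (muH k))
  (muH_cov : forall k, identity_covariance (muH k))
  (muG_density : forall k, has_density (muG k))
  (muG_cov : forall k, identity_covariance (muG k))
  (lam : bool -> bool -> R) (lambda1 lambda2 : R)
  (lambda1E : lambda1 = unjammed1 lam)
  (lambda2E : lambda2 = unjammed2 lam)
  (lambda1_gt0 : 0 < lambda1) (lambda2_gt0 : 0 < lambda2)
  (c : R -> channel R)
  (c_model : forall PT, 0 < PT -> jammed_miso_bc muH muG lam PT (c PT)) :
  (`|lambda1 - lambda2| / (lambda1 * lambda2) <= 1 ->
   forall d1 d2 : R, 0 <= d1 -> 0 <= d2 ->
     d1 + (2 * Num.max 1 (lambda1 / lambda2) - 1) / (1 + lambda2) * d2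
       <= lambda1 ->
     (2 * Num.max 1 (lambda2 / lambda1) - 1) / (1 + lambda1) * d1 + d2
       <= lambda2 ->
     dof_region c d1 d2) /\
  (1 < `|lambda1 - lambda2| / (lambda1 * lambda2) ->
   forall d1 d2 : R, 0 <= d1 -> 0 <= d2 ->
     d1 / lambda1 + d2 / lambda2 <= 1 ->
     dof_region c d1 d2).
Proof.
have la1E : unjammed_prob lam ord0 = lambda1 by rewrite lambda1E.
have la2E : unjammed_prob lam ord_max = lambda2 by rewrite lambda2E.
have la11 : lambda1 <= 1 by rewrite -la1E; exact: unjammed_prob_le1 c_model ord0.
have la21 : lambda2 <= 1 by rewrite -la2E; exact: unjammed_prob_le1 c_model ord_max.
split=> _ d1 d2 d10 d20.
  move=> h1 h2.
  (* The region with each [max] replaced by 1 is the larger one reached by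
     [a_k = d_k / (1 + lambda_k)]. *)
  have weaken (x la d : R) : 0 < la -> 0 <= d ->
      d / (1 + la) <= (2 * Num.max 1 x - 1) / (1 + la) * d.
    move=> la0 d0; rewrite mulrAC ler_wpM2r// ?invr_ge0; first lra.
    have : 1 <= Num.max 1 x by rewrite le_max lexx.
    by nra.
  have w2 := weaken (lambda1 / lambda2) _ _ lambda2_gt0 d20.
  have w1 := weaken (lambda2 / lambda1) _ _ lambda1_gt0 d10.
  set a2 := d2 / (1 + lambda2) in w2; set a1 := d1 / (1 + lambda1) in w1.
  have a1E : (lambda1 + 1) * a1 = d1 by rewrite /a1; field; lra.
  have a2E : (lambda2 + 1) * a2 = d2 by rewrite /a2; field; lra.
  have a10 : 0 <= a1 by rewrite divr_ge0//; lra.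
  have a20 : 0 <= a2 by rewrite divr_ge0//; lra.
  (* Hence [a1 + a2 <= d1 + a2 <= lambda1 <= 1]: the slots fit into the block. For [th = true] the
     other conditions of the scheme reduce to [d1 + a2 <= lambda1] and [d2 + a1 <= lambda2]. *)
  have a1d : a1 <= d1 by rewrite -a1E mulrDl mul1r lerDr mulr_ge0// ltW.
  apply: (@scheme_dof_region _ _ _ muH_density _ _ c_model true a1 a2);
    rewrite ?la1E ?la2E ?mulr1n//; lra.
move=> h; set a1 := d1 / lambda1 in h; set a2 := d2 / lambda2 in h.
have a1E : lambda1 * a1 = d1 by rewrite mulrC divfK// gt_eqF.
have a2E : lambda2 * a2 = d2 by rewrite mulrC divfK// gt_eqF.
have a10 : 0 <= a1 by rewrite divr_ge0// ltW.
have a20 : 0 <= a2 by rewrite divr_ge0// ltW.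
have s1 : lambda1 * a1 <= lambda1 * (1 - a2).
  by rewrite (ler_wpM2l (ltW lambda1_gt0))// lerBrDr.
have s2 : lambda2 * a2 <= lambda2 * (1 - a1).
  by rewrite (ler_wpM2l (ltW lambda2_gt0))// lerBrDr addrC.
apply: (@scheme_dof_region _ _ _ muH_density _ _ c_model false a1 a2);
  rewrite ?la1E ?la2E ?mulr0n//; lra.
Qed.
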